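(* Suppose $|v_{ij}(x)|\lesssim\langle x\rangle^{-3-\epsilon}$ for some $\epsilon>0$ and all $i,j$. Fix $\phi=Uv\psi\in S_2(L^2\times L^2)$, where $\psi=c_0(1,0)^T-\mathcal G_0v^*\phi$ and $c_0=\langle(a,c)^T,T\phi\rangle/\|(a,c)^T\|_2^2$. Then $\phi\in S_3(L^2\times L^2)$ if and only if $\psi\in L^2\times L^2(\mathbb R^2)$.
   Context: Let $m>0$ and let $V:\mathbb R^2\to\mathbb C^{2\times2}$ be self-adjoint-matrix valued. Matrices: $\alpha_1=\begin{pmatrix}0&1\\1&0\end{pmatrix}$, $\alpha_2=\begin{pmatrix}0&-i\\i&0\end{pmatrix}$, $\alpha\cdot\nabla=\alpha_1\partial_1+\alpha_2\partial_2$; $\langle x\rangle=(1+|x|^2)^{1/2}$. Write $V=B^*\,\mathrm{diag}(\lambda_1,\lambda_2)\,B$ pointwise with $B(x)$ unitary and $\lambda_j(x)$ real, $\eta_j=|\lambda_j|^{1/2}$, $U=\mathrm{diag}(\mathrm{sign}\lambda_1,\mathrm{sign}\lambda_2)$ (convention $\mathrm{sign}(0)=1$), $v=\mathrm{diag}(\eta_1,\eta_2)B=\begin{pmatrix}a&b\\c&d\end{pmatrix}$, so $V=v^*Uv$. Assume $(a,c)^T$ is not identically zero. Let $I_1=\mathrm{diag}(1,0)$; let $M_{11},M_{22}$ be the integral operators with constant kernels $\mathrm{diag}(1,0)$, $\mathrm{diag}(0,1)$. Let $G_0f(x)=-\frac1{2\pi}\int_{\mathbb R^2}\log|x-y|f(y)\,dy$,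 $G_1f(x)=\int_{\mathbb R^2}|x-y|^2f(y)\,dy$, $\mathcal G_0=-i\alpha\cdot\nabla G_0+2mG_0I_1$, $\mathcal G_1=-i\alpha\cdot\nabla G_1+2mG_1I_1-\frac2mM_{11}-\frac2mM_{22}$, $T=U+v\mathcal G_0v^*$; $P$ is the orthogonal projection in $L^2\times L^2$ onto the span of $(a,c)^T$, $Q=1-P$. $S_1$ is the (orthogonal) Riesz projection onto the kernel of $QTQ$ on $Q(L^2\times L^2)$; every $\phi\in S_1(L^2\times L^2)$ satisfies $\phi=Uv\psi$ for the $\psi$ defined in the claim. $S_2$ is the Riesz projection onto the kernel of $T_1=S_1TPTS_1$ on $S_1(L^2\times L^2)$; $S_3$ is the Riesz projection onto the kernel of $T_2=S_2v\mathcal G_1v^*S_2$ on $S_2(L^2\times L^2)$. The inner product in $c_0$ is linear in the second slot: $\langle(a,c)^T,T\phi\rangle=\int(\overline a\,(T\phi)_1+\overline c\,(T\phi)_2)dx$. *)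

(* Defs.v *)
From HB Require Import structures.
From mathcomp Require Import all_boot all_order all_algebra.
From mathcomp Require Import all_classical all_reals all_analysis.
From mathcomp Require Import complex.

Set Implicit Arguments.
Unset Strict Implicit.
Unset Printing Implicit Defensive.

Import Order.TTheory GRing.Theory Num.Theory.
Import numFieldNormedType.Exports.

Local Open Scope classical_set_scope.
Local Open Scope complex_scope.
Local Open Scope ring_scope.
Local Open Scope sesquilinear_scope.

Notation plane R := (measurableTypeR R * measurableTypeR R)%type (only parsing).
Notation spinor R := (plane R -> 'cV[R[i]]_2) (only parsing).
Notation mxfield R := (plane R -> 'M[R[i]]_2) (only parsing).

Definition leb2 (R : realType) : {measure set (plane R) -> \bar R} :=
  (@lebesgue_measure R \x @lebesgue_measure R)%E.
Arguments leb2 R : clear implicits.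

Definition mat2 (K : pzRingType) (a b c d : K) : 'M[K]_2 :=
  \matrix_(i < 2, j < 2)
    if i == 0 then (if j == 0 then a else b) else (if j == 0 then c else d).

Definition col2 (K : pzRingType) (a b : K) : 'cV[K]_2 :=
  \col_(i < 2) if i == 0 then a else b.

Definition norm2 (R : realType) (x : plane R) : R :=
  Num.sqrt (x.1 ^+ 2 + x.2 ^+ 2).

Definition dist2 (R : realType) (x y : plane R) : R :=
  Num.sqrt ((x.1 - y.1) ^+ 2 + (x.2 - y.2) ^+ 2).

Definition japanese (R : realType) (x : plane R) : R :=
  Num.sqrt (1 + norm2 x ^+ 2).

(* [measurable_fun] refers to the Borel sigma-algebra, which is not complete;
   a function is Lebesgue measurable iff it agrees almost everywhere with a
   Borel one. *)
Definition lmeasurable (R : realType) (f : plane R -> R) : Prop :=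
  exists2 g : plane R -> R, measurable_fun setT g &
    {ae leb2 R, forall x, f x = g x}.

Definition clmeasurable (R : realType) (f : plane R -> R[i]) : Prop :=
  lmeasurable (fun x => complex.Re (f x)) /\
  lmeasurable (fun x => complex.Im (f x)).

Definition cint (R : realType) (f : plane R -> R[i]) : R[i] :=
  Rintegral (leb2 R) setT (fun x => complex.Re (f x)) +i*
  Rintegral (leb2 R) setT (fun x => complex.Im (f x)).

Definition vint (R : realType) (f : spinor R) : 'cV[R[i]]_2 :=
  \col_(i < 2) cint (fun y => f y i 0).

Definition aeq (R : realType) (u w : spinor R) : Prop :=
  {ae leb2 R, forall x, u x = w x}.

Definition is_L2 (R : realType) (u : spinor R) : Prop :=
  (forall i, clmeasurable (fun x => u x i 0)) /\
  (\int[leb2 R]_x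
     (\sum_(i < 2)
        (complex.Re (u x i 0) ^+ 2 + complex.Im (u x i 0) ^+ 2))%:E < +oo)%E.

Definition inner (R : realType) (u w : spinor R) : R[i] :=
  cint (fun x => \sum_(i < 2) (u x i 0)^* * w x i 0).

(* Spinor fields are not quotiented by almost everywhere equality: an operator
   is a map on representatives, and equalities in L^2 are [aeq]. *)

Definition mulop (R : realType) (A : mxfield R) (u : spinor R) : spinor R :=
  fun x => A x *m u x.

Definition adjfield (R : realType) (A : mxfield R) : mxfield R :=
  fun x => (A x)^t*.

Definition spanL2 (R : realType) (u : spinor R) : set (spinor R) :=
  [set w | is_L2 w /\ exists k : R[i], aeq w (fun x => k *: u x)].

Definition rangeL2 (R : realType) (S : spinor R -> spinor R) :
    set (spinor R) :=
  [set u | is_L2 u /\ exists2 w, is_L2 w & aeq u (S w)].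

Definition kernel_on (R : realType) (A : spinor R -> spinor R)
    (H : set (spinor R)) : set (spinor R) :=
  [set u | H u /\ aeq (A u) (fun=> 0)].

(* [M] is meant to be a closed subspace of L^2; the condition then determines
   [S u] up to almost everywhere equality, for every [u] in L^2. *)
Definition is_orth_proj (R : realType) (S : spinor R -> spinor R)
    (M : set (spinor R)) : Prop :=
  forall u, is_L2 u ->
    M (S u) /\ forall z, M z -> inner z (fun x => u x - S u x) = 0.

Definition compl_proj (R : realType) (P : spinor R -> spinor R)
    (u : spinor R) : spinor R :=
  fun x => u x - P u x.

Definition alpha1 (R : realType) : 'M[R[i]]_2 := mat2 0 1 1 0.
Definition alpha2 (R : realType) : 'M[R[i]]_2 := mat2 0 (- 'i%C) 'i%C 0.
Definition I1 (R : realType) : 'M[R[i]]_2 := mat2 1 0 0 0.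

(* Classical partial derivatives, with the junk value of [derive1] at points
   where they do not exist. For a square integrable [f] with enough decay,
   [G0 f] and [G1 f] have them almost everywhere, so the junk is invisible in
   L^2. *)
Definition partial1 (R : realType) (f : plane R -> R[i]) (x : plane R) : R[i] :=
  derive1 (fun t : R => complex.Re (f (t, x.2))) x.1 +i*
  derive1 (fun t : R => complex.Im (f (t, x.2))) x.1.

Definition partial2 (R : realType) (f : plane R -> R[i]) (x : plane R) : R[i] :=
  derive1 (fun t : R => complex.Re (f (x.1, t))) x.2 +i*
  derive1 (fun t : R => complex.Im (f (x.1, t))) x.2.

Definition dirac0 (R : realType) (f : spinor R) : spinor R :=
  fun x => - 'i%C *:
    (alpha1 R *m (\col_(j < 2) partial1 (fun y => f y j 0) x) +
     alpha2 R *m (\col_(j < 2) partial2 (fun y => f y j 0) x)).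

Definition G0 (R : realType) (f : spinor R) : spinor R :=
  fun x => (- (2 * pi)^-1)%:C *: vint (fun y => (ln (dist2 x y))%:C *: f y).

Definition G1 (R : realType) (f : spinor R) : spinor R :=
  fun x => vint (fun y => (dist2 x y ^+ 2)%:C *: f y).

Definition M11 (R : realType) (f : spinor R) : spinor R :=
  fun=> vint (fun y => mat2 1 0 0 0 *m f y).

Definition M22 (R : realType) (f : spinor R) : spinor R :=
  fun=> vint (fun y => mat2 0 0 0 1 *m f y).

Definition calG0 (R : realType) (m : R) (f : spinor R) : spinor R :=
  fun x => dirac0 (G0 f) x + (2 * m)%:C *: G0 (mulop (fun=> I1 R) f) x.

Definition calG1 (R : realType) (m : R) (f : spinor R) : spinor R :=
  fun x => dirac0 (G1 f) x + (2 * m)%:C *: G1 (mulop (fun=> I1 R) f) x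
           - (2 / m)%:C *: M11 f x - (2 / m)%:C *: M22 f x.

Definition sign1 (R : realType) (t : R) : R := if t < 0 then -1 else 1.

Definition Vfield (R : realType) (l1 l2 : plane R -> R) (B : mxfield R) :
    mxfield R :=
  fun x => (B x)^t* *m mat2 (l1 x)%:C 0 0 (l2 x)%:C *m B x.

Definition Ufield (R : realType) (l1 l2 : plane R -> R) : mxfield R :=
  fun x => mat2 (sign1 (l1 x))%:C 0 0 (sign1 (l2 x))%:C.

Definition vfield (R : realType) (l1 l2 : plane R -> R) (B : mxfield R) :
    mxfield R :=
  fun x =>
    mat2 (Num.sqrt `|l1 x|)%:C 0 0 (Num.sqrt `|l2 x|)%:C *m B x.

(* With [v x] the matrix of rows (a, b) and (c, d), this is (a, c)^T. *)
Definition accol (R : realType) (v : mxfield R) : spinor R :=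
  fun x => col 0 (v x).

Definition Top (R : realType) (m : R) (U v : mxfield R) (f : spinor R) :
    spinor R :=
  fun x => mulop U f x + mulop v (calG0 m (mulop (adjfield v) f)) x.

Definition QTQ (R : realType) (T P : spinor R -> spinor R) :
    spinor R -> spinor R :=
  compl_proj P \o T \o compl_proj P.

Definition T1op (R : realType) (T P S1 : spinor R -> spinor R) :
    spinor R -> spinor R :=
  S1 \o T \o P \o T \o S1.

Definition T2op (R : realType) (m : R) (v : mxfield R)
    (S2 : spinor R -> spinor R) : spinor R -> spinor R :=
  S2 \o mulop v \o calG1 m \o mulop (adjfield v) \o S2.

Definition c0 (R : realType) (m : R) (U v : mxfield R) (phi : spinor R) :
    R[i] :=
  inner (accol v) (Top m U v phi) / inner (accol v) (accol v).

Definition psi (R : realType) (m : R) (U v : mxfield R) (phi : spinor R) :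
    spinor R :=
  fun x => c0 m U v phi *: col2 1 0 - calG0 m (mulop (adjfield v) phi) x.

(* Main.v *)
From HB Require Import structures.
Require Import Defs.
From mathcomp Require Import all_boot all_order all_algebra.
From mathcomp Require Import all_classical all_reals all_analysis.
From mathcomp Require Import measurable_realfun complex ring lra.

(** Write f = v^* phi, with components f_1 and f_2 (entries 0 and 1 below).

    For phi in the range of S_2 two cancellations hold. First, phi lies in the
    range of Q, so it is orthogonal to (a, c)^T, that is, f_1 has integral zero.
    Secondly, P T phi = k (a, c)^T for a scalar k, and S_1 T P T phi = 0; since T
    is symmetric, pairing with phi gives |k|^2 ||(a, c)^T||^2 = 0. Hence c_0 = 0
    ([range_S2_c0]) and psi = - calG0 f.

    The kernel of calG0 is built from log |x - y| and its gradient in x. At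
    infinity the gradient is x / |x|^2 and log |x - y| is
    log |x| - (x . y) / |x|^2, up to terms that are square integrable in x after
    integration against f ([riesz_far], [log_far], [remainder_sqint]). The log |x|
    term and the leading term of the second component carry the integral of f_1
    and vanish. What remains of the first component is a multiple of
    (A_1 x_1 + A_2 x_2) / |x|^2, where
    A_1 = i int f_2 + 2 m int y_1 f_1 and A_2 = int f_2 + 2 m int y_2 f_1.
    No nonzero such combination is square integrable at infinity
    ([far_sqint_coef]), so psi is in L^2 exactly when A_1 = A_2 = 0 ([calG0_L2]).

    The kernel of calG1 is a polynomial of degree two. On pairs f, g whose first
    components have integral zero it reduces to the form
    - (1 / m) (conj (A_1 g) A_1 f + conj (A_2 g) A_2 f) ([calG1_form]), so
    S_2 v calG1 v^* phi = 0 also means A_1 = A_2 = 0: pair with phi for one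
    direction, and use the formula against every element of the range of S_2 for
    the other ([threshold_resonance]).

    The derivatives in calG0 are classical partial derivatives, and the density f
    is only square integrable with a weight. On almost every horizontal line the
    logarithmic potential is a primitive of the potential of the gradient kernel
    ([log_pot_line]), so Lebesgue's differentiation theorem applies there. To pass
    from almost every line to almost every point, the set of points of
    differentiability must be measurable; it is described by difference quotients
    with rational increments ([rat_derive]). *)

Set Implicit Arguments.
Unset Strict Implicit.
Unset Printing Implicit Defensive.
Import Order.TTheory GRing.Theory Num.Theory.
Import numFieldNormedType.Exports.
Local Open Scope classical_set_scope.
Local Open Scope complex_scope.
Local Open Scope ring_scope.
Local Open Scope sesquilinear_scope.

(** * Integrals of functions measurable up to a null set *)

Section AlmostEverywhereMeasurable.
Context d (T : measurableType d) (R : realType).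
Variable mu : {measure set T -> \bar R}.
Implicit Types f g h : T -> R.
Import HBNNSimple.

(** The integral of a nonnegative function is a supremum over the simple
    functions below it, and such a simple function can be cut off on a null
    set. *)
Lemma ae_ge0_integral_le (f g : T -> \bar R) :
  (forall x, 0 <= f x)%E -> (forall x, 0 <= g x)%E ->
  {ae mu, forall x, (f x <= g x)%E} -> (\int[mu]_x f x <= \int[mu]_x g x)%E.
Proof.
move=> f0 g0 [N [mN N0 subN]].
rewrite ge0_integralTE//; apply: ge_ereal_sup => _ /= [h hf <-].
pose h' := proj_nnsfun h (measurableC mN).
have h'E x : ~ N x -> h' x = h x.
  by move=> Nx; rewrite /h' -mrestrict /patch ifT // inE.
have h'g x : ((h' x)%:E <= g x)%E.
  rewrite /h' -mrestrict /patch; case: ifPn => [|_]; last exact: g0.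
  rewrite inE => Nx; apply: le_trans (hf x) _.
  by apply: contrapT => fg; apply: Nx; exact: subN.
rewrite -integralT_nnsfun.
have -> : (\int[mu]_x (h x)%:E = \int[mu]_x (h' x)%:E)%E.
  apply: ge0_ae_eq_integral => //.
  - exact/measurable_EFinP.
  - exact/measurable_EFinP.
  - by move=> x _; rewrite lee_fin.
  - by move=> x _; rewrite lee_fin.
  by exists N; split => // x hh; apply: contrapT => Nx; apply: hh => _; rewrite h'E.
rewrite [leRHS]ge0_integralTE//; apply: ereal_sup_ubound => /=.
by exists h' => //; rewrite -integralT_nnsfun.
Qed.

Lemma ae_integral_eq (f g : T -> \bar R) :
  {ae mu, forall x, f x = g x} -> (\int[mu]_x f x = \int[mu]_x g x)%E.
Proof.
move=> fg; rewrite integralE [RHS]integralE; congr (_ - _)%E; apply/eqP;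
  rewrite eq_le; apply/andP; split; apply: ae_ge0_integral_le => //;
  by apply: filterS fg => x fgx; rewrite ?funeposE ?funenegE fgx.
Qed.

Lemma ae_Rintegral_eq f g : {ae mu, forall x, f x = g x} ->
  Rintegral mu setT f = Rintegral mu setT g.
Proof.
move=> fg; rewrite /Rintegral; congr fine; apply: ae_integral_eq.
by apply: filterS fg => x ->.
Qed.

(** Measurability for the completion of the measure, through a measurable
    representative. *)
Definition aemeas f := exists2 g, measurable_fun setT g &
  {ae mu, forall x, f x = g x}.

Lemma measurable_aemeas f : measurable_fun setT f -> aemeas f.
Proof. by move=> mf; exists f => //; exact: aeW. Qed.

Lemma aemeas_eq f g : {ae mu, forall x, f x = g x} -> aemeas f -> aemeas g.
Proof.
move=> fg [h mh fh]; exists h => //.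
by apply: filterS2 fg fh => x -> .
Qed.

Lemma aemeas_op1 (op : R -> R) f :
  (forall f, measurable_fun setT f -> measurable_fun setT (op \o f)) ->
  aemeas f -> aemeas (fun x => op (f x)).
Proof.
move=> mop [f' mf ff]; exists (op \o f'); first exact: mop.
by apply: filterS ff => x /= ->.
Qed.

Lemma aemeas_op2 (op : R -> R -> R) f g :
  (forall f g, measurable_fun setT f -> measurable_fun setT g ->
    measurable_fun setT (fun x => op (f x) (g x))) ->
  aemeas f -> aemeas g -> aemeas (fun x => op (f x) (g x)).
Proof.
move=> mop [f' mf ff] [g' mg gg]; exists (fun x => op (f' x) (g' x)).
  exact: mop.
by apply: filterS2 ff gg => x -> ->.
Qed.

Lemma aemeasD f g : aemeas f -> aemeas g -> aemeas (fun x => f x + g x).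
Proof. by apply: aemeas_op2 => ? ? ? ?; exact: measurable_funD. Qed.

Lemma aemeasM f g : aemeas f -> aemeas g -> aemeas (fun x => f x * g x).
Proof. by apply: aemeas_op2 => ? ? ? ?; exact: measurable_funM. Qed.

Lemma aemeas_cst k : aemeas (fun=> k).
Proof. exact: measurable_aemeas. Qed.

Lemma aemeasZ k f : aemeas f -> aemeas (fun x => k * f x).
Proof. by move=> mf; apply: aemeasM => //; exact: aemeas_cst. Qed.

Lemma aemeasN f : aemeas f -> aemeas (fun x => - f x).
Proof.
by apply: (@aemeas_op1 -%R) => ? ?; exact: (measurableT_comp (@oppr_measurable R setT)).
Qed.

Lemma aemeas_norm f : aemeas f -> aemeas (fun x => `|f x|).
Proof. by apply: (@aemeas_op1 Num.norm) => ? ?; exact: measurableT_comp. Qed.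

Definition aeint f := aemeas f /\ (\int[mu]_x `|f x|%:E < +oo)%E.

Lemma aeintP f : aeint f <-> exists2 g, mu.-integrable setT (EFin \o g) &
  {ae mu, forall x, f x = g x}.
Proof.
split=> [[[g mg fg] intf]|[g /integrableP[mg intg] fg]].
  exists g => //; apply/integrableP; split; first exact/measurable_EFinP.
  apply: le_lt_trans intf; apply: ae_ge0_integral_le => //=.
  by apply: filterS fg => x ->.
split; first by exists g => //; exact/measurable_EFinP.
apply: le_lt_trans intg; apply: ae_ge0_integral_le => //=.
by apply: filterS fg => x ->.
Qed.

Lemma integrable_aeint f : mu.-integrable setT (EFin \o f) -> aeint f.
Proof. by move=> intf; apply/aeintP; exists f => //; exact: aeW. Qed.

Lemma aeint_eq f g : {ae mu, forall x, f x = g x} -> aeint f -> aeint g.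
Proof.
move=> fg /aeintP[h ih fh]; apply/aeintP; exists h => //.
by apply: filterS2 fg fh => x ->.
Qed.

Lemma aeint0 : aeint (fun=> 0).
Proof.
split; first exact: aemeas_cst.
by under eq_integral do rewrite normr0; rewrite integral0.
Qed.

Lemma aeintZ k f : aeint f -> aeint (fun x => k * f x).
Proof.
move=> /aeintP[g ig fg]; apply/aeintP; exists (fun x => k * g x).
  exact: eq_integrable (integrableZl measurableT k ig).
by apply: filterS fg => x ->.
Qed.

Lemma aeintN f : aeint f -> aeint (fun x => - f x).
Proof.
move=> /(aeintZ (-1)); apply: aeint_eq; apply: aeW => x /=.
by rewrite mulN1r.
Qed.

Lemma aeintD f g : aeint f -> aeint g -> aeint (fun x => f x + g x).
Proof.
move=> /aeintP[f' if' ff] /aeintP[g' ig' gg]; apply/aeintP.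
exists (fun x => f' x + g' x); first exact: eq_integrable (integrableD measurableT if' ig').
by apply: filterS2 ff gg => x -> ->.
Qed.

Lemma aeintB f g : aeint f -> aeint g -> aeint (fun x => f x - g x).
Proof. by move=> mf mg; apply: aeintD => //; exact: aeintN. Qed.

Lemma aeint_dom f g : aemeas f -> aeint g ->
  {ae mu, forall x, `|f x| <= g x} -> aeint f.
Proof.
move=> mf [_ intg] fg; split => //; apply: le_lt_trans intg.
apply: ae_ge0_integral_le => [x|x|]; rewrite ?lee_fin//.
by apply: filterS fg => x; rewrite lee_fin => /le_trans -> //; exact: ler_norm.
Qed.

Lemma aeint_norm f : aeint f -> aeint (fun x => `|f x|).
Proof.
move=> [mf intf]; split; first exact: aemeas_norm.
by under eq_integral do rewrite normr_id.
Qed.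

Lemma Rint_cstM k f : aeint f ->
  Rintegral mu setT (fun x => k * f x) = k * Rintegral mu setT f.
Proof.
move=> /aeintP[g ig fg]; rewrite (ae_Rintegral_eq fg) -RintegralZl//.
by apply: ae_Rintegral_eq; apply: filterS fg => x ->.
Qed.

Lemma RintD f g : aeint f -> aeint g ->
  Rintegral mu setT (fun x => f x + g x) =
  Rintegral mu setT f + Rintegral mu setT g.
Proof.
move=> /aeintP[f' if' ff] /aeintP[g' ig' gg].
rewrite (ae_Rintegral_eq ff) (ae_Rintegral_eq gg) -RintegralD//.
by apply: ae_Rintegral_eq; apply: filterS2 ff gg => x -> ->.
Qed.

Lemma RintN f : aeint f ->
  Rintegral mu setT (fun x => - f x) = - Rintegral mu setT f.
Proof.
move=> fi; rewrite -[RHS]mulN1r -Rint_cstM//.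
by apply: eq_Rintegral => x _; rewrite mulN1r.
Qed.

Lemma RintB f g : aeint f -> aeint g ->
  Rintegral mu setT (fun x => f x - g x) =
  Rintegral mu setT f - Rintegral mu setT g.
Proof. by move=> fi gi; rewrite RintD ?RintN//; exact: aeintN. Qed.

Lemma Rint_le f g : aeint f -> aeint g -> {ae mu, forall x, f x <= g x} ->
  Rintegral mu setT f <= Rintegral mu setT g.
Proof.
move=> fi gi fg; rewrite -subr_ge0 -RintB//.
rewrite (@ae_Rintegral_eq _ (fun x => `|g x - f x|)).
  by apply: Rintegral_ge0.
by apply: filterS fg => x fgx; rewrite ger0_norm// subr_ge0.
Qed.

Lemma Rint_norm_le f g : aeint f -> aeint g ->
  {ae mu, forall x, `|f x| <= g x} ->
  `|Rintegral mu setT f| <= Rintegral mu setT g.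
Proof.
move=> fi gi fg; rewrite ler_norml -RintN//; apply/andP; split.
  apply: Rint_le => //; first exact: aeintN.
  by apply: filterS fg => x; rewrite ler_norml => /andP[].
apply: Rint_le => //.
by apply: filterS fg => x; rewrite ler_norml => /andP[].
Qed.

Lemma ge0_Rint_eq0 f : aeint f -> (forall x, 0 <= f x) ->
  Rintegral mu setT f = 0 -> {ae mu, forall x, f x = 0}.
Proof.
move=> /aeintP[g ig fg] f0; rewrite (ae_Rintegral_eq fg) => g0.
have /integrableP[mg _] := ig.
have /(ae_eq_integral_abs mu measurableT mg) gg :
    (\int[mu]_x `|(EFin \o g) x| = 0)%E.
  have -> : (\int[mu]_x `|(EFin \o g) x| = \int[mu]_x (EFin \o g) x)%E.
    apply: ae_integral_eq.
    by apply: filterS fg => x /= fgx; rewrite ger0_norm// -fgx.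
  rewrite -[LHS]fineK; last exact: integrable_fin_num.
  by have -> : fine (\int[mu]_x (EFin \o g) x)%E = 0 by exact: g0.
by apply: filterS2 fg gg => x -> /(_ I) /= [].
Qed.

(** The finiteness condition has the form of the one in [is_L2]; [sqintP] is
    the form used in proofs. *)
Definition sqint f := aemeas f /\ (\int[mu]_x (f x ^+ 2)%:E < +oo)%E.

Lemma sqintP f : sqint f <-> aemeas f /\ aeint (fun x => f x ^+ 2).
Proof.
split=> [[mf intf]|[mf [_ intf]]]; split => //.
- split; first by under eq_fun do rewrite expr2; exact: aemeasM.
  by under eq_integral do rewrite ger0_norm ?sqr_ge0//.
- by under eq_integral do rewrite -[_ ^+ 2]ger0_norm ?sqr_ge0//.
Qed.

Lemma sqint_meas f : sqint f -> aemeas f. Proof. by case. Qed.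

Lemma sqint_sq f : sqint f -> aeint (fun x => f x ^+ 2).
Proof. by move=> /sqintP[]. Qed.

Lemma sqint_eq f g : {ae mu, forall x, f x = g x} -> sqint f -> sqint g.
Proof.
move=> fg /sqintP[mf fi]; apply/sqintP; split; first exact: aemeas_eq fg mf.
by apply: aeint_eq fi; apply: filterS fg => x ->.
Qed.

Lemma sqint_dom f g : aemeas f -> sqint g ->
  {ae mu, forall x, `|f x| <= `|g x|} -> sqint f.
Proof.
move=> mf /sqintP[mg gi] fg; apply/sqintP; split => //.
apply: aeint_dom gi _; first by under eq_fun do rewrite expr2; exact: aemeasM.
apply: filterS fg => x fgx; rewrite normrX -[leRHS]real_normK ?num_real//.
by rewrite ler_sqr ?nnegrE.
Qed.

Lemma sqintD f g : sqint f -> sqint g -> sqint (fun x => f x + g x).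
Proof.
move=> /sqintP[mf fi] /sqintP[mg gi]; apply/sqintP.
split; first exact: aemeasD.
apply: (aeint_dom _ (aeintZ 2 (aeintD fi gi))).
  by under eq_fun do rewrite expr2; apply: aemeasM; exact: aemeasD.
apply: aeW => x /=; rewrite ger0_norm ?sqr_ge0//.
have := sqr_ge0 (f x - g x); lra.
Qed.

Lemma sqintZ k f : sqint f -> sqint (fun x => k * f x).
Proof.
move=> /sqintP[mf fi]; apply/sqintP; split; first exact: aemeasZ.
have := aeintZ (k ^+ 2) fi; apply: aeint_eq; apply: aeW => x /=.
by rewrite exprMn.
Qed.

Lemma sqintN f : sqint f -> sqint (fun x => - f x).
Proof.
move=> /(sqintZ (-1)); apply: sqint_eq; apply: aeW => x /=.
by rewrite mulN1r.
Qed.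

Lemma sqintB f g : sqint f -> sqint g -> sqint (fun x => f x - g x).
Proof. by move=> mf mg; apply: sqintD => //; exact: sqintN. Qed.

Lemma sqint0 : sqint (fun=> 0).
Proof.
apply/sqintP; split; first exact: aemeas_cst.
by apply: aeint_eq aeint0; apply: aeW => x /=; rewrite expr0n.
Qed.

Lemma sqintM f g : sqint f -> sqint g -> aeint (fun x => f x * g x).
Proof.
move=> /sqintP[mf fi] /sqintP[mg gi].
apply: (aeint_dom _ (aeintD fi gi)); first exact: aemeasM.
apply: aeW => x /=; rewrite ler_norml; apply/andP; split.
  have := sqr_ge0 (f x + g x); have := sqr_ge0 (f x); have := sqr_ge0 (g x); nra.
have := sqr_ge0 (f x - g x); have := sqr_ge0 (f x); have := sqr_ge0 (g x); nra.
Qed.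

End AlmostEverywhereMeasurable.

(** * Integral operators with a Schur majorant *)

Section KernelOperators.
Context d (T : measurableType d) (R : realType).
Variable mu : {sigma_finite_measure set T -> \bar R}.
Implicit Types (f g h : T -> R) (F : T * T -> R).

(** The positive and negative parts are measurable in the parameter by
    Tonelli. *)
Lemma measurable_Rint_param F : measurable_fun setT F ->
  measurable_fun setT (fun x => Rintegral mu setT (fun y => F (x, y))).
Proof.
move=> mF; apply: measurableT_comp => //.
have mE : measurable_fun setT (EFin \o F) by exact/measurable_EFinP.
have E x : (\int[mu]_y (F (x, y))%:E = \int[mu]_y ((EFin \o F)^\+ (x, y))
    - \int[mu]_y ((EFin \o F)^\- (x, y)))%E.
  rewrite integralE; congr (_ - _)%E; apply: eq_integral => y _;
    by rewrite !(funeposE, funenegE).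
under eq_fun do rewrite E.
apply: emeasurable_funB.
  apply: (measurable_fun_fubini_tonelli_F (m2 := mu) ((EFin \o F)^\+)%E) => //.
  exact: measurable_funepos.
apply: (measurable_fun_fubini_tonelli_F (m2 := mu) ((EFin \o F)^\-)%E) => //.
exact: measurable_funeneg.
Qed.

Lemma measurable_section F x : measurable_fun setT F ->
  measurable_fun setT (fun y => F (x, y)).
Proof. by move=> mF; exact: measurableT_comp. Qed.

Lemma measurable_fun_fst f : measurable_fun setT f ->
  measurable_fun setT (fun z : T * T => f z.1).
Proof. by move=> mf; exact: measurableT_comp. Qed.

Lemma measurable_fun_snd f : measurable_fun setT f ->
  measurable_fun setT (fun z : T * T => f z.2).
Proof. by move=> mf; exact: measurableT_comp. Qed.

Lemma ge0_integrable12 F : measurable_fun setT F -> (forall z, 0 <= F z) ->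
  (\int[mu]_x \int[mu]_y (F (x, y))%:E < +oo)%E ->
  (mu \x mu)%E.-integrable setT (EFin \o F).
Proof.
move=> mF F0 iF; apply/integrable12ltyP; first exact/measurable_EFinP.
apply: le_lt_trans iF; rewrite le_eqVlt; apply/orP; left; apply/eqP.
by apply: eq_integral => x _; apply: eq_integral => y _ /=; rewrite ger0_norm.
Qed.

Section Schur.
Variables (k : T * T -> R) (C : R).
Hypotheses (mk : measurable_fun setT k) (k0 : forall z, 0 <= k z).
Hypothesis C0 : 0 < C.
Hypothesis kl : forall x, (\int[mu]_y (k (x, y))%:E <= C%:E)%E.
Hypothesis kr : forall y, (\int[mu]_x (k (x, y))%:E <= C%:E)%E.

(** Tonelli exchanges the integrals, and the bound on the columns of k
    integrates x out. *)
Lemma schur_integrable f : measurable_fun setT f ->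
  (\int[mu]_x `|f x|%:E < +oo)%E ->
  (\int[mu]_x \int[mu]_y (k (x, y) * `|f y|)%:E < +oo)%E.
Proof.
move=> mf fi.
have mF : measurable_fun setT (fun z => k z * `|f z.2|).
  by apply: measurable_funM => //; apply: measurableT_comp => //; exact: measurable_fun_snd.
rewrite (fubini_tonelli (m1 := mu) (m2 := mu)
  (fun z => (k z * `|f z.2|)%:E)) /=; last 2 first.
- exact/measurable_EFinP.
- by move=> z; rewrite lee_fin mulr_ge0.
have le1 : (\int[mu]_y \int[mu]_x (k (x, y) * `|f y|)%:E <=
    \int[mu]_y (C%:E * `|f y|%:E))%E.
  apply: ge0_le_integral => //.
  - by move=> y _; apply: integral_ge0 => x _; rewrite lee_fin mulr_ge0.
  - apply: (measurable_fun_fubini_tonelli_G (m1 := mu)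
      (fun z => (k z * `|f z.2|)%:E)); first exact/measurable_EFinP.
    by move=> z; rewrite lee_fin mulr_ge0.
  - by apply/measurable_EFinP; apply: measurable_funM => //; exact: measurableT_comp.
  move=> y _; under eq_integral do rewrite EFinM.
  rewrite ge0_integralZr//; last 2 first.
  - by apply/measurable_EFinP; exact: (measurableT_comp mk).
  - by move=> x _; rewrite lee_fin.
  by apply: lee_wpmul2r => //; rewrite lee_fin.
apply: le_lt_trans le1 _; rewrite ge0_integralZl//.
- by rewrite lte_mul_pinfty// lee_fin ltW.
- by apply/measurable_EFinP; exact: measurableT_comp.
- by rewrite lee_fin ltW.
Qed.

Lemma schur_ae f : aeint mu f ->
  {ae mu, forall x, aeint mu (fun y => k (x, y) * `|f y|)} /\
  aeint mu (fun x => Rintegral mu setT (fun y => k (x, y) * `|f y|)).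
Proof.
move=> /aeintP[g /integrableP[/measurable_EFinP mg gi] fg].
have fgk x : {ae mu, forall y, k (x, y) * `|g y| = k (x, y) * `|f y|}.
  by apply: filterS fg => y ->.
have mF : measurable_fun setT (fun z => k z * `|g z.2|).
  by apply: measurable_funM => //; apply: measurableT_comp => //; exact: measurable_fun_snd.
have Fi : (mu \x mu)%E.-integrable setT (EFin \o (fun z => k z * `|g z.2|)).
  by apply: ge0_integrable12 => //= [z|]; [rewrite mulr_ge0 | exact: schur_integrable].
split.
  have := ae_integrable1 Fi; apply: filterS => x /= ix.
  exact: (aeint_eq (fgk x) (integrable_aeint ix)).
apply: (@aeint_eq _ _ _ _
    (fun x => Rintegral mu setT (fun y => k (x, y) * `|g y|))).
  by apply: aeW => x; exact: ae_Rintegral_eq.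
split; first by apply: measurable_aemeas; exact: (measurable_Rint_param mF).
apply: le_lt_trans (schur_integrable mg gi); apply: ae_ge0_integral_le.
- by move=> x; rewrite lee_fin.
- by move=> x; apply: integral_ge0 => y _; rewrite lee_fin mulr_ge0.
have := ae_integrable1 Fi; apply: filterS => x /= ix.
rewrite ger0_norm; last by apply: Rintegral_ge0 => y _; rewrite mulr_ge0.
by rewrite /Rintegral fineK//; exact: integrable_fin_num.
Qed.

(** Schur test. By the Cauchy-Schwarz inequality for the weight k, the square
    of the potential of |f| is at most C times the potential of f^2, which is
    integrable by [schur_ae]. *)
Lemma schur_L2 f : sqint mu f ->
  {ae mu, forall x, aeint mu (fun y => k (x, y) * `|f y|)} /\
  sqint mu (fun x => Rintegral mu setT (fun y => k (x, y) * `|f y|)).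
Proof.
move=> f2; have [aek2 ik2] := schur_ae (sqint_sq f2).
have kx x : aeint mu (fun y => k (x, y)).
  split; first by apply: measurable_aemeas; exact: measurable_section.
  under eq_integral do rewrite ger0_norm//.
  by apply: le_lt_trans (kl x) _; rewrite ltry.
have [[g mg fg] _] := f2.
have fgk x : {ae mu, forall y, k (x, y) * `|g y| = k (x, y) * `|f y|}.
  by apply: filterS fg => y ->.
have mF : measurable_fun setT (fun z => k z * `|g z.2|).
  by apply: measurable_funM => //; apply: measurableT_comp => //; exact: measurable_fun_snd.
(* |f| <= 1 + f^2, and the rows of k are integrable *)
have ak : {ae mu, forall x, aeint mu (fun y => k (x, y) * `|f y|)}.
  apply: filterS aek2 => x kf2; apply: (aeint_dom _ (aeintD (kx x) kf2)).
    apply: (aemeas_eq (fgk x)); apply: measurable_aemeas.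
    exact: (measurable_section x mF).
  apply: aeW => y /=; rewrite ger0_norm ?mulr_ge0// -{2}[k _]mulr1 -mulrDr.
  rewrite ler_wpM2l// [`|_ ^+ 2|]ger0_norm ?sqr_ge0// -[f y ^+ 2]real_normK ?num_real//.
  have := sqr_ge0 (`|f y| - 1); have := sqr_ge0 (`|f y|); lra.
split => //; apply/sqintP; split.
  apply: (@aemeas_eq _ _ _ _
    (fun x => Rintegral mu setT (fun y => k (x, y) * `|g y|))).
    by apply: aeW => x; exact: ae_Rintegral_eq.
  by apply: measurable_aemeas; exact: (measurable_Rint_param mF).
apply: (aeint_dom _ (aeintZ C ik2)).
  under eq_fun do rewrite expr2.
  have mN : aemeas mu (fun x => Rintegral mu setT (fun y => k (x, y) * `|f y|)).
    apply: (@aemeas_eq _ _ _ _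
      (fun x => Rintegral mu setT (fun y => k (x, y) * `|g y|))).
      by apply: aeW => x; exact: ae_Rintegral_eq.
    by apply: measurable_aemeas; exact: (measurable_Rint_param mF).
  exact: aemeasM.
apply: filterS2 ak aek2 => x kf kf2; rewrite ger0_norm ?sqr_ge0//.
set A := Rintegral _ _ _; set B := Rintegral _ _ _.
(* the mean square deviation of |f| from A / C for the weight k is nonnegative *)
suff : 2 * (A / C) * A - (A / C) ^+ 2 * C <= B.
  have -> : 2 * (A / C) * A - (A / C) ^+ 2 * C = A ^+ 2 / C by field; rewrite gt_eqF.
  by rewrite ler_pdivrMr// [B * C]mulrC.
have kC : Rintegral mu setT (fun y => k (x, y)) <= C.
  rewrite -lee_fin /Rintegral fineK ?kl//.
  by apply/fin_numPlt; rewrite (lt_le_trans _ (integral_ge0 _ _))//=;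
    [apply: le_lt_trans (kl x) _; rewrite ltry | move=> y _; rewrite lee_fin].
apply: le_trans (_ : 2 * (A / C) * A
    - (A / C) ^+ 2 * Rintegral mu setT (fun y => k (x, y)) <= _).
  by rewrite lerD2l lerN2 ler_wpM2l ?sqr_ge0.
rewrite -!Rint_cstM// -RintB//; last 2 first.
- exact: aeintZ.
- exact: aeintZ.
apply: Rint_le => //; first by apply: aeintB; exact: aeintZ.
apply: aeW => y /=; rewrite [`|_ ^+ 2|]ger0_norm ?sqr_ge0//.
rewrite -[f y ^+ 2]real_normK ?num_real//.
rewrite -subr_ge0 [leRHS](_ : _ = k (x, y) * (`|f y| - A / C) ^+ 2); last by ring.
by rewrite mulr_ge0// sqr_ge0.
Qed.

Section Potential.
Variables (kap : T * T -> R) (w : T -> R).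
Hypotheses (mkap : measurable_fun setT kap) (mw : measurable_fun setT w).
Hypothesis w0 : forall x, 0 <= w x.
Hypothesis kap_le : forall x y, `|kap (x, y)| <= k (x, y) + w x * w y.

Let pot h x := Rintegral mu setT (fun y => kap (x, y) * h y).

Lemma pot_aemeas h : aemeas mu h -> aemeas mu (pot h).
Proof.
move=> [g mg hg]; apply: (@aemeas_eq _ _ _ _ (pot g)).
  apply: aeW => x; apply: ae_Rintegral_eq.
  by apply: filterS hg => y ->.
apply: measurable_aemeas.
apply: (measurable_Rint_param (F := fun z => kap z * g z.2)).
by apply: measurable_funM => //; exact: measurable_fun_snd.
Qed.

Lemma pot_section_aemeas h x : aemeas mu h ->
  aemeas mu (fun y => kap (x, y) * h y).
Proof.
move=> mh; apply: aemeasM => //; apply: measurable_aemeas.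
exact: measurable_section.
Qed.

Lemma pot_aeint h : sqint mu h -> aeint mu (fun y => w y * h y) ->
  {ae mu, forall x, aeint mu (fun y => kap (x, y) * h y)}.
Proof.
move=> h2 wh; have [kh _] := schur_L2 h2; apply: filterS kh => x khx.
apply: (aeint_dom _ (aeintD khx (aeintZ (w x) (aeint_norm wh)))).
  by apply: pot_section_aemeas; exact: sqint_meas h2.
apply: aeW => y; rewrite normrM (le_trans (ler_wpM2r _ (kap_le x y)))//.
by rewrite mulrDl normrM [`|w y|]ger0_norm// mulrA.
Qed.

Lemma pot_le h : sqint mu h -> aeint mu (fun y => w y * h y) ->
  {ae mu, forall x, `|pot h x| <=
    Rintegral mu setT (fun y => k (x, y) * `|h y|) +
    w x * Rintegral mu setT (fun y => w y * `|h y|)}.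
Proof.
move=> h2 wh; have [kh _] := schur_L2 h2.
have wh' : aeint mu (fun y => w y * `|h y|).
  apply: aeint_eq (aeint_norm wh); apply: aeW => y.
  by rewrite normrM [`|w y|]ger0_norm.
apply: filterS2 kh (pot_aeint h2 wh) => x khx kx.
rewrite -Rint_cstM// -RintD//; last exact: aeintZ.
apply: Rint_norm_le => //; first by apply: aeintD => //; exact: aeintZ.
apply: aeW => y; rewrite normrM (le_trans (ler_wpM2r _ (kap_le x y)))//.
by rewrite mulrDl mulrA.
Qed.

(** Fubini. The integrand g(x) kap(x, y) h(y) is dominated by k(x, y) (g(x)^2
    + h(y)^2), integrable by the Schur bounds, plus the product of |w g| and
    |w h|. *)
Lemma pot_form g h : sqint mu h -> aeint mu (fun y => w y * h y) ->
  sqint mu g -> aeint mu (fun y => w y * g y) ->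
  aeint mu (fun x => g x * pot h x) /\
  Rintegral mu setT (fun x => g x * pot h x) =
  Rintegral mu setT (fun y => h y * Rintegral mu setT (fun x => kap (x, y) * g x)).
Proof.
move=> h2 wh g2 wg.
have [[h' mh hh] _] := h2; have [[g' mg gg] _] := g2.
have {}h2 : sqint mu h' by exact: sqint_eq hh h2.
have {}g2 : sqint mu g' by exact: sqint_eq gg g2.
have {}wh : aeint mu (fun y => w y * h' y).
  by apply: aeint_eq wh; apply: filterS hh => x ->.
have {}wg : aeint mu (fun y => w y * g' y).
  by apply: aeint_eq wg; apply: filterS gg => x ->.
pose F z := kap z * g' z.1 * h' z.2.
have mF : measurable_fun setT F.
  by apply: measurable_funM; [apply: measurable_funM => //; exact: measurable_fun_fst
    | exact: measurable_fun_snd].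
pose F1 z := k z * `|g' z.1 ^+ 2|.
pose F2 z := k z * `|h' z.2 ^+ 2|.
pose F3 z := `|w z.1 * g' z.1| * `|w z.2 * h' z.2|.
have mg2 : measurable_fun setT (fun z : T * T => `|g' z.1 ^+ 2|).
  apply: measurableT_comp => //; apply: measurable_funX; exact: measurable_fun_fst.
have mh2 : measurable_fun setT (fun z : T * T => `|h' z.2 ^+ 2|).
  apply: measurableT_comp => //; apply: measurable_funX; exact: measurable_fun_snd.
have F1i : (mu \x mu)%E.-integrable setT (EFin \o F1).
  have mF1 : measurable_fun setT F1 by exact: measurable_funM.
  apply: ge0_integrable12 => //= [z|]; first by rewrite mulr_ge0.
  have le1 : (\int[mu]_x \int[mu]_y (F1 (x, y))%:E <=
      \int[mu]_x (C%:E * (`|g' x ^+ 2|)%:E))%E.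
    apply: ge0_le_integral => //.
    - by move=> y _; apply: integral_ge0 => x _; rewrite lee_fin mulr_ge0.
    - apply: (measurable_fun_fubini_tonelli_F (m2 := mu) (EFin \o F1));
        first exact/measurable_EFinP.
      by move=> z; rewrite lee_fin mulr_ge0.
    - apply/measurable_EFinP; apply: measurable_funM => //.
      by apply: measurableT_comp => //; exact: measurable_funX.
    move=> x _; rewrite /F1 /=.
    under eq_integral do rewrite EFinM.
    rewrite ge0_integralZr//; last 2 first.
    - by apply/measurable_EFinP; exact: measurable_section.
    - by move=> y _; rewrite lee_fin.
    by apply: lee_wpmul2r => //; rewrite lee_fin.
  apply: le_lt_trans le1 _; rewrite ge0_integralZl//.
  - rewrite lte_mul_pinfty//; first by rewrite lee_fin ltW.
    by have [_] := sqint_sq g2.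
  - apply/measurable_EFinP.
    by apply: measurableT_comp => //; exact: measurable_funX.
  - by rewrite lee_fin ltW.
have F2i : (mu \x mu)%E.-integrable setT (EFin \o F2).
  have mF2 : measurable_fun setT F2 by exact: measurable_funM.
  apply: ge0_integrable12 => //= [z|]; first by rewrite mulr_ge0.
  apply: (schur_integrable (f := fun x => h' x ^+ 2)); first exact: measurable_funX.
  by have [_] := sqint_sq h2.
have F3i : (mu \x mu)%E.-integrable setT (EFin \o F3).
  have mwg : measurable_fun setT (fun x => `|w x * g' x|).
    by apply: measurableT_comp => //; exact: measurable_funM.
  have mwh : measurable_fun setT (fun x => `|w x * h' x|).
    by apply: measurableT_comp => //; exact: measurable_funM.
  have mF3 : measurable_fun setT F3.
    by apply: measurable_funM; [exact: (measurable_fun_fst mwg) |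
      exact: (measurable_fun_snd mwh)].
  apply: ge0_integrable12 => //= [z|]; first by rewrite mulr_ge0.
  have -> : (\int[mu]_x \int[mu]_y (F3 (x, y))%:E =
      \int[mu]_x (`|w x * g' x|%:E * \int[mu]_y `|w y * h' y|%:E))%E.
    apply: eq_integral => x _; rewrite -ge0_integralZl//.
    by apply/measurable_EFinP.
  rewrite ge0_integralZr//; last 2 first.
  - exact/measurable_EFinP.
  - by apply: integral_ge0 => y _; rewrite lee_fin.
  have [_ wg'] := wg; have [_ wh'] := wh.
  apply: lte_mul_pinfty => //; first by apply: integral_ge0 => y _; rewrite lee_fin.
  by rewrite fin_num_abs gee0_abs//; apply: integral_ge0 => y _; rewrite lee_fin.
have Fi : (mu \x mu)%E.-integrable setT (EFin \o F).
  have := integrableD measurableT (integrableD measurableT F1i F2i) F3i.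
  apply: le_integrable => //; first exact/measurable_EFinP.
  move=> [x y] _ /=; rewrite lee_fin /F /= !normrM.
  rewrite [leRHS]ger0_norm; last first.
    by rewrite !addr_ge0// /F1 /F2 /F3 ?mulr_ge0// ?k0.
  have gh : `|g' x| * `|h' y| <= `|g' x ^+ 2| + `|h' y ^+ 2|.
    rewrite !normrX; have := sqr_ge0 (`|g' x| - `|h' y|).
    have := sqr_ge0 (`|g' x|); have := sqr_ge0 (`|h' y|); lra.
  apply: le_trans (_ : (k (x, y) + w x * w y) * (`|g' x| * `|h' y|) <= _).
    by rewrite -mulrA ler_wpM2r ?mulr_ge0.
  rewrite mulrDl; apply: lerD.
    by rewrite /F1 /F2 -mulrDr ler_wpM2l.
  rewrite /F3 /= !normrM [`|w x|]ger0_norm// [`|w y|]ger0_norm//.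
  by rewrite le_eqVlt; apply/orP; left; apply/eqP; ring.
have e1 x : {ae mu, forall y, kap (x, y) * h y = kap (x, y) * h' y}.
  by apply: filterS hh => y ->.
have e2 y : {ae mu, forall x, kap (x, y) * g x = kap (x, y) * g' x}.
  by apply: filterS gg => x ->.
have sx : {ae mu, forall x, g x * pot h x = Rintegral mu setT (fun y => F (x, y))}.
  apply: filterS2 gg (pot_aeint h2 wh) => x gx px.
  rewrite gx /pot (ae_Rintegral_eq (e1 x)) -Rint_cstM//.
  by apply: eq_Rintegral => y _; rewrite /F /=; ring.
have sy : {ae mu, forall y, h y * Rintegral mu setT (fun x => kap (x, y) * g x) =
    Rintegral mu setT (fun x => F (x, y))}.
  have iy := ae_integrable2 Fi; apply: filterS2 hh iy => y hy Fy.
  rewrite hy (ae_Rintegral_eq (e2 y)).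
  (* integrability of F in x gives that of kap g only where h' y is nonzero *)
  have [hy0|hy0] := eqVneq (h' y) 0.
    rewrite hy0 mul0r /Rintegral integral0_eq// => x _.
    by rewrite /F /= hy0 mulr0.
  rewrite -Rint_cstM; last first.
    apply: aeint_eq (aeintZ (h' y)^-1 (integrable_aeint Fy)).
    by apply: aeW => x; rewrite /F /=; field.
  by apply: eq_Rintegral => x _; rewrite /F /=; ring.
have iF := integrable_fubini_F Fi.
have iFf : {ae mu, forall x, fubini_F mu (EFin \o F) x =
    (Rintegral mu setT (fun y => F (x, y)))%:E}.
  have := ae_integrable1 Fi; apply: filterS => x ix.
  by rewrite /fubini_F /Rintegral fineK//; exact: integrable_fin_num.
have iGf : {ae mu, forall x, fubini_G mu (EFin \o F) x =
    (Rintegral mu setT (fun y => F (y, x)))%:E}.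
  have := ae_integrable2 Fi; apply: filterS => x ix.
  by rewrite /fubini_G /Rintegral fineK//; exact: integrable_fin_num.
split.
  apply: (@aeint_eq _ _ _ _ (fun x => Rintegral mu setT (fun y => F (x, y)))).
    by apply: filterS sx => x ->.
  split; first by apply: measurable_aemeas; exact: (measurable_Rint_param mF).
  have /integrableP[_] := iF; apply: le_lt_trans.
  apply: ae_ge0_integral_le => //.
  by apply: filterS iFf => x /= ->; rewrite abse_EFin.
rewrite (ae_Rintegral_eq sx) (ae_Rintegral_eq sy) /Rintegral; congr fine.
transitivity (\int[mu]_x fubini_F mu (EFin \o F) x)%E.
  by apply: ae_integral_eq; apply: filterS iFf => x /= ->.
transitivity (\int[mu]_x fubini_G mu (EFin \o F) x)%E.
  by rewrite integral12_prod_meas1// -integral21_prod_meas1.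
by apply: ae_integral_eq; apply: filterS iGf => x /= ->.
Qed.

End Potential.
End Schur.
End KernelOperators.

(** * Lebesgue measure and distance on the plane *)

Section PlaneMeasure.
Variable R : realType.
Implicit Types (a x y : plane R) (f : plane R -> R).

Lemma leb2_sigma_finite : sigma_finite setT (leb2 R).
Proof.
have /sigma_finiteP[F [TF ndF Foo]] := sigma_finiteT (@lebesgue_measure R).
exists (fun n => F n `*` F n).
  rewrite -setXTT TF predeqE => -[x y]; split.
    move=> [/= [n _ Fnx] [k _ Gky]]; exists (maxn n k) => //; split.
    - by move: x Fnx; exact/subsetPset/ndF/leq_maxl.
    - by move: y Gky; exact/subsetPset/ndF/leq_maxr.
  by move=> [n _ []/= ? ?]; split; exists n.
move=> k; have [? ?] := Foo k.
split; first exact: measurableX.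
have -> : leb2 R (F k `*` F k) =
    (lebesgue_measure (F k) * lebesgue_measure (F k))%E.
  exact: product_measure1E.
by rewrite lte_mul_pinfty// ge0_fin_numE.
Qed.

(** The product measure as a sigma-finite measure, the form that Fubini
    theorems take. *)
Definition leb2s : set (plane R) -> \bar R := leb2 R.
HB.instance Definition _ := Measure.copy leb2s (leb2 R).
HB.instance Definition _ :=
  @Measure_isSigmaFinite.Build _ _ _ leb2s leb2_sigma_finite.

Definition square a (r : R) : set (plane R) :=
  `[a.1 - r, a.1 + r] `*` `[a.2 - r, a.2 + r].

Lemma measurable_square a r : measurable (square a r).
Proof. by apply: measurableX; exact: measurable_itv. Qed.

Lemma leb2_box (a b c e : R) : a <= b -> c <= e ->
  leb2 R (`[a, b] `*` `[c, e]) = ((b - a) * (e - c))%:E.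
Proof.
move=> ab ce; transitivity ((@lebesgue_measure R `[a, b]) *
    (@lebesgue_measure R `[c, e]))%E.
  have := @product_measure1E _ _ _ _ R (@lebesgue_measure R) (@lebesgue_measure R) `[a, b]%classic `[c, e]%classic. by apply; exact: measurable_itv.
rewrite !lebesgue_measure_itv /= !lte_fin EFinM; congr (_ * _)%E.
  case: ltP => // ba; have -> : a = b by apply/eqP; rewrite eq_le ab ba.
  by rewrite subrr.
case: ltP => // ba; have -> : c = e by apply/eqP; rewrite eq_le ce ba.
by rewrite subrr.
Qed.

Lemma leb2_square a r : 0 <= r -> leb2 R (square a r) = ((2 * r) ^+ 2)%:E.
Proof.
move=> r0; rewrite /square leb2_box; last 2 first.
- by lra.
- by lra.
by congr (_%:E); ring.
Qed.

(** The function is dominated by the sum of the constants c n on the squares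
    of radius r n, whose integrals are dominated by a geometric series of sum
    K. *)
Lemma squares_integral_le f a (r c : nat -> R) (K : R) :
  (forall n, 0 <= r n) -> (forall n, 0 <= c n) -> 0 <= K ->
  (forall x, 0 <= f x) ->
  (forall x, f x != 0 -> exists2 n, square a (r n) x & f x <= c n) ->
  (forall n, c n * (2 * r n) ^+ 2 <= K / (2 ^ n.+1)%:R) ->
  (\int[leb2 R]_x (f x)%:E <= K%:E)%E.
Proof.
move=> r0 c0 K0 f0 fc cK.
pose g n x : \bar R := (c n * \1_(square a (r n)) x)%:E.
have mg n : measurable_fun setT (g n).
  apply/measurable_EFinP; apply: measurable_funM => //.
  by apply: measurable_indic; exact: measurable_square.
have g0 n x : (0 <= g n x)%E by rewrite lee_fin mulr_ge0.
apply: (@le_trans _ _ (\int[leb2 R]_x \sum_(n <oo) g n x)%E).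
  apply: ae_ge0_integral_le.
  - by move=> x; rewrite lee_fin.
  - by move=> x; apply: nneseries_ge0.
  apply: aeW => x; have [->|fx0] := eqVneq (f x) 0.
    by apply: nneseries_ge0.
  have [n xn fxc] := fc x fx0.
  apply: (@le_trans _ _ (\sum_(0 <= i < n.+1) g i x)%E).
    rewrite big_nat_recr//=; apply: (@le_trans _ _ (g n x)).
      by rewrite /g indicE mem_set// mulr1 lee_fin.
    by apply: leeDr; apply: sume_ge0.
  by apply: nneseries_lim_ge.
rewrite integral_nneseries//.
apply: (@le_trans _ _ (\sum_(n <oo) (K / (2 ^ n.+1)%:R)%:E)%E); last first.
  exact: epsilon_trick0.
apply: lee_nneseries => [n _ _|n _].
  by apply: integral_ge0.
have -> : (\int[leb2 R]_x g n x =
    (c n)%:E * \int[leb2 R]_x (\1_(square a (r n)) x)%:E)%E.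
  rewrite -ge0_integralZl// ?lee_fin//.
  by apply/measurable_EFinP; apply: measurable_indic; exact: measurable_square.
rewrite integral_indic//; last exact: measurable_square.
rewrite setIT (_ : (_ * _)%E = (c n * (2 * r n) ^+ 2)%:E) ?lee_fin//.
by rewrite EFinM -(leb2_square a).
Qed.

Lemma geometric_scale (b t : R) : 1 < b -> 1 <= t ->
  exists n : nat, t <= b ^+ n <= b * t.
Proof.
move=> b1 t1.
have b0 : 0 < b by exact: lt_trans b1.
have /ex_minnP[n tn nmin] : exists n : nat, t <= b ^+ n.
  have [n hn] : exists n : nat, t <= 1 + n%:R * (b - 1).
    have bp : 0 < b - 1 by rewrite subr_gt0.
    have [n hn] : exists n : nat, t / (b - 1) < n%:R.
      by exists (Num.bound (t / (b - 1))); apply: archi_boundP;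
        rewrite divr_ge0// ?(ltW bp)// (le_trans _ t1).
    exists n; rewrite ltr_pdivrMr// in hn; apply: ltW; apply: lt_le_trans hn _.
    by rewrite lerDr.
  exists n; apply: le_trans hn _.
  elim: n => [|n IH]; first by rewrite mul0r addr0 expr0.
  rewrite exprS; apply: le_trans (_ : b * (1 + n%:R * (b - 1)) <= _); last first.
    by rewrite ler_pM2l.
  rewrite -natr1; have : 0 <= n%:R * (b - 1) ^+ 2 by rewrite mulr_ge0// sqr_ge0.
  lra.
exists n; rewrite tn /=; case: n tn nmin => [|n] tn nmin.
  by rewrite expr0 -[leLHS]mulr1 ler_pM// ltW.
rewrite exprS ler_pM2l//; rewrite leNgt; apply/negP => /ltW /nmin.
by rewrite ltnn.
Qed.

Lemma dist2_ge0 x y : 0 <= dist2 x y. Proof. exact: sqrtr_ge0. Qed.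

Lemma norm2_ge0 x : 0 <= norm2 x. Proof. exact: sqrtr_ge0. Qed.

Lemma sqr_norm2 x : norm2 x ^+ 2 = x.1 ^+ 2 + x.2 ^+ 2.
Proof. by rewrite sqr_sqrtr// addr_ge0// sqr_ge0. Qed.

Lemma sqr_dist2 x y : dist2 x y ^+ 2 = (x.1 - y.1) ^+ 2 + (x.2 - y.2) ^+ 2.
Proof. by rewrite sqr_sqrtr// addr_ge0// sqr_ge0. Qed.

Lemma sqr_japanese x : japanese x ^+ 2 = 1 + norm2 x ^+ 2.
Proof. by rewrite sqr_sqrtr// addr_ge0// sqr_ge0. Qed.

Lemma dist2C x y : dist2 x y = dist2 y x.
Proof. by rewrite /dist2 -(opprB y.1) -(opprB y.2) !sqrrN. Qed.

Lemma dist2_sub x y : dist2 x y = norm2 (x.1 - y.1, x.2 - y.2).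
Proof. by []. Qed.

Lemma le_normr_sqr (u v : R) : 0 <= v -> u ^+ 2 <= v ^+ 2 -> `|u| <= v.
Proof. by move=> v0; rewrite -[u ^+ 2]real_normK ?num_real// ler_sqr ?nnegrE. Qed.

Lemma norm2_coord1 x : `|x.1| <= norm2 x.
Proof.
apply: le_normr_sqr; first exact: norm2_ge0.
by rewrite sqr_norm2 lerDl sqr_ge0.
Qed.

Lemma norm2_coord2 x : `|x.2| <= norm2 x.
Proof.
apply: le_normr_sqr; first exact: norm2_ge0.
by rewrite sqr_norm2 lerDr sqr_ge0.
Qed.

Lemma dist2_coord1 x y : `|x.1 - y.1| <= dist2 x y.
Proof. exact: (norm2_coord1 (x.1 - y.1, x.2 - y.2)). Qed.

Lemma dist2_coord2 x y : `|x.2 - y.2| <= dist2 x y.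
Proof. exact: (norm2_coord2 (x.1 - y.1, x.2 - y.2)). Qed.

Lemma norm2_cauchy x y : `|x.1 * y.1 + x.2 * y.2| <= norm2 x * norm2 y.
Proof.
apply: le_normr_sqr; first by rewrite mulr_ge0 ?norm2_ge0.
rewrite exprMn !sqr_norm2; have := sqr_ge0 (x.1 * y.2 - x.2 * y.1); nra.
Qed.

Lemma dist2_sqrE x y : dist2 x y ^+ 2 =
  norm2 x ^+ 2 - 2 * (x.1 * y.1 + x.2 * y.2) + norm2 y ^+ 2.
Proof. by rewrite sqr_dist2 !sqr_norm2; ring. Qed.

Lemma dist2_le x y : dist2 x y <= norm2 x + norm2 y.
Proof.
rewrite -ler_sqr ?nnegrE ?addr_ge0 ?norm2_ge0 ?dist2_ge0// dist2_sqrE.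
have := norm2_cauchy x y; rewrite ler_norml => /andP[]; lra.
Qed.

Lemma norm2_le x y : norm2 x <= dist2 x y + norm2 y.
Proof.
rewrite -ler_sqr ?nnegrE ?addr_ge0 ?norm2_ge0 ?dist2_ge0//.
have := norm2_cauchy (x.1 - y.1, x.2 - y.2) y; rewrite -dist2_sub /=.
have -> : norm2 x ^+ 2 = dist2 x y ^+ 2
    + 2 * ((x.1 - y.1) * y.1 + (x.2 - y.2) * y.2) + norm2 y ^+ 2.
  by rewrite sqr_dist2 !sqr_norm2; ring.
rewrite ler_norml => /andP[]; lra.
Qed.

Lemma japanese_ge1 x : 1 <= japanese x.
Proof.
rewrite -ler_sqr ?nnegrE ?sqrtr_ge0// sqr_japanese expr1n lerDl.
exact: sqr_ge0.
Qed.

Lemma japanese_gt0 x : 0 < japanese x.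
Proof. by apply: lt_le_trans (japanese_ge1 x). Qed.

Lemma norm2_le_japanese x : norm2 x <= japanese x.
Proof.
rewrite -ler_sqr ?nnegrE ?sqrtr_ge0// sqr_japanese.
by rewrite -[leLHS]add0r lerD2r.
Qed.

Lemma japanese_le x : japanese x <= 1 + norm2 x.
Proof.
have n0 := norm2_ge0 x.
rewrite -ler_sqr ?nnegrE ?sqrtr_ge0 ?addr_ge0// sqr_japanese.
by have := n0; nra.
Qed.

Lemma square_dist2 x y r : dist2 x y <= r -> square x r y.
Proof.
move=> xyr; split => /=; rewrite in_itv/=.
  have := le_trans (dist2_coord1 x y) xyr.
  by rewrite ler_norml => /andP[? ?]; apply/andP; split; lra.
have := le_trans (dist2_coord2 x y) xyr.
by rewrite ler_norml => /andP[? ?]; apply/andP; split; lra.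
Qed.

(** Common majorant near the diagonal of the logarithm and of the length of
    its gradient. *)
Definition near_ker (z : plane R * plane R) : R :=
  if dist2 z.1 z.2 <= 1 then (dist2 z.1 z.2)^-1 else 0.

Lemma near_ker_ge0 z : 0 <= near_ker z.
Proof. by rewrite /near_ker; case: ifP => // _; rewrite invr_ge0 dist2_ge0. Qed.

Lemma near_ker_dyadic x y : near_ker (x, y) != 0 ->
  exists2 n, square x (2 * 2^-1 ^+ n) y & near_ker (x, y) <= 2 ^+ n.
Proof.
rewrite /near_ker /=; case: ifP => [xy1|_]; last by rewrite eqxx.
rewrite invr_eq0 => xy0.
have xyp : 0 < dist2 x y by rewrite lt_def xy0 dist2_ge0.
have [//||n /andP[n1 n2]] := @geometric_scale 2 (dist2 x y)^-1.
  by rewrite ltr1n.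
  by rewrite invf_ge1.
exists n => //; apply: square_dist2.
rewrite exprVn; have p2 : 0 < 2 ^+ n :> R by exact: exprn_gt0.
by move: n2; rewrite ler_pdivlMr// mulrC ler_pdivlMr.
Qed.

(** Where the kernel has size about 2^n, the point y lies in a square of area
    about 4^(- n). *)
Lemma near_ker_int x : (\int[leb2 R]_y (near_ker (x, y))%:E <= 32%:E)%E.
Proof.
apply: (@squares_integral_le _ x (fun n => 2 * 2^-1 ^+ n) (fun n => 2 ^+ n)).
- by move=> n; rewrite mulr_ge0// exprn_ge0// invr_ge0.
- by move=> n; exact: exprn_ge0.
- by [].
- by move=> y; exact: near_ker_ge0.
- by move=> y; exact: near_ker_dyadic.
(* 2^n (4 2^(- n))^2 = 32 / 2^(n + 1) *)
move=> n; rewrite natrX exprVn [_ ^+ n.+1]exprS.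
have p2 : 2 ^+ n != 0 :> R by rewrite expf_neq0.
by rewrite le_eqVlt; apply/orP; left; apply/eqP; field.
Qed.

Lemma near_kerC x y : near_ker (x, y) = near_ker (y, x).
Proof. by rewrite /near_ker /= dist2C. Qed.

(** Cover the plane by squares of radius b^n. With b = 2^(1 / (s - 2)), the
    bound b^(- s n) on the integrand times the area 4 b^(2 n) halves with each
    n. *)
Lemma japanese_powR_int (s : R) : 2 < s ->
  (\int[leb2 R]_x (japanese x `^ (- s))%:E < +oo)%E.
Proof.
move=> s2; pose b : R := 2 `^ (s - 2)^-1.
have s20 : 0 < s - 2 by rewrite subr_gt0.
have b1 : 1 < b.
  have <- : 1 `^ (s - 2)^-1 = 1 by rewrite powR1.
  by rewrite gt0_ltr_powR ?nnegrE ?invr_gt0// ltr1n.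
have b0 : 0 < b by exact: lt_trans b1.
have bs : b `^ (- s) * b ^+ 2 = 2^-1.
  rewrite -[b ^+ 2]powR_mulrn ?(ltW b0)// -powRD; last first.
    by apply/implyP => _; rewrite gt_eqF.
  have -> : - s + 2 = - (s - 2) by ring.
  rewrite /b -powRrM mulrN mulVf ?gt_eqF//.
  by rewrite powR_inv1.
clearbody b; pose K : R := 8 * b `^ s.
apply: (@le_lt_trans _ _ K%:E); last exact: ltry.
apply: (@squares_integral_le _ (0, 0) (fun n => b ^+ n)
  (fun n => b `^ s * (b `^ (- s)) ^+ n)).
- by move=> n; rewrite exprn_ge0// ltW.
- by move=> n; rewrite mulr_ge0 ?exprn_ge0 ?powR_ge0.
- by rewrite mulr_ge0 ?powR_ge0.
- by move=> x; exact: powR_ge0.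
- move=> x _; have [n /andP[n1 n2]] := geometric_scale b1 (japanese_ge1 x).
  exists n.
    apply: square_dist2; rewrite dist2C dist2_sub /= !subr0.
    by apply: le_trans n1; exact: norm2_le_japanese.
  have xb : b ^+ n / b <= japanese x by rewrite ler_pdivrMr// mulrC.
  have bn0 : 0 < b ^+ n / b by rewrite divr_gt0// exprn_gt0.
  have -> : b `^ s * (b `^ (- s)) ^+ n = (b ^+ n / b) `^ (- s).
    rewrite powRM ?exprn_ge0 ?invr_ge0 ?(ltW b0)// mulrC.
    rewrite -[(b `^ (- s)) ^+ n]powR_mulrn ?powR_ge0// powRAC powR_mulrn ?(ltW b0)//.
    have -> : b^-1 `^ (- s) = b `^ s; last by rewrite mulrC.
    by rewrite -powR_inv1 ?(ltW b0)// -powRrM mulN1r opprK.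
  rewrite !powRN lef_pV2 ?posrE ?powR_gt0 ?japanese_gt0//.
  rewrite ge0_ler_powR ?nnegrE ?(ltW bn0) ?(ltW (japanese_gt0 x))//.
  by rewrite (le_trans _ (ltW s2)).
move=> n; rewrite natrX [_ ^+ n.+1]exprS.
have -> : b `^ s * b `^ (- s) ^+ n * (2 * b ^+ n) ^+ 2 =
    4 * b `^ s * (b `^ (- s) * b ^+ 2) ^+ n.
  have -> : (b `^ (- s) * b ^+ 2) ^+ n = b `^ (- s) ^+ n * (b ^+ n) ^+ 2.
    by rewrite exprMn -!exprM mulnC.
  by ring.
have p2 : 2 ^+ n != 0 :> R by rewrite expf_neq0.
by rewrite bs exprVn /K le_eqVlt; apply/orP; left; apply/eqP; field.
Qed.

Lemma lin_weight_ge0 x : 0 <= 1 + norm2 x.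
Proof. by rewrite addr_ge0// norm2_ge0. Qed.

Lemma measurable_sqrt : measurable_fun setT (@Num.sqrt R).
Proof. by apply: continuous_measurable_fun; exact: sqrt_continuous. Qed.

Lemma measurable_norm2 : measurable_fun setT (@norm2 R).
Proof.
apply: (measurableT_comp measurable_sqrt).
by apply: measurable_funD; apply: measurable_funX.
Qed.

Lemma measurable_japanese : measurable_fun setT (@japanese R).
Proof.
apply: (measurableT_comp measurable_sqrt).
by apply: measurable_funD => //; apply: measurable_funX; exact: measurable_norm2.
Qed.

Lemma measurable_diff1 :
  measurable_fun setT (fun z : plane R * plane R => z.1.1 - z.2.1).
Proof.
by apply: measurable_funB; apply: (measurableT_comp measurable_fst).
Qed.

Lemma measurable_diff2 :
  measurable_fun setT (fun z : plane R * plane R => z.1.2 - z.2.2).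
Proof.
by apply: measurable_funB; apply: (measurableT_comp measurable_snd).
Qed.

Lemma measurable_dist2 :
  measurable_fun setT (fun z : plane R * plane R => dist2 z.1 z.2).
Proof.
apply: (measurableT_comp measurable_sqrt).
by apply: measurable_funD; apply: measurable_funX;
  [exact: measurable_diff1|exact: measurable_diff2].
Qed.

Lemma measurable_inv : measurable_fun setT (@GRing.inv R).
Proof.
rewrite (_ : @GRing.inv R = fun t : R => t * (t ^+ 2) `^ (-1)).
  apply: measurable_funM => //; apply: (measurableT_comp (measurable_powR _)).
  exact: measurable_funX.
apply/funext => t; rewrite powR_inv1 ?sqr_ge0//.
have [->|t0] := eqVneq t 0; first by rewrite invr0 mul0r.
by field.
Qed.

Lemma measurable_near_ker : measurable_fun setT near_ker.
Proof.
rewrite /near_ker; apply: measurable_fun_ifT => //.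
  by apply: measurable_fun_ler => //; exact: measurable_dist2.
by apply: (measurableT_comp measurable_inv); exact: measurable_dist2.
Qed.

Definition log_ker (z : plane R * plane R) : R := ln (dist2 z.1 z.2).

(** The gradient of [log_ker] in its first argument has components [riesz1]
    and [riesz2]. *)
Definition riesz1 (z : plane R * plane R) : R :=
  (z.1.1 - z.2.1) / dist2 z.1 z.2 ^+ 2.

Definition riesz2 (z : plane R * plane R) : R :=
  (z.1.2 - z.2.2) / dist2 z.1 z.2 ^+ 2.

Lemma measurable_log_ker : measurable_fun setT log_ker.
Proof.
by apply: (measurableT_comp (@measurable_ln R)); exact: measurable_dist2.
Qed.

Lemma measurable_riesz1 : measurable_fun setT riesz1.
Proof.
apply: measurable_funM; first exact: measurable_diff1.
apply: (measurableT_comp measurable_inv).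
by apply: measurable_funX; exact: measurable_dist2.
Qed.

Lemma measurable_riesz2 : measurable_fun setT riesz2.
Proof.
apply: measurable_funM; first exact: measurable_diff2.
apply: (measurableT_comp measurable_inv).
by apply: measurable_funX; exact: measurable_dist2.
Qed.

End PlaneMeasure.

(** * The logarithm and its gradient near the diagonal and at infinity *)

Section KernelEstimates.
Variable R : realType.
Implicit Types (x y : plane R) (t : R).

Lemma ln_ge_opp_inv t : 0 < t -> - ln t <= t^-1.
Proof.
move=> t0; rewrite -lnV ?posrE//; apply: ltW; apply: ln_sublinear.
by rewrite invr_gt0.
Qed.

Lemma ln_sqrt t : 0 < t -> ln t = 2 * ln (Num.sqrt t).
Proof.
move=> t0; rewrite -{1}[t]sqr_sqrtr ?(ltW t0)// lnXn ?sqrtr_gt0//.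
by rewrite mulr_natl.
Qed.

Lemma ln_le_sqrt t : 0 < t -> ln t <= 2 * Num.sqrt t.
Proof.
by move=> t0; rewrite ln_sqrt// ler_pM2l// ltW// ln_sublinear// sqrtr_gt0.
Qed.

Lemma sqr_ln_le t : 0 < t -> t <= 1 -> ln t ^+ 2 <= 4 * t^-1.
Proof.
move=> t0 t1; have s0 : 0 < Num.sqrt t by rewrite sqrtr_gt0.
rewrite ln_sqrt// exprMn -[t in t^-1](sqr_sqrtr (ltW t0)) -exprVn.
rewrite (_ : 2 ^+ 2 = 4); last by ring.
rewrite ler_pM2l// -[leLHS]sqrrN ler_sqr ?nnegrE ?invr_ge0 ?(ltW s0)//.
  exact: ln_ge_opp_inv.
by rewrite oppr_ge0 ln_le0// -sqrtr1 ler_sqrt.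
Qed.

(** Apply ln (1 + t) <= t to u and to the inverse of 1 + u. The lower bound on
    u keeps 1 + u away from 0. *)
Lemma ln1D_approx (u : R) : - (3 / 4) <= u -> `|ln (1 + u) - u| <= 4 * u ^+ 2.
Proof.
move=> u1; have u0 : 0 < 1 + u by lra.
have h1 : ln (1 + u) <= u by apply: le_ln1Dx; lra.
have h2 : - ln (1 + u) <= - u + 4 * u ^+ 2.
  rewrite -lnV ?posrE//; have -> : (1 + u)^-1 = 1 + (- u / (1 + u)).
    by field; rewrite gt_eqF.
  apply: (@le_trans _ _ (- u / (1 + u))).
    apply: le_ln1Dx; rewrite -(ltrD2l 1) subrr (_ : 1 + _ = (1 + u)^-1).
      by rewrite invr_gt0.
    by field; rewrite gt_eqF.
  rewrite ler_pdivrMr//; have := sqr_ge0 u => u2.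
  have : 0 <= u ^+ 2 * (u + 3 / 4) by rewrite mulr_ge0//; lra.
  lra.
have := sqr_ge0 u => u2.
by rewrite ler_norml; apply/andP; split; lra.
Qed.

Lemma log_ker_le x y :
  `|log_ker (x, y)| <= near_ker (x, y) + (1 + norm2 x) * (1 + norm2 y).
Proof.
rewrite /log_ker /near_ker /=.
have nx := norm2_ge0 x; have ny := norm2_ge0 y.
have w1 : dist2 x y <= (1 + norm2 x) * (1 + norm2 y).
  by apply: le_trans (dist2_le x y) _; have := mulr_ge0 nx ny; lra.
have [d0|d0] := eqVneq (dist2 x y) 0.
  rewrite d0 ln0// normr0 ler01 invr0 add0r.
  by rewrite mulr_ge0// lin_weight_ge0.
have dp : 0 < dist2 x y by rewrite lt_def d0 dist2_ge0.
case: ifPn => [d1|]; last first.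
  rewrite -ltNge => d1; rewrite ger0_norm ?ln_ge0 ?(ltW d1)// add0r.
  by apply: le_trans w1; rewrite ltW// ln_sublinear.
rewrite ler0_norm ?ln_le0//; apply: le_trans (ln_ge_opp_inv dp) _.
by rewrite lerDl (le_trans (ltW dp)).
Qed.

(** Bounding |log| |h| by squares near the diagonal gives a majorant that is
    integrable in y for every x, not only for almost every x. *)
Lemma log_ker_sqr_le x y (h : R) : `|log_ker (x, y) * h| <=
  4 * near_ker (x, y) + h ^+ 2 + (1 + norm2 x) * ((1 + norm2 y) * `|h|).
Proof.
rewrite /log_ker /near_ker /= normrM.
have nx := norm2_ge0 x; have ny := norm2_ge0 y.
have w1 : dist2 x y <= (1 + norm2 x) * (1 + norm2 y).
  by apply: le_trans (dist2_le x y) _; have := mulr_ge0 nx ny; lra.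
have w0 : 0 <= (1 + norm2 x) * ((1 + norm2 y) * `|h|).
  by rewrite !mulr_ge0// lin_weight_ge0.
have h0 := sqr_ge0 h.
have [d0|d0] := eqVneq (dist2 x y) 0.
  by rewrite d0 ln0// normr0 ler01 invr0 mulr0 mul0r add0r addr_ge0.
have dp : 0 < dist2 x y by rewrite lt_def d0 dist2_ge0.
case: ifPn => [d1|]; last first.
  rewrite -ltNge => d1; rewrite [`|ln _|]ger0_norm ?ln_ge0 ?(ltW d1)// mulr0 add0r.
  apply: (@le_trans _ _ ((1 + norm2 x) * ((1 + norm2 y) * `|h|))).
    rewrite mulrA ler_wpM2r//.
    by apply: le_trans w1; rewrite ltW// ln_sublinear.
  by rewrite lerDr.
apply: (@le_trans _ _ (4 * (dist2 x y)^-1 + h ^+ 2)); last by rewrite lerDl.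
apply: (@le_trans _ _ (ln (dist2 x y) ^+ 2 + h ^+ 2)).
  rewrite -[X in _ <= X + _]real_normK ?num_real// -[X in _ <= _ + X]real_normK ?num_real//.
  have := sqr_ge0 (`|ln (dist2 x y)| - `|h|).
  have := sqr_ge0 (`|ln (dist2 x y)|); have := sqr_ge0 (`|h|); lra.
by rewrite lerD2r sqr_ln_le.
Qed.

Lemma riesz_le (c : R) x y : `|c| <= dist2 x y ->
  `|c / dist2 x y ^+ 2| <= near_ker (x, y) + 1.
Proof.
move=> cd; rewrite /near_ker /=.
have [d0|d0] := eqVneq (dist2 x y) 0.
  by rewrite d0 ler01 !expr0n invr0 mulr0 normr0 add0r.
have dp : 0 < dist2 x y by rewrite lt_def d0 dist2_ge0.
rewrite normrM normfV [`|_ ^+ 2|]ger0_norm ?sqr_ge0//.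
apply: (@le_trans _ _ (dist2 x y)^-1).
  rewrite ler_pdivrMr ?exprn_gt0// expr2 mulrA mulVf// mul1r//.
case: ifPn => [d1|]; first by rewrite lerDl.
by rewrite -ltNge => d1; rewrite add0r invf_le1// ltW.
Qed.

Lemma riesz1_le x y : `|riesz1 (x, y)| <= near_ker (x, y) + 1.
Proof. by apply: riesz_le; exact: dist2_coord1. Qed.

Lemma riesz2_le x y : `|riesz2 (x, y)| <= near_ker (x, y) + 1.
Proof. by apply: riesz_le; exact: dist2_coord2. Qed.

(** The power -3/2 of the bracket: its square is integrable on the plane. *)
Definition decay x : R := (Num.sqrt (japanese x) ^+ 3)^-1.

(** Leading terms at infinity of the gradient of the logarithm, cut off where
    they are singular. *)
Definition far1 x : R := if 1 <= norm2 x then x.1 / norm2 x ^+ 2 else 0.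

Definition far2 x : R := if 1 <= norm2 x then x.2 / norm2 x ^+ 2 else 0.

Definition far_ln x : R := if 1 <= norm2 x then ln (norm2 x) else 0.

Lemma decay_ge0 x : 0 <= decay x.
Proof. by rewrite invr_ge0 exprn_ge0// sqrtr_ge0. Qed.

Lemma sqr_decay x : decay x ^+ 2 = japanese x `^ (- 3).
Proof.
rewrite /decay exprVn -exprM mulnC exprM sqr_sqrtr ?(ltW (japanese_gt0 x))//.
by rewrite powRN powR_mulrn// ltW// japanese_gt0.
Qed.

Let root x : R := Num.sqrt (japanese x).

Let root_ge1 x : 1 <= root x.
Proof. by rewrite /root -[leLHS]sqrtr1 ler_wsqrtr// japanese_ge1. Qed.

Let root_sq x : root x ^+ 2 = japanese x.
Proof. by rewrite sqr_sqrtr// ltW// japanese_gt0. Qed.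

Lemma decay_lb x (K A : R) : A * root x ^+ 3 <= K -> A <= K * decay x.
Proof.
move=> AK; rewrite /decay ler_pdivlMr//.
by rewrite exprn_gt0// (lt_le_trans _ (root_ge1 x)).
Qed.

(** The inversion z / |z|^2 maps x - y and x to points at distance |y| / (|x -
    y| |x|). When |x - y| >= 1 the inequality |x| <= |x - y| (1 + |y|) turns
    this into a multiple of (1 + |y|)^2 / |x|^2; the first term takes care of
    |x - y| <= 1. For |x| < 1 the leading term is 0 and the kernel is at most
    1 beyond the diagonal part. The boolean selects the coordinate, so that
    both are treated at once. *)
Lemma riesz_far (c : bool) x y :
  `| (if c then riesz1 (x, y) else riesz2 (x, y))
     - (if c then far1 x else far2 x)| <=
  near_ker (x, y) * (1 + norm2 y) + 128 * decay x * (1 + norm2 y) ^+ 2.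
Proof.
have nx := norm2_ge0 x; have ny := norm2_ge0 y.
have k0 := near_ker_ge0 (x, y); have s1 := root_ge1 x.
have ky : near_ker (x, y) <= near_ker (x, y) * (1 + norm2 y).
  by rewrite -[leLHS]mulr1 ler_wpM2l// lerDl.
have w1 : 1 <= (1 + norm2 y) ^+ 2 by rewrite -[leLHS](expr1n _ 2) ler_sqr ?nnegrE// ?addr_ge0// lerDl.
have s3 : 1 <= root x ^+ 3 by rewrite exprn_ege1.
rewrite -mulrA [decay x * _]mulrC mulrA.
have [x1|x1] := leP 1 (norm2 x); last first.
  have -> : (if c then far1 x else far2 x) = 0.
    by rewrite /far1 /far2 !(leNgt 1) x1; case: c.
  rewrite subr0; apply: (@le_trans _ _ (near_ker (x, y) + 1)).
    by case: c; [exact: riesz1_le|exact: riesz2_le].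
  apply: lerD => //; apply: decay_lb; rewrite mul1r.
  have : root x ^+ 2 <= 2.
    by rewrite root_sq; apply: le_trans (japanese_le x) _; lra.
  move=> r2; have r : root x <= 2 by nra.
  rewrite exprS; nra.
have xp : 0 < norm2 x by lra.
have J2 : root x ^+ 2 <= 2 * norm2 x.
  by rewrite root_sq; apply: le_trans (japanese_le x) _; lra.
have [d0|d0] := eqVneq (dist2 x y) 0.
  have xy : norm2 x <= norm2 y by have := norm2_le x y; rewrite d0 add0r.
  have -> : (if c then riesz1 (x, y) else riesz2 (x, y)) = 0.
    by rewrite /riesz1 /riesz2 /= d0 expr0n invr0 !mulr0; case: c.
  rewrite sub0r normrN; apply: (@le_trans _ _ 1).
    rewrite /far1 /far2 x1; have := norm2_coord1 x; have := norm2_coord2 x.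
    case: c => c2 c1; rewrite normrM normfV [`|_ ^+ 2|]ger0_norm ?sqr_ge0//;
      rewrite ler_pdivrMr ?exprn_gt0// mul1r; [apply: le_trans c1 _|apply: le_trans c2 _];
      by rewrite expr2 ler_peMl.
  rewrite -[leLHS]add0r; apply: lerD; first by rewrite mulr_ge0// addr_ge0.
  apply: decay_lb; rewrite mul1r.
  have : root x ^+ 3 <= (root x ^+ 2) ^+ 2.
    by rewrite -exprM ler_weXn2l.
  by have := sqr_ge0 (root x); nra.
have dp : 0 < dist2 x y by rewrite lt_def d0 dist2_ge0.
apply: (@le_trans _ _ (norm2 y / (dist2 x y * norm2 x))).
  apply: le_normr_sqr; first by rewrite divr_ge0// mulr_ge0// ltW.
  have e : (riesz1 (x, y) - far1 x) ^+ 2 + (riesz2 (x, y) - far2 x) ^+ 2 =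
      (norm2 y / (dist2 x y * norm2 x)) ^+ 2.
    rewrite /riesz1 /riesz2 /far1 /far2 x1 /=.
    rewrite expr_div_n exprMn [norm2 y ^+ 2]sqr_norm2.
    have dx : norm2 x ^+ 2 != 0 by rewrite expf_neq0// gt_eqF.
    have dd : dist2 x y ^+ 2 != 0 by rewrite expf_neq0.
    rewrite sqr_norm2 sqr_dist2 in dx dd *.
    by field; rewrite dx dd.
  by rewrite -e; case: c; rewrite ?lerDl ?lerDr sqr_ge0.
have dx0 : 0 < dist2 x y * norm2 x by rewrite mulr_gt0.
have [d1|d1] := leP (dist2 x y) 1.
  apply: (@le_trans _ _ (near_ker (x, y) * (1 + norm2 y))).
    rewrite /near_ker /= d1 ler_pdivrMr//.
    rewrite (_ : _ * _ * _ = (1 + norm2 y) * norm2 x); last by field.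
    by nra.
  by rewrite lerDl; apply: mulr_ge0; [apply: mulr_ge0; rewrite ?sqr_ge0 | exact: decay_ge0].
rewrite -[leLHS]add0r; apply: lerD; first by rewrite mulr_ge0// addr_ge0.
apply: decay_lb; rewrite mulrAC ler_pdivrMr//.
have xd : norm2 x <= dist2 x y * (1 + norm2 y).
  by apply: le_trans (norm2_le x y) _; nra.
apply: (@le_trans _ _ (norm2 y * (4 * norm2 x ^+ 2))).
  rewrite ler_wpM2l//; apply: (@le_trans _ _ ((root x ^+ 2) ^+ 2)).
    by rewrite -exprM ler_weXn2l.
  rewrite (_ : 4 * _ = (2 * norm2 x) ^+ 2); last by ring.
  by rewrite ler_sqr ?nnegrE ?sqr_ge0 ?mulr_ge0.
apply: (@le_trans _ _ (norm2 y * (4 * (norm2 x * (dist2 x y * (1 + norm2 y)))))).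
  by rewrite expr2 !ler_wpM2l.
rewrite (_ : 128 * _ * _ = (dist2 x y * norm2 x) * (128 * (1 + norm2 y) ^+ 2)); last by ring.
rewrite (_ : norm2 y * (4 * _) = (dist2 x y * norm2 x) * (4 * norm2 y * (1 + norm2 y))); last by ring.
by rewrite ler_pM2l//; nra.
Qed.

(** If |y| <= |x| / 2, expand log |x - y|^2 = log |x|^2 + log (1 + u) to first
    order, with u = |y|^2 / |x|^2 - 2 (x . y) / |x|^2. Otherwise |x| <= 2 |y|,
    and each of the three terms is bounded separately: the weight (1 + |y|)^2
    makes up for the decay in x. *)
Lemma log_far x y :
  `|log_ker (x, y) - far_ln x + (far1 x * y.1 + far2 x * y.2)| <=
  near_ker (x, y) * (1 + norm2 y) + 128 * decay x * (1 + norm2 y) ^+ 2.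
Proof.
have nx := norm2_ge0 x; have ny := norm2_ge0 y.
have k0 := near_ker_ge0 (x, y); have s1 := root_ge1 x.
have w1 : 1 <= (1 + norm2 y) ^+ 2.
  by rewrite -[leLHS](expr1n _ 2) ler_sqr ?nnegrE// ?addr_ge0// lerDl.
have s3 : 1 <= root x ^+ 3 by rewrite exprn_ege1.
have ky : near_ker (x, y) <= near_ker (x, y) * (1 + norm2 y).
  by rewrite -[leLHS]mulr1 ler_wpM2l// lerDl.
rewrite -mulrA [decay x * _]mulrC mulrA.
(* near_ker dominates the logarithm up to distance 1, beyond which it vanishes
   and the logarithm is nonnegative *)
have lnd (A : R) : (1 < dist2 x y -> ln (dist2 x y) <= A) -> 0 <= A ->
    `|log_ker (x, y)| <= near_ker (x, y) + A.
  move=> hA A0; rewrite /log_ker /near_ker /=.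
  have [d0|d0] := eqVneq (dist2 x y) 0.
    by rewrite d0 ln0// normr0 ler01 invr0 add0r.
  have dp : 0 < dist2 x y by rewrite lt_def d0 dist2_ge0.
  case: (leP (dist2 x y) 1) => d1.
    rewrite ler0_norm ?ln_le0//; apply: le_trans (ln_ge_opp_inv dp) _.
    by rewrite lerDl.
  by rewrite ger0_norm ?ln_ge0 ?(ltW d1)// add0r hA.
have [x1|x1] := leP 1 (norm2 x); last first.
  rewrite /far1 /far2 /far_ln !(leNgt 1) x1 /= !mul0r addr0 subr0 addr0.
  apply: (@le_trans _ _ (near_ker (x, y) + (1 + norm2 y))).
    apply: lnd; last by rewrite addr_ge0.
    move=> d1; apply: (@le_trans _ _ (dist2 x y)).
      by rewrite ltW// ln_sublinear// (lt_trans _ d1).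
    by apply: le_trans (dist2_le x y) _; rewrite lerD2r ltW.
  apply: lerD => //; apply: decay_lb.
  have : root x ^+ 2 <= 2.
    by rewrite root_sq; apply: le_trans (japanese_le x) _; lra.
  move=> r2; have r : root x <= 2 by nra.
  have r3 : root x ^+ 3 <= 4 by rewrite exprS; nra.
  apply: (@le_trans _ _ ((1 + norm2 y) * 4)); first by rewrite ler_wpM2l// addr_ge0.
  by nra.
have xp : 0 < norm2 x by lra.
have J2 : root x ^+ 2 <= 2 * norm2 x.
  by rewrite root_sq; apply: le_trans (japanese_le x) _; lra.
have far_dot : far1 x * y.1 + far2 x * y.2 = (x.1 * y.1 + x.2 * y.2) / norm2 x ^+ 2.
  by rewrite /far1 /far2 x1; field; rewrite gt_eqF.
have cs := norm2_cauchy x y.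
rewrite far_dot {1}/far_ln x1; set p := x.1 * y.1 + x.2 * y.2 in cs *.
have s34 : root x ^+ 3 <= (root x ^+ 2) ^+ 2 by rewrite -exprM ler_weXn2l.
have [yx|yx] := leP (norm2 y) (norm2 x / 2).
  pose w := norm2 y / norm2 x.
  have w0 : 0 <= w by rewrite divr_ge0.
  have w2 : w <= 2^-1 by rewrite ler_pdivrMr// mulrC.
  pose q := p / norm2 x ^+ 2.
  have qw : `|q| <= w.
    rewrite /q normrM normfV [`|_ ^+ 2|]ger0_norm ?sqr_ge0//.
    rewrite ler_pdivrMr ?exprn_gt0//; apply: le_trans cs _.
    by rewrite /w le_eqVlt; apply/orP; left; apply/eqP; field; rewrite gt_eqF.
  pose u := w ^+ 2 - 2 * q.
  have dE : dist2 x y ^+ 2 = norm2 x ^+ 2 * (1 + u).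
    by rewrite dist2_sqrE /u /w /q -/p; field; rewrite gt_eqF.
  move: qw; rewrite ler_norml => /andP[q1 q2].
  have u1 : - (3 / 4) <= u by rewrite /u; nra.
  have u34 := ln1D_approx u1.
  have u0 : 0 < 1 + u by lra.
  have dp : 0 < dist2 x y.
    rewrite lt_def dist2_ge0 andbT; apply/eqP => d0; move: dE.
    rewrite d0 expr0n /= => /esym/eqP; rewrite mulf_eq0 expf_eq0 /=.
    by rewrite (gt_eqF xp) (gt_eqF u0).
  have lnE : 2 * log_ker (x, y) = 2 * ln (norm2 x) + ln (1 + u).
    rewrite /log_ker /= !mulr_natl -!lnXn// dE lnM ?posrE ?exprn_gt0//.
  have main : `|log_ker (x, y) - ln (norm2 x) + q| <= 13 * w ^+ 2.
    have -> : log_ker (x, y) - ln (norm2 x) + q = 2^-1 * ln (1 + u) + q.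
      by have := lnE; lra.
    move: u34; rewrite !ler_norml => /andP[a b].
    have u2 : u ^+ 2 <= 25 / 4 * w ^+ 2.
      have : u <= 5 / 2 * w by rewrite /u; nra.
      have : - (5 / 2 * w) <= u by rewrite /u; nra.
      by move=> c1 c2; nra.
    have : u = w ^+ 2 - 2 * q by [].
    by move=> uE; apply/andP; split; lra.
  apply: (le_trans main); rewrite -[leLHS]add0r.
  apply: lerD; first by rewrite mulr_ge0// addr_ge0.
  apply: decay_lb.
  apply: (@le_trans _ _ (13 * w ^+ 2 * (2 * norm2 x) ^+ 2)).
    apply: ler_wpM2l; first by rewrite mulr_ge0// sqr_ge0.
    apply: (le_trans s34).
    by rewrite ler_sqr ?nnegrE ?sqr_ge0 ?mulr_ge0.
  have -> : 13 * w ^+ 2 * (2 * norm2 x) ^+ 2 = 52 * norm2 y ^+ 2.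
    by rewrite /w; field; rewrite gt_eqF.
  by nra.
have yp : 0 < norm2 y by lra.
have sy : root x ^+ 2 <= 4 * norm2 y by lra.
pose r := Num.sqrt (norm2 y).
have rp : 0 < r by rewrite sqrtr_gt0.
have rE : r ^+ 2 = norm2 y by rewrite sqr_sqrtr.
have sr : root x <= 2 * r.
  rewrite -ler_sqr ?nnegrE ?mulr_ge0 ?(ltW rp) ?sqrtr_ge0//.
  by rewrite exprMn rE; apply: (le_trans sy); rewrite (_ : 2 ^+ 2 = 4)//; ring.
have s3r : root x ^+ 3 <= 8 * r ^+ 3.
  rewrite (_ : 8 * r ^+ 3 = (2 * r) ^+ 3); last by ring.
  by rewrite lerXn2r ?nnegrE ?sqrtr_ge0 ?mulr_ge0 ?(ltW rp).
have lnz : `|log_ker (x, y)| <= near_ker (x, y) + 4 * r.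
  apply: lnd; last by rewrite mulr_ge0// ltW.
  move=> d1; apply: le_trans (ln_le_sqrt _) _; first exact: lt_trans d1.
  have : Num.sqrt (dist2 x y) <= 2 * r.
    rewrite -ler_sqr ?nnegrE ?mulr_ge0 ?(ltW rp) ?sqrtr_ge0// sqr_sqrtr ?dist2_ge0//.
    rewrite exprMn rE; apply: le_trans (dist2_le x y) _.
    by rewrite (_ : 2 ^+ 2 = 4); [lra|ring].
  by lra.
have lnx : `|ln (norm2 x)| <= 4 * r.
  rewrite ger0_norm ?ln_ge0//; apply: le_trans (ln_le_sqrt xp) _.
  have : Num.sqrt (norm2 x) <= 2 * r.
    rewrite -ler_sqr ?nnegrE ?mulr_ge0 ?(ltW rp) ?sqrtr_ge0// sqr_sqrtr//.
    by rewrite exprMn rE (_ : 2 ^+ 2 = 4); [lra|ring].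
  by lra.
have px : `|p / norm2 x ^+ 2| <= 2 * norm2 y ^+ 2 / norm2 x ^+ 2.
  rewrite normrM normfV [`|_ ^+ 2|]ger0_norm ?sqr_ge0//.
  rewrite ler_pM2r ?invr_gt0 ?exprn_gt0//; apply: (le_trans cs).
  by nra.
apply: (@le_trans _ _ (near_ker (x, y) + 4 * r + 4 * r + 2 * norm2 y ^+ 2 / norm2 x ^+ 2)).
  apply: le_trans (ler_normD _ _) _; apply: lerD px.
  by apply: le_trans (ler_normB _ _) _; apply: lerD lnx.
rewrite -!addrA; apply: lerD => //; apply: decay_lb.
have h1 : 4 * r * root x ^+ 3 <= 32 * norm2 y ^+ 2.
  apply: (@le_trans _ _ (4 * r * (8 * r ^+ 3))).
    by rewrite ler_wpM2l// mulr_ge0// ltW.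
  by rewrite -rE le_eqVlt; apply/orP; left; apply/eqP; ring.
have h2 : 2 * norm2 y ^+ 2 / norm2 x ^+ 2 * root x ^+ 3 <= 8 * norm2 y ^+ 2.
  apply: (@le_trans _ _ (2 * norm2 y ^+ 2 / norm2 x ^+ 2 * (2 * norm2 x) ^+ 2)).
    apply: ler_wpM2l; first by rewrite divr_ge0// ?sqr_ge0// mulr_ge0// sqr_ge0.
    apply: (le_trans s34).
    by rewrite ler_sqr ?nnegrE ?sqr_ge0 ?mulr_ge0.
  by rewrite le_eqVlt; apply/orP; left; apply/eqP; field; rewrite gt_eqF.
rewrite (mulrDl (4 * r)) (mulrDl (4 * r)).
apply: (@le_trans _ _ (32 * norm2 y ^+ 2 + (32 * norm2 y ^+ 2 + 8 * norm2 y ^+ 2))).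
  by apply: lerD; [exact: h1 | apply: lerD; [exact: h1 | exact: h2]].
by nra.
Qed.

End KernelEstimates.

(** * Potentials of weighted densities *)

Section Potentials.
Variable R : realType.
Notation mu := (leb2 R).
Implicit Types (x y : plane R) (h g : plane R -> R).

Definition pot (kap : plane R * plane R -> R) h x : R :=
  Rintegral mu setT (fun y => kap (x, y) * h y).

(** The weights under which the remainders of the expansions at infinity are
    square integrable: the near-diagonal part sees the first condition, the
    far part the second one. *)
Definition density h := sqint mu (fun y => (1 + norm2 y) * h y) /\
  aeint mu (fun y => (1 + norm2 y) ^+ 2 * h y).

Lemma measurable_lin_weight : measurable_fun setT (fun x => 1 + norm2 x : R).
Proof. by apply: measurable_funD => //; exact: measurable_norm2. Qed.

Lemma lin_weight_gt0 x : 0 < 1 + norm2 x.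
Proof. by rewrite ltr_pwDl// norm2_ge0. Qed.

Lemma density_aemeas h : density h -> aemeas mu h.
Proof.
move=> [[mh _] _]; have mi : aemeas mu (fun y => (1 + norm2 y)^-1).
  apply: measurable_aemeas.
  by apply: (measurableT_comp (@measurable_inv R)); exact: measurable_lin_weight.
apply: aemeas_eq (aemeasM mi mh); apply: aeW => y.
by rewrite mulrA mulVf ?mul1r// gt_eqF// lin_weight_gt0.
Qed.

Lemma density_eq h g : {ae mu, forall x, h x = g x} -> density h -> density g.
Proof.
move=> hg [h2 h1]; split.
  by apply: sqint_eq h2; apply: filterS hg => x ->.
by apply: aeint_eq h1; apply: filterS hg => x ->.
Qed.

Lemma density_aeintM (a : plane R -> R) h : measurable_fun setT a ->
  (forall y, `|a y| <= (1 + norm2 y) ^+ 2) -> density h ->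
  aeint mu (fun y => a y * h y).
Proof.
move=> ma ale dh; have [_ h1] := dh; apply: (aeint_dom _ (aeint_norm h1)).
  by apply: aemeasM; [exact: measurable_aemeas|exact: density_aemeas].
apply: aeW => y; rewrite normrM [leRHS]normrM ler_wpM2r//.
by rewrite [leRHS]ger0_norm ?sqr_ge0.
Qed.

Lemma lin_weight_ge1 x : 1 <= 1 + norm2 x.
Proof. by rewrite lerDl norm2_ge0. Qed.

Lemma lin_weight_sq x : 1 + norm2 x <= (1 + norm2 x) ^+ 2.
Proof. by rewrite expr2 ler_peMl ?lin_weight_ge0// lin_weight_ge1. Qed.

Lemma density_aeint h : density h -> aeint mu h.
Proof.
move=> dh; have := @density_aeintM (fun=> 1) h (measurable_cst _) _ dh.
move=> H; apply: aeint_eq (H _); first by apply: aeW => x /=; rewrite mul1r.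
by move=> y; rewrite normr1 exprn_ege1// lin_weight_ge1.
Qed.

Lemma density_weight h : density h -> aeint mu (fun y => (1 + norm2 y) * h y).
Proof.
move=> dh; apply: density_aeintM => //; first exact: measurable_lin_weight.
by move=> y; rewrite ger0_norm ?lin_weight_ge0// lin_weight_sq.
Qed.

Lemma density_moment1 h : density h -> aeint mu (fun y => y.1 * h y).
Proof.
move=> dh; apply: density_aeintM => // y.
apply: le_trans (norm2_coord1 y) (le_trans _ (lin_weight_sq y)).
by rewrite lerDr.
Qed.

Lemma density_moment2 h : density h -> aeint mu (fun y => y.2 * h y).
Proof.
move=> dh; apply: density_aeintM => // y.
apply: le_trans (norm2_coord2 y) (le_trans _ (lin_weight_sq y)).
by rewrite lerDr.
Qed.

Lemma density_moment_sq h : density h -> aeint mu (fun y => norm2 y ^+ 2 * h y).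
Proof.
move=> dh; apply: density_aeintM => //.
  by apply: measurable_funX; exact: measurable_norm2.
move=> y; rewrite ger0_norm ?sqr_ge0// ler_sqr ?nnegrE ?norm2_ge0 ?lin_weight_ge0//.
by rewrite lerDr.
Qed.

Lemma density_sqint h : density h -> sqint mu h.
Proof.
move=> dh; have [h2 _] := dh; apply: sqint_dom (density_aemeas dh) h2 _.
apply: aeW => y; rewrite normrM -[leLHS]mul1r ler_wpM2r//.
by rewrite ger0_norm ?lin_weight_ge0// lin_weight_ge1.
Qed.

Lemma sqint_decay : sqint mu (@decay R).
Proof.
split.
  apply: measurable_aemeas; apply: (measurableT_comp (@measurable_inv R)).
  apply: measurable_funX; apply: (measurableT_comp (@measurable_sqrt R)).
  exact: measurable_japanese.
by under eq_integral do rewrite sqr_decay; apply: japanese_powR_int; lra.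
Qed.

Let near_kl x : (\int[@leb2s R]_y (near_ker (x, y))%:E <= 32%:E)%E.
Proof. exact: near_ker_int. Qed.

Let near_kr y : (\int[@leb2s R]_x (near_ker (x, y))%:E <= 32%:E)%E.
Proof.
under eq_integral do rewrite near_kerC.
exact: near_ker_int.
Qed.

Let ltr032 : 0 < 32 :> R. Proof. by []. Qed.

Lemma near_pot_L2 h : sqint mu h ->
  {ae mu, forall x, aeint mu (fun y => near_ker (x, y) * `|h y|)} /\
  sqint mu (fun x => Rintegral mu setT (fun y => near_ker (x, y) * `|h y|)).
Proof.
exact: (@schur_L2 _ _ _ (@leb2s R) _ _ (@measurable_near_ker R) (@near_ker_ge0 R)
  ltr032 near_kl near_kr).
Qed.

(** A product weight at a distance: the far part of the kernel then factors,
    and only its near part needs the Schur test. *)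
Definition near_lin (kap : plane R * plane R -> R) :=
  measurable_fun setT kap /\ forall x y, `|kap (x, y)| <=
    near_ker (x, y) + (1 + norm2 x) * (1 + norm2 y).

Lemma near_lin_log : near_lin (@log_ker R).
Proof. by split; [exact: measurable_log_ker|exact: log_ker_le]. Qed.

Let lin_weight2_ge1 x y : 1 <= (1 + norm2 x) * (1 + norm2 y).
Proof. by rewrite mulr_ege1// lin_weight_ge1. Qed.

Lemma near_lin_riesz1 : near_lin (@riesz1 R).
Proof.
split=> [|x y]; first exact: measurable_riesz1.
by apply: le_trans (riesz1_le x y) _; rewrite lerD2l lin_weight2_ge1.
Qed.

Lemma near_lin_riesz2 : near_lin (@riesz2 R).
Proof.
split=> [|x y]; first exact: measurable_riesz2.
by apply: le_trans (riesz2_le x y) _; rewrite lerD2l lin_weight2_ge1.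
Qed.

Section NearLin.
Variable kap : plane R * plane R -> R.
Hypothesis kapP : near_lin kap.

Lemma potential_aemeas h : aemeas mu h -> aemeas mu (pot kap h).
Proof. by have [mk _] := kapP; exact: (@pot_aemeas _ _ _ (@leb2s R) _ mk). Qed.

Lemma potential_aeint h : density h ->
  {ae mu, forall x, aeint mu (fun y => kap (x, y) * h y)}.
Proof.
move=> dh; have [mk kle] := kapP.
exact: (@pot_aeint _ _ _ (@leb2s R) _ _ (@measurable_near_ker R) (@near_ker_ge0 R)
  ltr032 near_kl near_kr _ (fun x => 1 + norm2 x) mk (@lin_weight_ge0 R) kle
  h (density_sqint dh) (density_weight dh)).
Qed.

Lemma potential_le h : density h ->
  {ae mu, forall x, `|pot kap h x| <=
    Rintegral mu setT (fun y => near_ker (x, y) * `|h y|) +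
    (1 + norm2 x) * Rintegral mu setT (fun y => (1 + norm2 y) * `|h y|)}.
Proof.
move=> dh; have [mk kle] := kapP.
exact: (@pot_le _ _ _ (@leb2s R) _ _ (@measurable_near_ker R) (@near_ker_ge0 R)
  ltr032 near_kl near_kr _ (fun x => 1 + norm2 x) mk (@lin_weight_ge0 R) kle
  h (density_sqint dh) (density_weight dh)).
Qed.

Lemma potential_form g h : density h -> density g ->
  aeint mu (fun x => g x * pot kap h x) /\
  Rintegral mu setT (fun x => g x * pot kap h x) =
  Rintegral mu setT (fun y => h y * Rintegral mu setT (fun x => kap (x, y) * g x)).
Proof.
move=> dh dg; have [mk kle] := kapP.
exact: (@pot_form _ _ _ (@leb2s R) _ _ (@measurable_near_ker R) (@near_ker_ge0 R)
  ltr032 near_kl near_kr _ (fun x => 1 + norm2 x) mk measurable_lin_weight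
  (@lin_weight_ge0 R) kle
  g h (density_sqint dh) (density_weight dh) (density_sqint dg) (density_weight dg)).
Qed.

(** The near part of the potential is square integrable by the Schur test; the
    far part grows at most linearly, which the decay of a absorbs. *)
Lemma potential_weighted_sqint (a : plane R -> R) (K : R) h : aemeas mu a ->
  (forall x, `|a x| * (1 + norm2 x) <= K * decay x) -> density h ->
  sqint mu (fun x => a x * pot kap h x).
Proof.
move=> ma aK dh; have [_ N2] := near_pot_L2 (density_sqint dh).
set M := Rintegral mu setT (fun y => (1 + norm2 y) * `|h y|).
have M0 : 0 <= M by apply: Rintegral_ge0 => y _; rewrite mulr_ge0 ?lin_weight_ge0.
have sp x : 0 < Num.sqrt (japanese x) by rewrite sqrtr_gt0; exact: japanese_gt0.
have d1 x : decay x <= 1.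
  rewrite invf_le1 ?exprn_gt0// exprn_ege1//.
  by rewrite -sqrtr1 ler_wsqrtr// japanese_ge1.
have K0 : 0 <= K.
  have := aK (0, 0); have d0 : 0 < decay ((0, 0) : plane R).
    by rewrite invr_gt0 exprn_gt0.
  by move=> /(le_trans (mulr_ge0 (normr_ge0 _) (lin_weight_ge0 _))); rewrite pmulr_lge0.
apply: (sqint_dom _ (sqintD (sqintZ K N2) (sqintZ (K * M) sqint_decay))).
  by apply: aemeasM => //; apply: potential_aemeas; exact: density_aemeas.
apply: filterS (potential_le dh) => x px; rewrite normrM.
set N := Rintegral mu setT (fun y => near_ker (x, y) * `|h y|) in px *.
have N0 : 0 <= N.
  by apply: Rintegral_ge0 => y _; rewrite mulr_ge0 ?near_ker_ge0.
rewrite [leRHS]ger0_norm; last by rewrite addr_ge0// mulr_ge0 ?decay_ge0// mulr_ge0.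
apply: (@le_trans _ _ (`|a x| * (N + (1 + norm2 x) * M))).
  by rewrite ler_wpM2l.
rewrite mulrDr; apply: lerD.
  rewrite ler_wpM2r//; apply: (@le_trans _ _ (`|a x| * (1 + norm2 x))).
    by rewrite -[leLHS]mulr1 ler_wpM2l// lin_weight_ge1.
  by apply: (le_trans (aK x)); rewrite -[leRHS]mulr1 ler_wpM2l.
by rewrite mulrA [leRHS]mulrAC ler_wpM2r.
Qed.

End NearLin.

(** The first term of the bound is handled by the Schur test applied to (1 +
    |y|) h; the second one is a product, with a square integrable factor in x.
    *)
Lemma remainder_sqint (rho : plane R * plane R -> R) h : measurable_fun setT rho ->
  (forall x y, `|rho (x, y)| <= near_ker (x, y) * (1 + norm2 y) +
     128 * decay x * (1 + norm2 y) ^+ 2) ->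
  density h -> {ae mu, forall x, aeint mu (fun y => rho (x, y) * h y)} /\
  sqint mu (pot rho h).
Proof.
move=> mr rle dh; have [h2 h1] := dh.
have [Ni N2] := near_pot_L2 h2.
have mpot : aemeas mu (pot rho h).
  by apply: (@pot_aemeas _ _ _ (@leb2s R) _ mr); exact: density_aemeas.
have h1' := aeint_norm h1.
set M := Rintegral mu setT (fun y => `|(1 + norm2 y) ^+ 2 * h y|).
have M0 : 0 <= M by apply: Rintegral_ge0.
have ptw x y : `|rho (x, y) * h y| <=
    near_ker (x, y) * `|(1 + norm2 y) * h y| +
    128 * decay x * `|(1 + norm2 y) ^+ 2 * h y|.
  have -> : `|(1 + norm2 y) * h y| = (1 + norm2 y) * `|h y|.
    by rewrite normrM ger0_norm ?lin_weight_ge0.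
  have -> : `|(1 + norm2 y) ^+ 2 * h y| = (1 + norm2 y) ^+ 2 * `|h y|.
    by rewrite normrM ger0_norm ?sqr_ge0.
  by rewrite normrM mulrA [128 * decay x * (_ * `|h y|)]mulrA -mulrDl ler_wpM2r.
have rint : {ae mu, forall x, aeint mu (fun y => rho (x, y) * h y)}.
  apply: filterS Ni => x Nx.
  apply: (aeint_dom _ (aeintD Nx (aeintZ (128 * decay x) h1'))).
    apply: (@pot_section_aemeas _ _ _ (@leb2s R) _ mr).
    exact: density_aemeas.
  by apply: aeW => y; exact: ptw.
split; first exact: rint.
apply: (sqint_dom mpot (sqintD N2 (sqintZ (128 * M) sqint_decay))).
apply: filterS2 Ni rint => x Nx rx.
rewrite [leRHS]ger0_norm; last first.
  rewrite addr_ge0//; last by rewrite !mulr_ge0 ?decay_ge0.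
  by apply: Rintegral_ge0 => y _; rewrite mulr_ge0 ?near_ker_ge0.
rewrite mulrAC -Rint_cstM// -RintD//; last exact: aeintZ.
apply: Rint_norm_le => //; first by apply: aeintD => //; exact: aeintZ.
by apply: aeW => y; exact: ptw.
Qed.

Let measurable_far (c : plane R -> R) : measurable_fun setT c ->
  measurable_fun setT (fun x => if 1 <= norm2 x then c x else 0).
Proof.
move=> mc; apply: measurable_fun_ifT => //.
by apply: measurable_fun_ler => //; exact: measurable_norm2.
Qed.

Lemma measurable_far1 : measurable_fun setT (@far1 R).
Proof.
apply: measurable_far; apply: measurable_funM => //.
apply: (measurableT_comp (@measurable_inv R)).
by apply: measurable_funX; exact: measurable_norm2.
Qed.

Lemma measurable_far2 : measurable_fun setT (@far2 R).
Proof.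
apply: measurable_far; apply: measurable_funM => //.
apply: (measurableT_comp (@measurable_inv R)).
by apply: measurable_funX; exact: measurable_norm2.
Qed.

Lemma measurable_far_ln : measurable_fun setT (@far_ln R).
Proof.
apply: measurable_far; apply: (measurableT_comp (@measurable_ln R)).
exact: measurable_norm2.
Qed.

Lemma riesz1_pot_remainder h : density h ->
  sqint mu (fun x => pot (@riesz1 R) h x - far1 x * Rintegral mu setT h).
Proof.
move=> dh; pose rho (z : plane R * plane R) := riesz1 z - far1 z.1.
have mr : measurable_fun setT rho.
  apply: measurable_funB; first exact: measurable_riesz1.
  by apply: (measurable_fun_fst measurable_far1).
have [ri r2] := remainder_sqint mr (riesz_far true) dh.
apply: sqint_eq r2; apply: filterS2 ri (potential_aeint near_lin_riesz1 dh) => x rx kx.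
rewrite /pot -Rint_cstM; last exact: density_aeint.
rewrite -RintB//; last by apply: aeintZ; exact: density_aeint.
by apply: eq_Rintegral => y _; rewrite /rho /= mulrBl.
Qed.

Lemma riesz2_pot_remainder h : density h ->
  sqint mu (fun x => pot (@riesz2 R) h x - far2 x * Rintegral mu setT h).
Proof.
move=> dh; pose rho (z : plane R * plane R) := riesz2 z - far2 z.1.
have mr : measurable_fun setT rho.
  apply: measurable_funB; first exact: measurable_riesz2.
  by apply: (measurable_fun_fst measurable_far2).
have [ri r2] := remainder_sqint mr (riesz_far false) dh.
apply: sqint_eq r2; apply: filterS2 ri (potential_aeint near_lin_riesz2 dh) => x rx kx.
rewrite /pot -Rint_cstM; last exact: density_aeint.
rewrite -RintB//; last by apply: aeintZ; exact: density_aeint.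
by apply: eq_Rintegral => y _; rewrite /rho /= mulrBl.
Qed.

(** The log |x| term of the expansion is multiplied by the integral of h,
    hence drops out. *)
Lemma log_pot_remainder h : density h -> Rintegral mu setT h = 0 ->
  sqint mu (fun x => pot (@log_ker R) h x +
    (far1 x * Rintegral mu setT (fun y => y.1 * h y) +
     far2 x * Rintegral mu setT (fun y => y.2 * h y))).
Proof.
move=> dh h0; pose rho (z : plane R * plane R) :=
  log_ker z - far_ln z.1 + (far1 z.1 * z.2.1 + far2 z.1 * z.2.2).
have mr : measurable_fun setT rho.
  apply: measurable_funD.
    apply: measurable_funB; first exact: measurable_log_ker.
    exact: (measurable_fun_fst measurable_far_ln).
  apply: measurable_funD; apply: measurable_funM.
  - exact: (measurable_fun_fst measurable_far1).
  - exact: (measurableT_comp measurable_fst).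
  - exact: (measurable_fun_fst measurable_far2).
  - exact: (measurableT_comp measurable_snd).
have [ri r2] := remainder_sqint mr (@log_far R) dh.
have hi := density_aeint dh; have m1 := density_moment1 dh.
have m2 := density_moment2 dh.
apply: sqint_eq r2; apply: filterS2 ri (potential_aeint near_lin_log dh) => x rx kx.
have -> : pot (@log_ker R) h x = pot (@log_ker R) h x - far_ln x * Rintegral mu setT h.
  by rewrite h0 mulr0 subr0.
rewrite /pot -!Rint_cstM// -RintB//; last exact: aeintZ.
rewrite -RintD//; [|exact: aeintZ|exact: aeintZ].
rewrite -RintD//; last by apply: aeintD; exact: aeintZ.
  by apply: eq_Rintegral => y _; rewrite /rho /=; ring.
by apply: aeintB => //; exact: aeintZ.
Qed.

End Potentials.

(** * Primitives and derivatives along rational increments *)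

Section LogPotentialDerivative.
Variable R : realType.
Notation mu := (leb2 R).
Notation lam := (@lebesgue_measure R).
Implicit Types (x y : plane R) (h g : plane R -> R).

Lemma is_derive_log_line y (s t : R) : s != y.2 ->
  is_derive t 1 (fun t : R => log_ker ((t, s), y)) (riesz1 ((t, s), y)).
Proof.
move=> sy; pose c := (s - y.2) ^+ 2.
have c0 : 0 < c by rewrite exprn_even_gt0//= subr_eq0.
pose p (t : R) := (t - y.1) ^+ 2 + c.
have p0 u : 0 < p u by rewrite ltr_wpDl// sqr_ge0.
have -> : (fun t : R => log_ker ((t, s), y)) = (fun t => 2^-1 * ln (p t)).
  apply/funext => u; rewrite /log_ker /dist2 /= -/c -/(p u).
  by rewrite (ln_sqrt (p0 u)) mulrA mulVf ?mul1r.
have dp : is_derive t 1 p (2 * (t - y.1)).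
  apply: is_derive_eq; rewrite /GRing.scale /=; ring.
have dl := is_derive1_ln (p0 t).
have dc : is_derive t 1 (@ln R \o p) ((p t)^-1 * (2 * (t - y.1))).
  exact: is_derive1_comp.
have dm (u : R) : is_derive u 1 (fun u : R => 2^-1 * u) 2^-1.
  by apply: is_derive_eq; rewrite /GRing.scale /=; ring.
apply: (is_derive_eq (is_derive1_comp (dm _) dc)).
rewrite /riesz1 sqr_dist2 /= -/c -/(p t); field.
by rewrite gt_eqF.
Qed.

Lemma riesz1_line_continuous y (s : R) : s != y.2 ->
  continuous (fun t : R => riesz1 ((t, s), y)).
Proof.
move=> sy t.
have c0 : 0 < (s - y.2) ^+ 2 by rewrite exprn_even_gt0//= subr_eq0.
have p0 (u : R) : (u - y.1) ^+ 2 + (s - y.2) ^+ 2 != 0.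
  by rewrite gt_eqF// ltr_wpDl// sqr_ge0.
under eq_fun do rewrite /riesz1 sqr_dist2 /=.
apply: cvgM; first by apply: cvgB; [exact: cvg_id | exact: cvg_cst].
apply: cvgV => //; apply: cvgD; last exact: cvg_cst.
by under eq_cvg do rewrite expr2; apply: cvgM; apply: cvgB;
  [exact: cvg_id | exact: cvg_cst | exact: cvg_id | exact: cvg_cst].
Qed.

Lemma log_ker_FTC y (s a b : R) : a < b -> s != y.2 ->
  (\int[lam]_(t in `[a, b]) (riesz1 ((t, s), y))%:E =
   (log_ker ((b, s), y))%:E - (log_ker ((a, s), y))%:E)%E.
Proof.
move=> ab sy; pose F (t : R) : R := log_ker ((t, s), y).
have dF (t : R) : is_derive t 1 F (riesz1 ((t, s), y)) by exact: is_derive_log_line.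
have cF (t : R) : {for t, continuous F}.
  by apply: differentiable_continuous; apply/derivable1_diffP; case: (dF t).
apply: (@continuous_FTC2 _ (fun t : R => riesz1 ((t, s), y)) F) => //.
- by apply: continuous_subspaceT; exact: riesz1_line_continuous.
- split.
  + by move=> t _; case: (dF t).
  + by apply: cvg_at_right_filter; exact: cF.
  + by apply: cvg_at_left_filter; exact: cF.
- by move=> t _; rewrite derive1E; apply: derive_val.
Qed.

(** Derivability tested on rational increments: for a continuous F this is the
    usual notion ([rat_derive_is_derive]), and it consists of countably many
    conditions, each of them measurable in parameters. *)
Definition rat_derive (F : R -> R) (t c : R) := forall k : nat, exists n : nat,
  forall q : rat, `|ratr q : R| < n.+1%:R^-1 ->
  `|F (t + ratr q) - F t - ratr q * c| <= `|ratr q : R| / k.+1%:R.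

Lemma natSinv_le (e : R) : 0 < e -> exists n : nat, n.+1%:R^-1 <= e.
Proof.
move=> e0; exists (Num.bound e^-1).
have := archi_boundP (ltW (_ : 0 < e^-1)); rewrite invr_gt0 => /(_ e0) h.
rewrite invf_ple ?posrE// ltW// (lt_trans h)// ltr_nat//.
Qed.

Lemma derivable_rat_derive (F : R -> R) (t : R) :
  derivable F t 1 -> rat_derive F t (derive1 F t).
Proof.
move=> dF k.
have /cvgrPdist_lt : (fun h : R => h^-1 *: ((F \o shift t) (h *: 1) - F t)) @ 0^' -->
    derive1 F t by rewrite derive1E; exact: dF.
have k0 : 0 < k.+1%:R^-1 :> R by rewrite invr_gt0.
move=> /(_ _ k0)[d /= d0 dP].
have [n nd] := natSinv_le d0; exists n => q qn.
have [->|q0] := eqVneq (ratr q : R) 0.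
  by rewrite addr0 subrr mul0r subr0 normr0 mul0r.
have := dP (ratr q); rewrite /ball /= sub0r normrN.
move=> /(_ (lt_le_trans qn nd) q0) /ltW.
rewrite /GRing.scale /= mulr1 [ratr q + t]addrC => H.
have -> : F (t + ratr q) - F t - ratr q * derive1 F t =
    - (ratr q * (derive1 F t - (ratr q)^-1 * (F (t + ratr q) - F t))).
  by rewrite mulrBr mulrA mulfV// mul1r opprB.
by rewrite normrN normrM ler_wpM2l.
Qed.

(** By continuity, an inequality that is strictly violated at a real increment
    is also violated at a rational one nearby. *)
Lemma rat_derive_is_derive (F : R -> R) (t c : R) : continuous F ->
  rat_derive F t c -> is_derive t 1 F c.
Proof.
move=> cF rF.
suff Fc : (fun h : R => h^-1 *: ((F \o shift t) (h *: 1) - F t)) @ 0^' --> c.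
  apply: DeriveDef; first by apply/cvg_ex; exists c.
  by apply/cvg_lim => //; exact: Rhausdorff.
apply/cvgrPdist_le => e e0.
have [k ke] := natSinv_le e0; have [n nP] := rF k.
have n0 : 0 < n.+1%:R^-1 :> R by rewrite invr_gt0.
exists (n.+1%:R^-1) => //= h; rewrite /ball /= sub0r normrN => hn h0.
have main : `|F (t + h) - F t - h * c| <= `|h| / k.+1%:R.
  rewrite leNgt; apply/negP; rewrite -subr_gt0.
  pose G (u : R) := `|F (t + u) - F t - u * c| - `|u| / k.+1%:R.
  have cG : {for h, continuous G}.
    apply: cvgB.
      apply: cvg_norm; apply: cvgB; last by apply: cvgMl; exact: cvg_id.
      apply: cvgB; last exact: cvg_cst.
      apply: (@continuous_comp _ _ _ (fun u : R => t + u) F); last exact: cF.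
      by apply: cvgD; [exact: cvg_cst|exact: cvg_id].
    by apply: cvgMl; apply: cvg_norm; exact: cvg_id.
  move=> /(cvgr_gt _ cG) [d /= d0 dG].
  have hn' : 0 < n.+1%:R^-1 - `|h| by rewrite subr_gt0.
  pose r := Num.min d (n.+1%:R^-1 - `|h|).
  have r0 : 0 < r by rewrite lt_min d0.
  have hr : h - r < h + r by lra.
  have [q] := rat_in_itvoo hr.
  rewrite in_itv/= => /andP[q1 q2].
  have hq : `|h - ratr q| < r by rewrite ltr_norml; apply/andP; split; lra.
  move: (hq); rewrite lt_min => /andP[hqd hqn].
  have := dG (ratr q) hqd; rewrite /G subr_gt0 ltNge nP//.
  have -> : ratr q = h - (h - ratr q) by ring.
  by apply: le_lt_trans (ler_normB _ _) _; rewrite -ltrBrDl.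
rewrite /GRing.scale /= mulr1 [h + t]addrC.
have -> : c - h^-1 * (F (t + h) - F t) = - (h^-1 * (F (t + h) - F t - h * c)).
  by rewrite [in RHS]mulrBr mulrA mulVf// mul1r opprB.
rewrite normrN normrM normfV ler_pdivrMl ?normr_gt0//.
by apply: (le_trans main); rewrite ler_wpM2l.
Qed.

(** Lebesgue differentiation theorem, applied on a bounded interval around
    each point. *)
Lemma primitive_ae_derive (F G : R -> R) : measurable_fun setT G ->
  (forall a b, a < b -> lam.-integrable `[a, b] (EFin \o G)) ->
  (forall a b, a < b -> F b - F a = Rintegral lam `[a, b] G) ->
  continuous F /\ {ae lam, forall t, derivable F t 1 /\ derive1 F t = G t}.
Proof.
move=> mG iG FG.
have FE (a b : R) : a < b -> F b = F a + Rintegral lam `[a, b] G.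
  by move=> ab; rewrite -FG//; ring.
split.
  move=> t.
  have ab : t - 1 < t + 1 by lra.
  have := @parameterized_integral_continuous R (t - 1) (t + 1) G (ltW ab) (iG _ _ ab).
  move=> /continuous_within_itvP => /(_ ab) [ct _ _].
  have tin : t \in `](t - 1), (t + 1)[ by rewrite in_itv/=; apply/andP; split; lra.
  have := ct t tin => ctt.
  have e : {near t, (fun u => F (t - 1) + Rintegral lam `[t - 1, u] G) =1 F}.
    have : \forall u \near t, t - 1 < u by apply: lt_nbhsr; lra.
    by apply: filterS => u tu; rewrite -FE.
  apply: cvg_trans (near_eq_cvg e) _.
  rewrite (FE (t - 1) t); last by lra.
  by apply: cvgD; [exact: cvg_cst | exact: ctt].
have lG : locally_integrable setT G.
  split => //; first exact: openT.
  move=> K _ cK.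
  have [M [Mr MK]] := compact_bounded cK.
  have KM : K `<=` `[- (`|M| + 1), `|M| + 1].
    move=> u Ku; rewrite /= in_itv/= -ler_norml; apply: (MK (`|M| + 1)) => //.
    by rewrite (le_lt_trans (ler_norm M))// ltrDl.
  have M1 : - (`|M| + 1) < `|M| + 1 by have := normr_ge0 M; lra.
  have /integrableP[_] := iG _ _ M1; apply: le_lt_trans.
  apply: ge0_subset_integral => //; first exact: compact_measurable.
  apply/measurable_EFinP; apply: measurableT_comp => //.
  exact: measurable_funS mG.
have := lebesgue_differentiation lG.
apply: filterS; first exact: (ae_filter_ringOfSetsType lam).
move=> t tG.
have t1 : t < t + 1 by lra.
have t2 : t - 1 < t + 1 by lra.
pose I0 (u : R) := Rintegral lam `[t - 1, u] G.
have [dI IE] : derivable I0 t 1 /\ derive1 I0 t = G t.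
  apply: (FTC1_lebesgue_pt t1 (iG _ _ t2) _ tG).
  by rewrite lte_fin; lra.
pose I (u : R) := F (t - 1) + I0 u.
have dI' : is_derive t 1 I (G t).
  rewrite -[G t]add0r; apply: is_deriveD.
  by apply: DeriveDef; [exact: dI|rewrite -derive1E].
have e : {near t, I =1 F}.
  have : \forall u \near t, t - 1 < u by apply: lt_nbhsr; lra.
  by apply: filterS => u tu; rewrite /I -FE.
have dF : is_derive t 1 F (G t) by exact: (near_eq_is_derive (g := F) e dI').
by split; [case: dF | rewrite derive1E; apply: derive_val].
Qed.

End LogPotentialDerivative.

(** * The logarithmic potential on horizontal lines *)

Section LogPotentialLine.
Variable R : realType.
Notation mu := (leb2 R).
Notation lam := (@lebesgue_measure R).
Implicit Types (x y : plane R) (h g : plane R -> R).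

Lemma ae_plane_snd (P : R -> Prop) : {ae lam, forall s, P s} ->
  {ae mu, forall x, P x.2}.
Proof.
move=> [N [mN N0 subN]]; exists (setT `*` N); split.
- exact: measurableX.
- have -> : mu (setT `*` N) = (lam setT * lam N)%E by exact: product_measure1E.
  by rewrite N0 mule0.
- by move=> x nPx; split => //; exact: subN.
Qed.

Lemma leb2_hline (s : R) : {ae mu, forall y : plane R, s != y.2}.
Proof.
have := @ae_plane_snd (fun u => s != u); apply.
exists [set s]; split => //; first exact: lebesgue_measure_set1.
by move=> u /= /negP; rewrite negbK => /eqP ->.
Qed.

(** Tonelli for the indicator of the complement of D. *)
Lemma ae_plane_sections (D : set (plane R)) : measurable D ->
  {ae lam, forall s, {ae lam, forall t, D (t, s)}} -> {ae mu, forall x, D x}.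
Proof.
move=> mD aeD; exists (~` D); split => //; first exact: measurableC.
have mCD : measurable (~` D) by exact: measurableC.
rewrite -[~` D]setIT -integral_indic//.
have -> : (\int[mu]_x (\1_(~` D) x)%:E =
    \int[lam]_s \int[lam]_t (\1_(~` D) (t, s))%:E)%E.
  apply: (@fubini_tonelli2 _ _ _ _ R lam lam (EFin \o \1_(~` D))).
    by apply/measurable_EFinP; exact: measurable_indic.
  by move=> x; rewrite lee_fin.
transitivity (\int[lam]_s (0 : \bar R))%E; last by rewrite integral0.
apply: ae_integral_eq; apply: filterS aeD => s Ds.
transitivity (\int[lam]_s (0 : \bar R))%E; last by rewrite integral0.
apply: ae_integral_eq; apply: filterS Ds => t Dts.
by rewrite indicE memNset// => /(_ Dts).
Qed.

Lemma aeint_integrable (f : R -> R) : measurable_fun setT f -> aeint lam f ->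
  lam.-integrable setT (EFin \o f).
Proof.
by move=> mf [_ fi]; apply/integrableP; split => //; exact/measurable_EFinP.
Qed.

Lemma log_pot_aeint h x : density h -> aeint mu (fun y => log_ker (x, y) * h y).
Proof.
move=> dh; have h2 := sqint_sq (density_sqint dh).
have wh := aeint_norm (density_weight dh).
have ni : aeint mu (fun y => near_ker (x, y)).
  split.
    apply: measurable_aemeas.
    by apply: (measurableT_comp (@measurable_near_ker R)).
  under eq_integral do rewrite ger0_norm ?near_ker_ge0//.
  by apply: le_lt_trans (near_ker_int x) _; rewrite ltry.
apply: (aeint_dom _ (aeintD (aeintD (aeintZ 4 ni) h2) (aeintZ (1 + norm2 x) wh))).
  apply: aemeasM; last exact: density_aemeas.
  apply: measurable_aemeas.
  by apply: (measurableT_comp (@measurable_log_ker R)).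
apply: aeW => y; rewrite [`|(1 + _) * _|]normrM [`|1 + norm2 y|]ger0_norm ?lin_weight_ge0//.
exact: log_ker_sqr_le.
Qed.

Section Line.
Variable g : plane R -> R.
Hypotheses (mg : measurable_fun setT g) (dg : density g).

Let E x : \bar R := (\int[mu]_y (near_ker (x, y) * `|g y|)%:E)%E.

Let mF : measurable_fun setT
  (fun z : plane R * plane R => near_ker z * `|g z.2|).
Proof.
apply: measurable_funM; first exact: measurable_near_ker.
by apply: measurableT_comp => //; exact: measurable_fun_snd.
Qed.

Let E0 x : (0 <= E x)%E.
Proof. by apply: integral_ge0 => y _; rewrite lee_fin mulr_ge0 ?near_ker_ge0. Qed.

Let mE : measurable_fun setT E.
Proof.
apply: (measurable_fun_fubini_tonelli_F (m2 := @leb2s R)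
  (fun z => (near_ker z * `|g z.2|)%:E)); first exact/measurable_EFinP.
by move=> z; rewrite lee_fin mulr_ge0 ?near_ker_ge0.
Qed.

Let g1 : (\int[mu]_y `|g y|%:E < +oo)%E.
Proof. by have [] := density_aeint dg. Qed.

(** The near-diagonal potential of |g| is integrable on the plane, hence on
    almost every horizontal line. *)
Lemma near_pot_line : {ae lam, forall s, (\int[lam]_t E (t, s) < +oo)%E}.
Proof.
have Ei : (lam \x lam)%E.-integrable setT E.
  apply/integrableP; split; first exact: mE.
  under eq_integral do rewrite gee0_abs//.
  apply: (@schur_integrable _ _ _ (@leb2s R) _ 32 (@measurable_near_ker R)
    (@near_ker_ge0 R) _ _ g mg g1) => // y.
  by under eq_integral do rewrite near_kerC; exact: near_ker_int.
have := ae_integrable2 Ei; apply: filterS => s /integrableP[_].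
by under eq_integral do rewrite gee0_abs//.
Qed.

Let mpot1 : measurable_fun setT (pot (@riesz1 R) g).
Proof.
apply: (@measurable_Rint_param _ _ _ (@leb2s R) (fun z => riesz1 z * g z.2)).
by apply: measurable_funM; [exact: measurable_riesz1|exact: measurable_fun_snd].
Qed.

Let mpotl : measurable_fun setT (pot (@log_ker R) g).
Proof.
apply: (@measurable_Rint_param _ _ _ (@leb2s R) (fun z => log_ker z * g z.2)).
by apply: measurable_funM; [exact: measurable_log_ker|exact: measurable_fun_snd].
Qed.

Lemma measurable_line (f : plane R -> R) (s : R) : measurable_fun setT f ->
  measurable_fun setT (fun t : R => f (t, s)).
Proof. by move=> mf; apply: measurableT_comp => //; exact: measurable_pair2. Qed.

(** For almost every y the kernel is continuously differentiable on the line,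
    so the formula holds for the kernel; Fubini integrates it in y. The
    singular part of the gradient is controlled by E, whose integral on the
    line is assumed finite. *)
Lemma log_pot_line (s a b : R) : (\int[lam]_t E (t, s) < +oo)%E -> a < b ->
  lam.-integrable `[a, b] (EFin \o (fun t => pot (@riesz1 R) g (t, s))) /\
  pot (@log_ker R) g (b, s) - pot (@log_ker R) g (a, s) =
  Rintegral lam `[a, b] (fun t => pot (@riesz1 R) g (t, s)).
Proof.
move=> Es ab.
pose c (t : R) : R := \1_(`[a, b]%classic : set R) t.
have mc : measurable_fun setT c by apply: measurable_indic; exact: measurable_itv.
pose Phi (z : R * plane R) : R := c z.1 * (riesz1 ((z.1, s), z.2) * g z.2).
have mPhi : measurable_fun setT Phi.
  apply: measurable_funM; first exact: measurableT_comp.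
  apply: measurable_funM; last exact: measurableT_comp.
  apply: (measurableT_comp (@measurable_riesz1 R)).
  apply: measurable_fun_pair => //=.
  by apply: measurable_fun_pair.
have c0 t : 0 <= c t by rewrite /c.
have c1 t : c t <= 1 by rewrite /c indicE lern1 leq_b1.
have mEs : measurable_fun setT (fun t : R => E (t, s)).
  by apply: (measurableT_comp mE); exact: measurable_pair2.
have Phii : (lam \x @leb2s R)%E.-integrable setT (EFin \o Phi).
  apply/integrable12ltyP; first exact/measurable_EFinP.
  apply: (@le_lt_trans _ _ (\int[lam]_t (E (t, s) +
      (\int[mu]_y `|g y|%:E) * (c t)%:E))%E).
    apply: ae_ge0_integral_le.
    - by move=> t; apply: integral_ge0.
    - move=> t; apply: adde_ge0 => //; apply: mule_ge0; rewrite ?lee_fin//.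
      by apply: integral_ge0.
    apply: aeW => t /=.
    apply: (@le_trans _ _ (\int[mu]_y
        ((near_ker ((t, s), y) * `|g y|)%:E + (c t * `|g y|)%:E))%E).
      apply: ae_ge0_integral_le => //.
        move=> y; apply: adde_ge0; rewrite lee_fin.
          by rewrite mulr_ge0 ?near_ker_ge0.
        by rewrite mulr_ge0.
      apply: aeW => y; rewrite lee_fin /Phi /= normrM [`|_ * g y|]normrM [`|c t|]ger0_norm//.
      rewrite mulrA -mulrDl ler_wpM2r//.
      have := riesz1_le (t, s) y; have := near_ker_ge0 ((t, s), y).
      have := c0 t; have := c1 t => d1 d0 k0 rl.
      apply: (@le_trans _ _ (c t * (near_ker ((t, s), y) + 1))).
        exact: (ler_wpM2l d0 rl).
      by rewrite mulrDr mulr1 lerD2r -[leRHS]mul1r ler_wpM2r.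
    rewrite ge0_integralD//; last 4 first.
    - by move=> y _; rewrite lee_fin mulr_ge0 ?near_ker_ge0.
    - by apply/measurable_EFinP; exact: (measurable_section (t, s) mF).
    - by move=> y _; rewrite lee_fin mulr_ge0.
    - apply/measurable_EFinP; apply: measurable_funM => //.
      exact: measurableT_comp.
    rewrite leeD2l//; under eq_integral do rewrite EFinM.
    rewrite ge0_integralZl_EFin//; first by rewrite muleC.
    by apply/measurable_EFinP; exact: measurableT_comp.
  have gE : (\int[mu]_y `|g y|%:E = (fine (\int[mu]_y `|g y|%:E))%:E)%E.
    by rewrite fineK// ge0_fin_numE//; apply: integral_ge0.
  have G0 : 0 <= fine (\int[mu]_y `|g y|%:E)%E.
    by apply: fine_ge0; apply: integral_ge0.
  rewrite gE; set G := fine _ in G0 *.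
  rewrite ge0_integralD//; last 2 first.
  - by move=> t _; rewrite -EFinM lee_fin mulr_ge0.
  - by apply: emeasurable_funM => //; exact/measurable_EFinP.
  apply: lte_add_pinfty => //.
  rewrite ge0_integralZl_EFin//; last 2 first.
  - by move=> t _; rewrite lee_fin.
  - exact/measurable_EFinP.
  rewrite lte_mul_pinfty// ?lee_fin//.
  rewrite /c integral_indic// setIT.
  have lab : lam `[a, b] = (b - a)%:E.
    by rewrite lebesgue_measure_itv /= lte_fin ab -EFinB.
  by apply: (@le_lt_trans _ _ (b - a)%:E); [rewrite -lab | exact: ltry].
pose K t := pot (@riesz1 R) g (t, s).
have sec : {ae lam, forall t, fubini_F (@leb2s R) (EFin \o Phi) t = (c t * K t)%:E}.
  have := ae_integrable1 Phii; apply: filterS.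
  move=> t it; rewrite /fubini_F /K /pot.
  have [ct|ct] := eqVneq (c t) 0.
    rewrite ct mul0r integral0_eq// => y _.
    by rewrite /Phi /= ct mul0r.
  have ig : aeint mu (fun y => riesz1 ((t, s), y) * g y).
    apply: aeint_eq (aeintZ (c t)^-1 (integrable_aeint it)).
    by apply: aeW => y; rewrite /Phi /=; field.
  rewrite -Rint_cstM// /Rintegral fineK//.
  exact: integrable_fin_num it.
have iK : lam.-integrable setT (EFin \o (fun t => c t * K t)).
  apply: aeint_integrable.
    by apply: measurable_funM => //; exact: measurable_line.
  split.
    apply: measurable_aemeas.
    by apply: measurable_funM => //; exact: measurable_line.
  have /integrableP[_] := integrable_fubini_F Phii; apply: le_lt_trans.
  apply: ae_ge0_integral_le => //.
  apply: filterS sec; first exact: (ae_filter_ringOfSetsType lam).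
  by move=> t; rewrite /fubini_F /= => ->; rewrite abse_EFin.
have cK : (fun t => c t * K t) = K \_ `[a, b].
  by apply/funext => t; rewrite /c /patch indicE; case: ifP; rewrite ?mul1r ?mul0r.
split.
  apply/integrable_mkcond; first exact: measurable_itv.
  by move: iK; rewrite cK -restrict_EFin.
have secy : {ae mu, forall y, fubini_G lam (EFin \o Phi) y =
    ((log_ker ((b, s), y) - log_ker ((a, s), y)) * g y)%:E}.
  apply: filterS (leb2_hline s) => y sy; rewrite /fubini_G /=.
  have FTC := log_ker_FTC ab sy.
  have -> : (fun t => (Phi (t, y))%:E) =
      (fun t => (EFin \o (fun t => riesz1 ((t, s), y) * g y)) t) \_ `[a, b].
    apply/funext => t; rewrite /Phi /c /patch /= indicE.
    by case: ifP; rewrite ?mul1r ?mul0r.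
  rewrite -integral_mkcond /=.
  under eq_integral do rewrite EFinM.
  rewrite integralZr//; first by rewrite FTC.
  apply: continuous_compact_integrable; first exact: segment_compact.
  by apply: continuous_subspaceT; exact: riesz1_line_continuous.
have La := log_pot_aeint (a, s) dg; have Lb := log_pot_aeint (b, s) dg.
rewrite -[LHS]RintB//.
transitivity (Rintegral mu setT
    (fun y => (log_ker ((b, s), y) - log_ker ((a, s), y)) * g y)).
  by apply: eq_Rintegral => y _; rewrite mulrBl.
rewrite [RHS]Rintegral_mkcond -/(K) -cK /Rintegral; congr fine.
transitivity (\int[mu]_y fubini_G lam (EFin \o Phi) y)%E.
  by apply: ae_integral_eq; apply: filterS secy => y ->.
transitivity (\int[lam]_t fubini_F (@leb2s R) (EFin \o Phi) t)%E.
  rewrite (integral12_prod_meas1 Phii).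
  exact: (integral21_prod_meas1 Phii).
apply: ae_integral_eq; apply: filterS sec; first exact: (ae_filter_ringOfSetsType lam).
by move=> t ->.
Qed.

(** On almost every line the potential is a primitive, so almost every point
    of the line lies in D; as D is a countable combination of measurable sets,
    almost every point of the plane does. *)
Lemma log_pot_is_derive_ae :
  {ae mu, forall x, is_derive (x.1 : R) 1
    (fun t : R => pot (@log_ker R) g (t, x.2)) (pot (@riesz1 R) g x)}.
Proof.
pose L := pot (@log_ker R) g; pose K := pot (@riesz1 R) g.
have good : {ae lam, forall s, continuous (fun t : R => L (t, s)) /\
    {ae lam, forall t, derivable (fun t : R => L (t, s)) t 1 /\
      derive1 (fun t : R => L (t, s)) t = K (t, s)}}.
  apply: filterS near_pot_line => s Es.
  apply: primitive_ae_derive.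
  - exact: measurable_line.
  - by move=> a b ab; have [] := log_pot_line Es ab.
  - by move=> a b ab; have [] := log_pot_line Es ab.
pose A (k n : nat) (q : rat) : set (plane R) := [set x |
  `|ratr q : R| < n.+1%:R^-1 ->
  `|L (x.1 + ratr q, x.2) - L x - ratr q * K x| <= `|ratr q : R| / k.+1%:R].
pose D : set (plane R) := [set x |
  rat_derive (fun t : R => L (t, x.2)) x.1 (K x)].
(* the condition is vacuous unless the increment q is smaller than 1 / (n + 1) *)
have mA k n q : measurable (A k n q).
  have [qn|qn] := boolP (`|ratr q : R| < n.+1%:R^-1); last first.
    rewrite (_ : A k n q = setT)//; apply/seteqP; split => // x _ /=.
    by move=> /idP; rewrite (negbTE qn).
  pose f x := `|L (x.1 + ratr q, x.2) - L x - ratr q * K x|.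
  have mf : measurable_fun setT f.
    apply: measurableT_comp => //; apply: measurable_funB; last first.
      by apply: measurable_funM => //; exact: mpot1.
    apply: measurable_funB; last exact: mpotl.
    apply: (measurableT_comp mpotl); apply: measurable_fun_pair => //=.
    by apply: measurable_funD.
  rewrite (_ : A k n q = f @^-1` `]-oo, `|ratr q : R| / k.+1%:R]).
    by rewrite -[X in measurable X]setTI; apply: mf => //; exact: measurable_itv.
  apply/seteqP; split => x /=; rewrite in_itv/=; first exact.
  by move=> ? _.
have DE : D = \bigcap_k \bigcup_n \bigcap_(q in @setT rat) A k n q.
  apply/seteqP; split => x /=.
    by move=> Dx k _; have [n nP] := Dx k; exists n => // q _; exact: nP.
  by move=> Dx k; have [n _ nP] := Dx k I; exists n => q; exact: nP.
have mD : measurable D.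
  rewrite DE; apply: bigcapT_measurable => k; apply: bigcupT_measurable => n.
  rewrite -[X in measurable X]setCK setC_bigcap; apply: measurableC.
  by apply: bigcupT_measurable_rat => q; apply: measurableC; exact: mA.
have aeD : {ae mu, forall x, D x}.
  apply: ae_plane_sections => //; apply: filterS good => s [_].
  apply: filterS; first exact: (ae_filter_ringOfSetsType lam).
  move=> t [dL eL]; rewrite /D /=.
  rewrite -[K _]eL; exact: derivable_rat_derive.
have cont := ae_plane_snd good.
apply: filterS2 aeD cont => x Dx [cx _].
exact: rat_derive_is_derive.
Qed.

End Line.
End LogPotentialLine.

(** * Both partial derivatives; square integrability of the leading terms *)

Section CoordinateSwap.
Variable R : realType.
Notation mu := (leb2 R).
Notation lam := (@lebesgue_measure R).
Implicit Types (x y : plane R) (h g : plane R -> R).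

Definition swap2 x : plane R := (x.2, x.1).

Lemma measurable_swap2 : measurable_fun setT swap2.
Proof. by apply: measurable_fun_pair; [exact: measurable_snd|exact: measurable_fst]. Qed.

Lemma ge0_integral_swap2 (f : plane R -> \bar R) : measurable_fun setT f ->
  (forall x, 0 <= f x)%E -> (\int[mu]_x f (swap2 x) = \int[mu]_x f x)%E.
Proof.
move=> mf f0.
have -> : (\int[mu]_x f (swap2 x) = \int[lam]_a \int[lam]_b f (b, a))%E.
  apply: (@fubini_tonelli1 _ _ _ _ R lam lam (f \o swap2)).
    by apply: measurableT_comp => //; exact: measurable_swap2.
  by move=> x; exact: f0.
by symmetry; apply: (@fubini_tonelli2 _ _ _ _ R lam lam f).
Qed.

Lemma ae_swap2 (P : plane R -> Prop) : {ae mu, forall x, P x} ->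
  {ae mu, forall x, P (swap2 x)}.
Proof.
move=> [N [mN N0 subN]]; exists (swap2 @^-1` N).
have mN' : measurable (swap2 @^-1` N).
  by rewrite -[X in measurable X]setTI; exact: measurable_swap2.
split => //; last by move=> x nPx; exact: subN.
rewrite -[swap2 @^-1` N]setIT -integral_indic//.
rewrite -N0 -[in RHS](setIT N) -integral_indic//.
apply: (@ge0_integral_swap2 (EFin \o \1_N)).
  by apply/measurable_EFinP; exact: measurable_indic.
by move=> x; rewrite lee_fin.
Qed.

Lemma aemeas_swap2 h : aemeas mu h -> aemeas mu (h \o swap2).
Proof.
move=> [g mg hg]; exists (g \o swap2); last exact: (ae_swap2 hg).
by apply: measurableT_comp => //; exact: measurable_swap2.
Qed.

Lemma aeint_swap2 h : aeint mu h -> aeint mu (h \o swap2).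
Proof.
move=> [mh hi]; split; first exact: aemeas_swap2.
have [g mg hg] := mh.
have -> : (\int[mu]_x `|(h \o swap2) x|%:E = \int[mu]_x `|g (swap2 x)|%:E)%E.
  by apply: ae_integral_eq; apply: filterS (ae_swap2 hg) => x /= ->.
rewrite (@ge0_integral_swap2 (fun x => `|g x|%:E)%E)//; last first.
  by apply/measurable_EFinP; exact: measurableT_comp.
apply: le_lt_trans hi; rewrite le_eqVlt; apply/orP; left; apply/eqP.
by apply: ae_integral_eq; apply: filterS hg => x ->.
Qed.

Lemma Rint_swap2 h : aemeas mu h ->
  Rintegral mu setT (h \o swap2) = Rintegral mu setT h.
Proof.
move=> [g mg hg]; rewrite (ae_Rintegral_eq hg).
rewrite (ae_Rintegral_eq (ae_swap2 hg)) /Rintegral; congr fine.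
have mE : measurable_fun setT (EFin \o g) by exact/measurable_EFinP.
rewrite integralE [RHS]integralE; congr (_ - _)%E.
  rewrite -[RHS]ge0_integral_swap2//; last exact: measurable_funepos.
  by apply: eq_integral => x _; rewrite !funeposE.
rewrite -[RHS]ge0_integral_swap2//; last exact: measurable_funeneg.
by apply: eq_integral => x _; rewrite !funenegE.
Qed.

Lemma norm2_swap2 x : norm2 (swap2 x) = norm2 x.
Proof. by rewrite /norm2 /= addrC. Qed.

Lemma dist2_swap2 x y : dist2 (swap2 x) y = dist2 x (swap2 y).
Proof. by rewrite /dist2 /= addrC. Qed.

Lemma sqint_swap2 h : sqint mu h -> sqint mu (h \o swap2).
Proof.
move=> /sqintP[mh hi]; apply/sqintP; split; first exact: aemeas_swap2.
exact: (aeint_swap2 hi).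
Qed.

Lemma density_swap2 h : density h -> density (h \o swap2).
Proof.
move=> [h2 h1]; split.
  apply: sqint_eq (sqint_swap2 h2); apply: aeW => x /=.
  by rewrite norm2_swap2.
apply: aeint_eq (aeint_swap2 h1); apply: aeW => x /=.
by rewrite norm2_swap2.
Qed.

Lemma pot_ae_eq kap h g : {ae mu, forall x, h x = g x} -> pot kap h = pot kap g.
Proof.
move=> hg; apply/funext => x; apply: ae_Rintegral_eq.
by apply: filterS hg => y ->.
Qed.

Lemma log_pot_partial1 h : density h ->
  {ae mu, forall x, is_derive (x.1 : R) 1
    (fun t : R => pot (@log_ker R) h (t, x.2)) (pot (@riesz1 R) h x)}.
Proof.
move=> dh; have [g mg hg] := density_aemeas dh.
rewrite !(pot_ae_eq _ hg); apply: log_pot_is_derive_ae => //.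
exact: density_eq hg dh.
Qed.

(** Exchange of the two coordinates. *)
Lemma log_pot_partial2 h : density h ->
  {ae mu, forall x, is_derive (x.2 : R) 1
    (fun t : R => pot (@log_ker R) h (x.1, t)) (pot (@riesz2 R) h x)}.
Proof.
move=> dh; have mh := density_aemeas dh.
have key (k1 k2 : plane R * plane R -> R) x : measurable_fun setT k2 ->
    (forall y, k1 (swap2 x, y) = k2 (x, swap2 y)) ->
    pot k1 (h \o swap2) (swap2 x) = pot k2 h x.
  move=> mk kk; rewrite /pot -(@Rint_swap2 (fun y => k2 (x, y) * h y)).
    by apply: eq_Rintegral => y _; rewrite kk.
  apply: aemeasM => //; apply: measurable_aemeas.
  by apply: (measurableT_comp mk).
have := ae_swap2 (log_pot_partial1 (density_swap2 dh)).
apply: filterS => x /=.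
rewrite (@key _ (@riesz2 R)) //; last 2 first.
- exact: measurable_riesz2.
- by move=> y; rewrite /riesz1 /riesz2 /= dist2_swap2.
rewrite (_ : (fun t : R => pot (@log_ker R) (h \o swap2) (t, x.1)) =
  (fun t : R => pot (@log_ker R) h (x.1, t)))//.
apply/funext => t; rewrite -(@key (@log_ker R) (@log_ker R) (x.1, t))//.
  exact: measurable_log_ker.
by move=> y; rewrite /log_ker /= dist2_swap2.
Qed.

(** On the rectangle B n, of area proportional to 4^n, the second term is at
    most half of the first and the function has size at least a multiple of
    2^(- n). Hence all the disjoint rectangles contribute at least the same
    positive amount to the integral of the square. *)
Lemma far_sqint_coef1 (a1 a2 : R) :
  sqint mu (fun x => a1 * far1 x + a2 * far2 x) -> a1 = 0.
Proof.
move=> s2; apply/eqP; apply: contraT => a10.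
pose F x := a1 * far1 x + a2 * far2 x.
have a1p : 0 < `|a1| by rewrite normr_gt0.
(* slope of the sector on which the term in a1 dominates *)
pose dl : R := `|a1| / (2 * (`|a1| + `|a2|)).
have d2p : 0 < 2 * (`|a1| + `|a2|) by rewrite mulr_gt0// ltr_wpDr.
have dlp : 0 < dl by rewrite divr_gt0.
have dl1 : dl <= 1.
  rewrite ler_pdivrMr// mul1r; have := normr_ge0 a2; lra.
have dl2 : `|a2| * dl <= `|a1| / 2.
  rewrite /dl mulrA ler_pdivrMr// mulrAC ler_pdivlMr//.
  by have := mulr_ge0 (ltW a1p) (ltW a1p); nra.
pose B (n : nat) : set (plane R) :=
  `[2 ^+ n, 2 ^+ n.+1[ `*` `[0, dl * 2 ^+ n].
have mB n : measurable (B n) by apply: measurableX; exact: measurable_itv.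
have p2 n : 0 < 2 ^+ n :> R by exact: exprn_gt0.
have Bm n : mu (B n) = (dl * 4 ^+ n)%:E.
  have -> : mu (B n) = (lam `[(2 ^+ n)%R, (2 ^+ n.+1)%R[ * lam `[0%R, (dl * 2 ^+ n)%R])%E.
    by apply: product_measure1E; exact: measurable_itv.
  rewrite !lebesgue_measure_itv /= !lte_fin mulr_gt0// exprS ltr_pMl ?ltr1n//.
  rewrite -!EFinB -EFinM; congr (_%:E).
  have -> : 4 ^+ n = 2 ^+ n * 2 ^+ n :> R by rewrite -exprMn; congr (_ ^+ n); ring.
  by ring.
pose e : R := `|a1| ^+ 2 / 100.
have Fb n x : B n x -> e / 4 ^+ n <= F x ^+ 2.
  move=> [] /=; rewrite !in_itv/= => /andP[x1l x1u] /andP[x2l x2u].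
  have pn := p2 n.
  have n4 : 4 ^+ n = (2 ^+ n) ^+ 2 :> R.
    by rewrite -exprM mulnC exprM; congr (_ ^+ n); ring.
  have x1p : 0 < x.1 by exact: lt_le_trans x1l.
  have x2b : x.2 <= 2 ^+ n by apply: le_trans x2u _; rewrite -[leRHS]mul1r ler_pM2r.
  have n1 : 1 <= norm2 x.
    apply: le_trans (le_trans (ler_norm _) (norm2_coord1 x)).
    by apply: le_trans x1l; rewrite exprn_ege1// ler1n.
  have np : 0 < norm2 x by lra.
  have nb : norm2 x ^+ 2 <= 5 * 4 ^+ n.
    rewrite sqr_norm2 n4; move: x1u; rewrite exprS => x1u.
    have : x.1 ^+ 2 <= (2 * 2 ^+ n) ^+ 2 by rewrite ler_sqr ?nnegrE ?ltW// mulr_gt0.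
    have : x.2 ^+ 2 <= (2 ^+ n) ^+ 2 by rewrite ler_sqr ?nnegrE// ltW.
    by rewrite exprMn; lra.
  have FE : F x = (a1 * x.1 + a2 * x.2) / norm2 x ^+ 2.
    by rewrite /F /far1 /far2 n1; field; rewrite gt_eqF.
  have num : `|a1| / 2 * 2 ^+ n <= `|a1 * x.1 + a2 * x.2|.
    have t1 : `|a1| * x.1 <= `|a1 * x.1 + a2 * x.2| + `|a2| * x.2.
      have -> : `|a1| * x.1 = `|(a1 * x.1 + a2 * x.2) - a2 * x.2|.
        by rewrite addrK normrM [`|x.1|]gtr0_norm.
      apply: le_trans (ler_normB _ _) _.
      by rewrite [`|a2 * _|]normrM [`|x.2|]ger0_norm.
    have t2 : `|a2| * x.2 <= `|a1| / 2 * 2 ^+ n.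
      apply: (@le_trans _ _ (`|a2| * (dl * 2 ^+ n))); first by rewrite ler_wpM2l.
      by rewrite mulrA ler_wpM2r// ltW.
    have t3 : `|a1| * 2 ^+ n <= `|a1| * x.1 by rewrite ler_wpM2l.
    by lra.
  rewrite FE expr_div_n ler_pdivlMr ?exprn_gt0//.
  rewrite -[leRHS]real_normK ?num_real//.
  apply: (@le_trans _ _ ((`|a1| / 2 * 2 ^+ n) ^+ 2)); last first.
    by rewrite ler_sqr ?nnegrE// mulr_ge0 ?divr_ge0// ltW.
  apply: (@le_trans _ _ (e / 4 ^+ n * (5 * 4 ^+ n) ^+ 2)).
    rewrite ler_wpM2l//; first by rewrite divr_ge0 ?exprn_ge0// divr_ge0// sqr_ge0.
    by rewrite ler_sqr ?nnegrE ?sqr_ge0 ?mulr_ge0 ?exprn_ge0.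
  rewrite /e n4 le_eqVlt; apply/orP; left; apply/eqP.
  by field; rewrite gt_eqF.
have tB : trivIset setT B.
  apply/trivIsetP => i j _ _; wlog ij : i j / (i < j)%N.
    move=> H ij; have [lij|lij] := ltnP i j; first exact: H.
    by rewrite setIC; apply: H; rewrite ?[j == i]eq_sym// ltn_neqAle lij eq_sym ij.
  move=> _; apply/seteqP; split => // x [[/= + _] [/= + _]].
  rewrite !in_itv/= => /andP[_ xi] /andP[xj _].
  have : 2 ^+ i.+1 <= 2 ^+ j :> R by rewrite ler_weXn2l// ler1n.
  by move=> ij2; have := lt_le_trans xi (le_trans ij2 xj); rewrite ltxx.
have [mF F2] := s2.
have ep : 0 < e by rewrite divr_gt0// exprn_gt0.
have mFF : measurable_fun setT (fun x => (F x ^+ 2)%:E).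
  apply/measurable_EFinP; apply: measurable_funX; apply: measurable_funD;
    apply: measurable_funM => //; [exact: measurable_far1|exact: measurable_far2].
have F20 x : (0 <= (F x ^+ 2)%:E)%E by rewrite lee_fin sqr_ge0.
have edl : 0 < e * dl by exact: mulr_gt0.
have FB n : ((e * dl)%:E <= \int[mu]_(x in B n) (F x ^+ 2)%:E)%E.
  apply: (@le_trans _ _ (\int[mu]_(x in B n) (e / 4 ^+ n)%:E)%E).
    rewrite integral_cst// Bm -EFinM lee_fin le_eqVlt; apply/orP; left.
    by apply/eqP; field; rewrite expf_neq0.
  apply: ge0_le_integral => //.
  - by move=> x _; rewrite lee_fin divr_ge0 ?exprn_ge0// ltW.
  - exact: measurable_funTS.
  - by move=> x Bx; rewrite lee_fin Fb.
have mU : measurable (\bigcup_n B n) by exact: bigcupT_measurable.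
have sumB N : ((N%:R * (e * dl))%:E <= \int[mu]_x (F x ^+ 2)%:E)%E.
  apply: (@le_trans _ _ (\int[mu]_(x in \bigcup_n B n) (F x ^+ 2)%:E)%E); last first.
    by apply: ge0_subset_integral.
  rewrite ge0_integral_bigcup//; last exact: measurable_funTS.
  apply: (@le_trans _ _ (\sum_(0 <= n < N) \int[mu]_(x in B n) (F x ^+ 2)%:E)%E).
    elim: N => [|N IH]; first by rewrite mul0r big_geq.
    rewrite big_nat_recr//= -natr1 mulrDl mul1r EFinD.
    by apply: leeD.
  by apply: nneseries_lim_ge => n _ _; apply: integral_ge0.
have rF : (\int[mu]_x (F x ^+ 2)%:E)%E \is a fin_num.
  by rewrite ge0_fin_numE//; apply: integral_ge0.
have I0 : (0 <= \int[mu]_x (F x ^+ 2)%:E)%E by apply: integral_ge0.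
have := archi_boundP (divr_ge0 (fine_ge0 I0) (ltW edl)).
set N := Num.bound _; rewrite ltr_pdivrMr// ltNge => /negP nle; exfalso; apply: nle.
by rewrite -lee_fin fineK//; exact: sumB.
Qed.

Lemma far_sqint_coef (a1 a2 : R) :
  sqint mu (fun x => a1 * far1 x + a2 * far2 x) -> a1 = 0 /\ a2 = 0.
Proof.
move=> s2; split; first exact: far_sqint_coef1 s2.
apply: (@far_sqint_coef1 a2 a1); apply: sqint_eq (sqint_swap2 s2).
by apply: aeW => x /=; rewrite /far1 /far2 norm2_swap2 addrC.
Qed.

End CoordinateSwap.

(** * Complex-valued functions *)

Section ComplexFunctions.
Variable R : realType.
Notation mu := (leb2 R).
Implicit Types (x y : plane R) (F G : plane R -> R[i]) (z w a : R[i]).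

Lemma ReD z w : complex.Re (z + w) = complex.Re z + complex.Re w.
Proof. by case: z => ? ?; case: w => ? ?. Qed.

Lemma ImD z w : complex.Im (z + w) = complex.Im z + complex.Im w.
Proof. by case: z => ? ?; case: w => ? ?. Qed.

Lemma ReN z : complex.Re (- z) = - complex.Re z.
Proof. by case: z. Qed.

Lemma ImN z : complex.Im (- z) = - complex.Im z.
Proof. by case: z. Qed.

Lemma ReM z w : complex.Re (z * w) =
  complex.Re z * complex.Re w - complex.Im z * complex.Im w.
Proof. by case: z => ? ?; case: w => ? ?. Qed.

Lemma ImM z w : complex.Im (z * w) =
  complex.Re z * complex.Im w + complex.Im z * complex.Re w.
Proof. by case: z => ? ?; case: w => ? ?. Qed.

Lemma ReJ z : complex.Re (z^*) = complex.Re z.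
Proof. by case: z. Qed.

Lemma ImJ z : complex.Im (z^*) = - complex.Im z.
Proof. by case: z. Qed.

Lemma ReC (r : R) : complex.Re r%:C = r. Proof. by []. Qed.

Lemma ImC (r : R) : complex.Im r%:C = 0. Proof. by []. Qed.

Lemma complex_ext z w : complex.Re z = complex.Re w ->
  complex.Im z = complex.Im w -> z = w.
Proof. by case: z => ? ?; case: w => ? ? /= -> ->. Qed.

Lemma conj_realM (r : R) z : (r%:C * z)^* = r%:C * z^*.
Proof. by apply: complex_ext; rewrite !(ReJ, ImJ, ReM, ImM, ReC, ImC); ring. Qed.

Definition reimE := (ReD, ImD, ReN, ImN, ReM, ImM, ReJ, ImJ, ReC, ImC).

Definition cintegrable F := aeint mu (fun x => complex.Re (F x)) /\
  aeint mu (fun x => complex.Im (F x)).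

Definition csqint F := sqint mu (fun x => complex.Re (F x)) /\
  sqint mu (fun x => complex.Im (F x)).

Definition cdensity F := density (fun x => complex.Re (F x)) /\
  density (fun x => complex.Im (F x)).

Lemma cint_ae_eq F G : {ae mu, forall x, F x = G x} -> cint F = cint G.
Proof.
move=> FG; rewrite /cint; congr (_ +i* _); apply: ae_Rintegral_eq;
  by apply: filterS FG => x ->.
Qed.

Lemma cint_ext F G : (forall x, F x = G x) -> cint F = cint G.
Proof. by move=> FG; apply: cint_ae_eq; exact: aeW. Qed.

Lemma cintegrable_eq F G : {ae mu, forall x, F x = G x} ->
  cintegrable F -> cintegrable G.
Proof.
move=> FG [r i]; split; [apply: aeint_eq r|apply: aeint_eq i];
  by apply: filterS FG => x ->.
Qed.

Lemma csqint_eq F G : {ae mu, forall x, F x = G x} -> csqint F -> csqint G.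
Proof.
move=> FG [r i]; split; [apply: sqint_eq r|apply: sqint_eq i];
  by apply: filterS FG => x ->.
Qed.

Lemma cintegrableD F G : cintegrable F -> cintegrable G ->
  cintegrable (fun x => F x + G x).
Proof.
move=> [Fr Fi] [Gr Gi]; split; under eq_fun do rewrite !reimE; exact: aeintD.
Qed.

Lemma cintegrableZ a F : cintegrable F -> cintegrable (fun x => a * F x).
Proof.
move=> [Fr Fi]; split; under eq_fun do rewrite !reimE;
  by [apply: aeintB; exact: aeintZ|apply: aeintD; exact: aeintZ].
Qed.

Lemma cintegrable_conj F : cintegrable F -> cintegrable (fun x => (F x)^*).
Proof.
move=> [r i]; split; first by under eq_fun do rewrite ReJ.
by under eq_fun do rewrite ImJ; exact: aeintN.
Qed.

Lemma csqintD F G : csqint F -> csqint G -> csqint (fun x => F x + G x).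
Proof.
move=> [Fr Fi] [Gr Gi]; split; under eq_fun do rewrite !reimE; exact: sqintD.
Qed.

Lemma csqintZ a F : csqint F -> csqint (fun x => a * F x).
Proof.
move=> [Fr Fi]; split; under eq_fun do rewrite !reimE;
  by [apply: sqintB; exact: sqintZ|apply: sqintD; exact: sqintZ].
Qed.

Lemma csqintN F : csqint F -> csqint (fun x => - F x).
Proof.
move=> [Fr Fi]; split; under eq_fun do rewrite !reimE; exact: sqintN.
Qed.

Lemma csqintB F G : csqint F -> csqint G -> csqint (fun x => F x - G x).
Proof. by move=> Fs Gs; apply: csqintD => //; exact: csqintN. Qed.

Lemma csqint0 : csqint (fun=> 0).
Proof. by split; exact: sqint0. Qed.

Lemma csqintM F G : csqint F -> csqint G -> cintegrable (fun x => (F x)^* * G x).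
Proof.
move=> [Fr Fi] [Gr Gi]; split; under eq_fun do rewrite !reimE.
  by apply: aeintB; apply: sqintM => //; exact: sqintN.
by apply: aeintD; apply: sqintM => //; exact: sqintN.
Qed.

Lemma cintD F G : cintegrable F -> cintegrable G ->
  cint (fun x => F x + G x) = cint F + cint G.
Proof.
move=> [Fr Fi] [Gr Gi]; apply: complex_ext; rewrite !reimE /= -RintD//;
  by apply: eq_Rintegral => x _; rewrite reimE.
Qed.

Lemma cint_eq0 F : (forall x, F x = 0) -> cint F = 0.
Proof.
move=> F0; rewrite (cint_ext F0).
by apply: complex_ext => /=; rewrite /Rintegral integral0_eq.
Qed.

Lemma cint_scale a F : cintegrable F -> cint (fun x => a * F x) = a * cint F.
Proof.
move=> [Fr Fi]; apply: complex_ext; rewrite !reimE /= -!Rint_cstM//.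
  rewrite -RintB//; [|exact: aeintZ|exact: aeintZ].
  by apply: eq_Rintegral => x _; rewrite reimE.
rewrite -RintD//; [|exact: aeintZ|exact: aeintZ].
by apply: eq_Rintegral => x _; rewrite reimE.
Qed.

Lemma cint_conj F : cintegrable F -> cint (fun x => (F x)^*) = (cint F)^*.
Proof.
move=> [Fr Fi]; apply: complex_ext; rewrite !reimE /=.
  by apply: eq_Rintegral => x _; rewrite reimE.
rewrite -RintN//; by apply: eq_Rintegral => x _; rewrite reimE.
Qed.

Lemma cdensity_integrable F : cdensity F -> cintegrable F.
Proof. by move=> [r i]; split; exact: density_aeint. Qed.

Lemma Re_realM (r : plane R -> R) F : (fun x => complex.Re ((r x)%:C * F x)) =
  (fun x => r x * complex.Re (F x)).
Proof. by apply/funext => x; rewrite !reimE mul0r subr0. Qed.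

Lemma Im_realM (r : plane R -> R) F : (fun x => complex.Im ((r x)%:C * F x)) =
  (fun x => r x * complex.Im (F x)).
Proof. by apply/funext => x; rewrite !reimE mul0r addr0. Qed.

Lemma cdensity_moment1 F : cdensity F -> cintegrable (fun x => (x.1)%:C * F x).
Proof.
move=> [r i]; rewrite /cintegrable.
by rewrite (Re_realM (fun x => x.1)) (Im_realM (fun x => x.1)); split; exact: density_moment1.
Qed.

Lemma cdensity_moment2 F : cdensity F -> cintegrable (fun x => (x.2)%:C * F x).
Proof.
move=> [r i]; rewrite /cintegrable.
by rewrite (Re_realM (fun x => x.2)) (Im_realM (fun x => x.2)); split; exact: density_moment2.
Qed.

Lemma cdensity_moment_sq F : cdensity F ->
  cintegrable (fun x => (norm2 x ^+ 2)%:C * F x).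
Proof.
move=> [r i]; rewrite /cintegrable.
by rewrite (Re_realM (fun x => norm2 x ^+ 2)) (Im_realM (fun x => norm2 x ^+ 2)); split; exact: density_moment_sq.
Qed.

Definition cpot kap F x := cint (fun y => (kap (x, y))%:C * F y).

Lemma Re_cpot kap F x : complex.Re (cpot kap F x) =
  pot kap (fun y => complex.Re (F y)) x.
Proof. by rewrite /cpot /= (Re_realM (fun y => kap (x, y))). Qed.

Lemma Im_cpot kap F x : complex.Im (cpot kap F x) =
  pot kap (fun y => complex.Im (F y)) x.
Proof. by rewrite /cpot /= (Im_realM (fun y => kap (x, y))). Qed.

(** Taken with s = 1 for the logarithm and s = -1 for its gradient, which is
    odd. *)
Lemma cpot_form kap (s : R) F G : near_lin kap ->
  (forall x y, kap (y, x) = s * kap (x, y)) -> cdensity F -> cdensity G ->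
  cintegrable (fun x => (F x)^* * cpot kap G x) /\
  cint (fun x => (F x)^* * cpot kap G x) =
    s%:C * (cint (fun x => (G x)^* * cpot kap F x))^*.
Proof.
move=> kP ks [F1 F2] [G1 G2].
have form g h : density h -> density g ->
    Rintegral mu setT (fun x => g x * pot kap h x) =
    s * Rintegral mu setT (fun x => h x * pot kap g x).
  move=> dh dg; have [_ ->] := potential_form kP dh dg.
  have [ih _] := potential_form kP dg dh.
  rewrite -Rint_cstM//; apply: ae_Rintegral_eq.
  apply: filterS (potential_aeint kP dg) => y iy.
  have -> : Rintegral mu setT (fun x => kap (x, y) * g x) = s * pot kap g y.
    rewrite /pot -Rint_cstM//; apply: eq_Rintegral => x _.
    by rewrite (ks y x) mulrA.
  by ring.
have int g h : density h -> density g -> aeint mu (fun x => g x * pot kap h x).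
  by move=> dh dg; have [] := potential_form kP dh dg.
have key A B : cdensity A -> cdensity B ->
    cintegrable (fun x => (A x)^* * cpot kap B x) /\
    cint (fun x => (A x)^* * cpot kap B x) =
    (Rintegral mu setT (fun x => complex.Re (A x) * pot kap (fun y => complex.Re (B y)) x) +
     Rintegral mu setT (fun x => complex.Im (A x) * pot kap (fun y => complex.Im (B y)) x)) +i*
    (Rintegral mu setT (fun x => complex.Re (A x) * pot kap (fun y => complex.Im (B y)) x) -
     Rintegral mu setT (fun x => complex.Im (A x) * pot kap (fun y => complex.Re (B y)) x)).
  move=> [A1 A2] [B1 B2].
  have reE : (fun x => complex.Re ((A x)^* * cpot kap B x)) = (fun x =>
      complex.Re (A x) * pot kap (fun y => complex.Re (B y)) x +
      complex.Im (A x) * pot kap (fun y => complex.Im (B y)) x).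
    by apply/funext => x; rewrite ReM ReJ ImJ Re_cpot Im_cpot mulNr opprK.
  have imE : (fun x => complex.Im ((A x)^* * cpot kap B x)) = (fun x =>
      complex.Re (A x) * pot kap (fun y => complex.Im (B y)) x -
      complex.Im (A x) * pot kap (fun y => complex.Re (B y)) x).
    by apply/funext => x; rewrite ImM ReJ ImJ Re_cpot Im_cpot mulNr.
  split.
    rewrite /cintegrable reE imE; split.
      by apply: aeintD; exact: int.
    by apply: aeintB; exact: int.
  rewrite /cint reE imE RintD ?RintB//; exact: int.
have [iFG ->] := key F G (conj F1 F2) (conj G1 G2).
have [_ ->] := key G F (conj G1 G2) (conj F1 F2).
split => //; apply: complex_ext; rewrite !reimE /= mul0r.
  rewrite subr0 mulrDr; congr (_ + _); exact: form.
rewrite addr0 opprB mulrBr; congr (_ - _); exact: form.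
Qed.

End ComplexFunctions.

(** * Spinor fields and orthogonal projections *)

Section Spinors.
Variable R : realType.
Notation mu := (leb2 R).
Implicit Types (x y : plane R) (u w z : plane R -> 'cV[R[i]]_2).

Lemma sum_ord2 (M : nmodType) (F : 'I_2 -> M) : \sum_(i < 2) F i = F 0 + F 1.
Proof.
by rewrite !big_ord_recl big_ord0 addr0; congr (_ + F _); apply/val_inj.
Qed.

Lemma ord2_ind (P : 'I_2 -> Prop) : P 0 -> P 1 -> forall i, P i.
Proof.
move=> P0 P1 [[|[|n]] ni] //.
  by rewrite (_ : Ordinal ni = 0)//; apply/val_inj.
by rewrite (_ : Ordinal ni = 1)//; apply/val_inj.
Qed.

Lemma cV2_ext (p q : 'cV[R[i]]_2) : p 0 0 = q 0 0 -> p 1 0 = q 1 0 -> p = q.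
Proof.
by move=> e0 e1; apply/matrixP; elim/ord2_ind => j; rewrite ord1.
Qed.

Lemma is_L2P u : is_L2 u <->
  csqint (fun x => u x 0 0) /\ csqint (fun x => u x 1 0).
Proof.
have sqE x : \sum_(i < 2) (complex.Re (u x i 0) ^+ 2 + complex.Im (u x i 0) ^+ 2) =
    complex.Re (u x 0 0) ^+ 2 + complex.Im (u x 0 0) ^+ 2 +
    (complex.Re (u x 1 0) ^+ 2 + complex.Im (u x 1 0) ^+ 2).
  by rewrite sum_ord2.
rewrite /is_L2; under eq_integral do rewrite sqE.
split=> [[mu_ fin]|[[r0 i0] [r1 i1]]].
  have [m0r m0i] := mu_ 0; have [m1r m1i] := mu_ 1.
  by split; split; split => //; apply: le_lt_trans fin;
    apply: ae_ge0_integral_le => [x|x|];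
    rewrite ?lee_fin ?addr_ge0 ?sqr_ge0//; apply: aeW => x; rewrite lee_fin;
    have := sqr_ge0 (complex.Re (u x 0 0)); have := sqr_ge0 (complex.Im (u x 0 0));
    have := sqr_ge0 (complex.Re (u x 1 0)); have := sqr_ge0 (complex.Im (u x 1 0)); lra.
split.
  by elim/ord2_ind; split; [case: r0|case: i0|case: r1|case: i1].
have [_] := aeintD (aeintD (sqint_sq r0) (sqint_sq i0)) (aeintD (sqint_sq r1) (sqint_sq i1)).
apply: le_lt_trans; rewrite le_eqVlt; apply/orP; left; apply/eqP.
apply: eq_integral => x _; rewrite ger0_norm//.
by rewrite !addr_ge0 ?sqr_ge0.
Qed.

Lemma is_L2_eq u w : aeq u w -> is_L2 u -> is_L2 w.
Proof.
move=> uw /is_L2P[u0 u1]; apply/is_L2P.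
by split; [apply: csqint_eq u0|apply: csqint_eq u1]; apply: filterS uw => x ->.
Qed.

Lemma is_L2B u w : is_L2 u -> is_L2 w -> is_L2 (fun x => u x - w x).
Proof.
move=> /is_L2P[u0 u1] /is_L2P[w0 w1]; apply/is_L2P.
by split; under eq_fun do rewrite !mxE; exact: csqintB.
Qed.

Lemma is_L2D u w : is_L2 u -> is_L2 w -> is_L2 (fun x => u x + w x).
Proof.
move=> /is_L2P[u0 u1] /is_L2P[w0 w1]; apply/is_L2P.
by split; under eq_fun do rewrite !mxE; exact: csqintD.
Qed.

Lemma is_L2Z (k : R[i]) u : is_L2 u -> is_L2 (fun x => k *: u x).
Proof.
move=> /is_L2P[u0 u1]; apply/is_L2P.
by split; under eq_fun do rewrite !mxE; exact: csqintZ.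
Qed.

Lemma aeq_sym u w : aeq u w -> aeq w u.
Proof. by apply: filterS => x ->. Qed.

Lemma aeq_trans u w z : aeq u w -> aeq w z -> aeq u z.
Proof. by apply: filterS2 => x -> ->. Qed.

Lemma aeq_refl u : aeq u u. Proof. exact: aeW. Qed.

Lemma inner_ae u u' w w' : aeq u u' -> aeq w w' -> inner u w = inner u' w'.
Proof.
move=> uu ww; apply: cint_ae_eq; apply: filterS2 uu ww => x -> ->.
by [].
Qed.

Lemma innerE u w : is_L2 u -> is_L2 w -> inner u w =
  cint (fun x => (u x 0 0)^* * w x 0 0) + cint (fun x => (u x 1 0)^* * w x 1 0).
Proof.
move=> /is_L2P[u0 u1] /is_L2P[w0 w1].
rewrite -cintD; [|exact: csqintM|exact: csqintM].
by apply: cint_ext => x; rewrite sum_ord2.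
Qed.

Lemma inner_conj u w : is_L2 u -> is_L2 w -> inner w u = (inner u w)^*.
Proof.
move=> Lu Lw; rewrite !innerE//.
have /is_L2P[u0 u1] := Lu; have /is_L2P[w0 w1] := Lw.
rewrite rmorphD /= -!cint_conj; [|exact: csqintM|exact: csqintM].
by congr (_ + _); apply: cint_ext => x; rewrite rmorphM /= conjCK mulrC.
Qed.

Lemma innerDr u w z : is_L2 u -> is_L2 w -> is_L2 z ->
  inner u (fun x => w x + z x) = inner u w + inner u z.
Proof.
move=> Lu Lw Lz; have Lwz := is_L2D Lw Lz; rewrite !innerE//.
have /is_L2P[u0 u1] := Lu; have /is_L2P[w0 w1] := Lw; have /is_L2P[z0 z1] := Lz.
rewrite addrACA; congr (_ + _); rewrite -cintD; try exact: csqintM;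
  by apply: cint_ext => x; rewrite mxE mulrDr.
Qed.

Lemma innerZr (k : R[i]) u w : is_L2 u -> is_L2 w ->
  inner u (fun x => k *: w x) = k * inner u w.
Proof.
move=> Lu Lw; have Lkw := is_L2Z k Lw; rewrite !innerE//.
have /is_L2P[u0 u1] := Lu; have /is_L2P[w0 w1] := Lw.
rewrite mulrDr; congr (_ + _); rewrite -cint_scale; try exact: csqintM;
  by apply: cint_ext => x; rewrite mxE mulrCA.
Qed.

Lemma innerBr u w z : is_L2 u -> is_L2 w -> is_L2 z ->
  inner u (fun x => w x - z x) = inner u w - inner u z.
Proof.
move=> Lu Lw Lz; rewrite -mulN1r -innerZr// -innerDr//; last exact: is_L2Z.
by apply: inner_ae; [exact: aeq_refl|apply: aeW => x; rewrite scaleN1r].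
Qed.

Lemma innerBl u w z : is_L2 u -> is_L2 w -> is_L2 z ->
  inner (fun x => w x - z x) u = inner w u - inner z u.
Proof.
move=> Lu Lw Lz; rewrite inner_conj//; last exact: is_L2B.
rewrite innerBr// rmorphB /= -!inner_conj//.
Qed.

Lemma innerZl (k : R[i]) u w : is_L2 u -> is_L2 w ->
  inner (fun x => k *: w x) u = k^* * inner w u.
Proof.
move=> Lu Lw; rewrite inner_conj//; last exact: is_L2Z.
by rewrite innerZr// rmorphM /= -inner_conj.
Qed.

Lemma inner_eq0 u : is_L2 u -> inner u u = 0 -> aeq u (fun=> 0).
Proof.
move=> Lu; rewrite innerE//; have /is_L2P[[r0 i0] [r1 i1]] := Lu.
have re (F : plane R -> R[i]) : complex.Re (cint (fun x => (F x)^* * F x)) =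
    Rintegral mu setT (fun x => complex.Re (F x) ^+ 2 + complex.Im (F x) ^+ 2).
  by apply: eq_Rintegral => x _; rewrite ReM ReJ ImJ; ring.
move=> /(congr1 (@complex.Re R)); rewrite ReD !re /=.
have i0' := aeintD (sqint_sq r0) (sqint_sq i0).
have i1' := aeintD (sqint_sq r1) (sqint_sq i1).
rewrite -RintD// => /(ge0_Rint_eq0 (aeintD i0' i1')) H.
have {}H := H (fun x => _); apply: filterS (H _) => [x|x]; last first.
  by rewrite !addr_ge0 ?sqr_ge0.
move=> s0; have p1 := sqr_ge0 (complex.Re (u x 0 0)).
have p2 := sqr_ge0 (complex.Im (u x 0 0)).
have p3 := sqr_ge0 (complex.Re (u x 1 0)).
have p4 := sqr_ge0 (complex.Im (u x 1 0)).
have sq0 (r : R) : r ^+ 2 = 0 -> r = 0 by move=> /eqP; rewrite sqrf_eq0 => /eqP.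
apply: cV2_ext; rewrite mxE; apply: complex_ext; apply: sq0 => /=; lra.
Qed.

Lemma inner_self_neq0 u : is_L2 u -> ~ aeq u (fun=> 0) -> inner u u != 0.
Proof. by move=> Lu u0; apply/eqP => /(inner_eq0 Lu). Qed.

(** Both u and S u belong to M up to null sets, so u - S u, being orthogonal
    to M, is orthogonal to itself. *)
Lemma orth_proj_fix (S : (plane R -> 'cV[R[i]]_2) -> (plane R -> 'cV[R[i]]_2))
    (M : set (plane R -> 'cV[R[i]]_2)) u w :
  is_orth_proj S M -> (forall z, M z -> is_L2 z) ->
  is_L2 u -> M w -> aeq u w -> aeq (S u) u.
Proof.
move=> SM ML Lu Mw uw; have [MS orth] := SM u Lu.
have LS := ML _ MS; have Lw := ML _ Mw.
have LD := is_L2B Lu LS.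
have e : inner (fun x => u x - S u x) (fun x => u x - S u x) = 0.
  rewrite innerBl// (orth (S u) MS) subr0 -(orth w Mw).
  by apply: inner_ae => //; exact: aeq_refl.
apply: filterS (inner_eq0 LD e) => x /eqP; rewrite subr_eq0 => /eqP <-.
by [].
Qed.

(** The kernel of an orthogonal projection is the orthogonal complement of its
    range. *)
Lemma orth_proj_eq0 (S : (plane R -> 'cV[R[i]]_2) -> (plane R -> 'cV[R[i]]_2))
    (M : set (plane R -> 'cV[R[i]]_2)) u :
  is_orth_proj S M -> (forall z, M z -> is_L2 z) -> is_L2 u ->
  aeq (S u) (fun=> 0) <-> forall z, M z -> inner z u = 0.
Proof.
move=> SM ML Lu; have [MS orth] := SM u Lu; have LS := ML _ MS.
split=> [S0 z Mz|z0].
  rewrite -(orth z Mz); apply: inner_ae; first exact: aeq_refl.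
  by apply: filterS S0 => x ->; rewrite subr0.
apply: inner_eq0 => //.
by have := orth _ MS; rewrite innerBr// (z0 _ MS) sub0r => /eqP; rewrite oppr_eq0 => /eqP.
Qed.

End Spinors.

(** * The Dirac operator applied to the logarithmic potential *)

Section DiracKernel.
Variable R : realType.
Notation mu := (leb2 R).
Implicit Types (x y : plane R) (f g : plane R -> 'cV[R[i]]_2).

Definition entry f (i : 'I_2) : plane R -> R[i] := fun x => f x i 0.

(** The class of v^* phi for square integrable phi ([spinor_density_adj]). *)
Definition spinor_density f := forall i, cdensity (entry f i).

Definition log_coef : R[i] := (- (2 * pi)^-1)%:C.

Lemma pi2_neq0 : 2 * pi != 0 :> R.
Proof. by rewrite mulf_neq0// gt_eqF// pi_gt0. Qed.

Lemma log_coef_neq0 : log_coef != 0.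
Proof.
apply/eqP => /(congr1 (@complex.Re R)) /= /eqP.
by rewrite oppr_eq0 invr_eq0 (negbTE pi2_neq0).
Qed.

Lemma G0_entry f x i : G0 f x i 0 = log_coef * cpot (@log_ker R) (entry f i) x.
Proof.
rewrite /G0 !mxE; congr (_ * _); apply: cint_ext => y.
by rewrite mxE.
Qed.

Let derive_scale (k : R) (F : R -> R) (t c : R) : is_derive t 1 F c ->
  derive1 (fun t => k * F t) t = k * c.
Proof.
move=> dF.
have dm (u : R) : is_derive u 1 (fun u : R => k * u) k.
  by apply: is_derive_eq; rewrite /GRing.scale /=; ring.
by rewrite derive1E; case: (is_derive1_comp (dm (F t)) dF) => _.
Qed.

Lemma partial1_G0 f i : cdensity (entry f i) -> {ae mu, forall x,
  partial1 (fun y => G0 f y i 0) x = log_coef * cpot (@riesz1 R) (entry f i) x}.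
Proof.
move=> [dr di]; apply: filterS2 (log_pot_partial1 dr) (log_pot_partial1 di) => x xr xi.
have reE : (fun t : R => complex.Re (G0 f (t, x.2) i 0)) = (fun t : R =>
    - (2 * pi)^-1 * pot (@log_ker R) (fun y => complex.Re (entry f i y)) (t, x.2)).
  by apply/funext => t; rewrite G0_entry ReM Re_cpot /= mul0r subr0.
have imE : (fun t : R => complex.Im (G0 f (t, x.2) i 0)) = (fun t : R =>
    - (2 * pi)^-1 * pot (@log_ker R) (fun y => complex.Im (entry f i y)) (t, x.2)).
  by apply/funext => t; rewrite G0_entry ImM Im_cpot /= mul0r addr0.
rewrite /partial1 reE imE (derive_scale _ xr) (derive_scale _ xi).
apply: complex_ext; first by rewrite ReM Re_cpot /= mul0r subr0.
by rewrite ImM Im_cpot /= mul0r addr0.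
Qed.

Lemma partial2_G0 f i : cdensity (entry f i) -> {ae mu, forall x,
  partial2 (fun y => G0 f y i 0) x = log_coef * cpot (@riesz2 R) (entry f i) x}.
Proof.
move=> [dr di]; apply: filterS2 (log_pot_partial2 dr) (log_pot_partial2 di) => x xr xi.
have reE : (fun t : R => complex.Re (G0 f (x.1, t) i 0)) = (fun t : R =>
    - (2 * pi)^-1 * pot (@log_ker R) (fun y => complex.Re (entry f i y)) (x.1, t)).
  by apply/funext => t; rewrite G0_entry ReM Re_cpot /= mul0r subr0.
have imE : (fun t : R => complex.Im (G0 f (x.1, t) i 0)) = (fun t : R =>
    - (2 * pi)^-1 * pot (@log_ker R) (fun y => complex.Im (entry f i y)) (x.1, t)).
  by apply/funext => t; rewrite G0_entry ImM Im_cpot /= mul0r addr0.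
rewrite /partial2 reE imE (derive_scale _ xr) (derive_scale _ xi).
apply: complex_ext; first by rewrite ReM Re_cpot /= mul0r subr0.
by rewrite ImM Im_cpot /= mul0r addr0.
Qed.

Lemma mulmx_cV2 (A : 'M[R[i]]_2) (u : 'cV[R[i]]_2) i :
  (A *m u) i 0 = A i 0 * u 0 0 + A i 1 * u 1 0.
Proof. by rewrite mxE sum_ord2. Qed.

Lemma I1_entry0 f x : mulop (fun=> I1 R) f x 0 0 = f x 0 0.
Proof. by rewrite /mulop mulmx_cV2 !mxE /= mul1r mul0r addr0. Qed.

Lemma I1_entry1 f x : mulop (fun=> I1 R) f x 1 0 = 0.
Proof. by rewrite /mulop mulmx_cV2 !mxE /= !mul0r addr0. Qed.

Lemma dirac0_entry0 f x : Defs.dirac0 f x 0 0 = - 'i%C *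
  (partial1 (entry f 1) x - 'i%C * partial2 (entry f 1) x).
Proof.
rewrite /Defs.dirac0; set p := \col_j partial1 _ x; set q := \col_j partial2 _ x.
have -> : partial1 (entry f 1) x = p 1 0 by rewrite mxE.
have -> : partial2 (entry f 1) x = q 1 0 by rewrite mxE.
move: p q => p q; rewrite mxE [X in _ * X]mxE !mulmx_cV2; congr (_ * _).
by rewrite ![alpha1 R _ _]mxE ![alpha2 R _ _]mxE /= !mul0r !add0r mul1r mulNr.
Qed.

Lemma dirac0_entry1 f x : Defs.dirac0 f x 1 0 = - 'i%C *
  (partial1 (entry f 0) x + 'i%C * partial2 (entry f 0) x).
Proof.
rewrite /Defs.dirac0; set p := \col_j partial1 _ x; set q := \col_j partial2 _ x.
have -> : partial1 (entry f 0) x = p 0 0 by rewrite mxE.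
have -> : partial2 (entry f 0) x = q 0 0 by rewrite mxE.
move: p q => p q; rewrite mxE [X in _ * X]mxE !mulmx_cV2; congr (_ * _).
by rewrite ![alpha1 R _ _]mxE ![alpha2 R _ _]mxE /= !mul0r !addr0 mul1r.
Qed.

Lemma calG0_entry0 (m : R) f : spinor_density f -> {ae mu, forall x,
  calG0 m f x 0 0 = log_coef *
    (- 'i%C * (cpot (@riesz1 R) (entry f 1) x - 'i%C * cpot (@riesz2 R) (entry f 1) x)
     + (2 * m)%:C * cpot (@log_ker R) (entry f 0) x)}.
Proof.
move=> df; apply: filterS2 (partial1_G0 (df 1)) (partial2_G0 (df 1)) => x p1 p2.
rewrite /calG0 mxE dirac0_entry0 [X in _ + X]mxE G0_entry.
rewrite -[entry (G0 f) 1]/(fun y => G0 f y 1 0) p1 p2.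
have -> : entry (mulop (fun=> I1 R) f) 0 = entry f 0.
  by apply/funext => y; exact: I1_entry0.
by ring.
Qed.

Lemma calG0_entry1 (m : R) f : spinor_density f -> {ae mu, forall x,
  calG0 m f x 1 0 = log_coef *
    (- 'i%C * (cpot (@riesz1 R) (entry f 0) x + 'i%C * cpot (@riesz2 R) (entry f 0) x))}.
Proof.
move=> df; apply: filterS2 (partial1_G0 (df 0)) (partial2_G0 (df 0)) => x p1 p2.
rewrite /calG0 mxE dirac0_entry1 [X in _ + X]mxE G0_entry.
rewrite -[entry (G0 f) 0]/(fun y => G0 f y 0 0) p1 p2.
have -> : cpot (@log_ker R) (entry (mulop (fun=> I1 R) f) 1) x = 0.
  by apply: cint_eq0 => y; rewrite /entry I1_entry1 mulr0.
by ring.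
Qed.

Lemma riesz1_anti x y : riesz1 (y, x) = -1 * riesz1 (x, y).
Proof. by rewrite /riesz1 /= [dist2 y x]dist2C; ring. Qed.

Lemma riesz2_anti x y : riesz2 (y, x) = -1 * riesz2 (x, y).
Proof. by rewrite /riesz2 /= [dist2 y x]dist2C; ring. Qed.

Lemma log_sym x y : log_ker (y, x) = 1 * log_ker (x, y).
Proof. by rewrite /log_ker /= dist2C mul1r. Qed.

(** The matrix coefficients of the gradient kernels are antihermitian and
    these kernels are odd; the logarithm is real and even. *)
Lemma calG0_form (m : R) f g : spinor_density f -> spinor_density g ->
  let form u w := cint (fun x => (u x 0 0)^* * calG0 m w x 0 0)
                  + cint (fun x => (u x 1 0)^* * calG0 m w x 1 0) in
  form f g = (form g f)^*.
Proof.
move=> df dg form.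
pose c := - 'i%C * log_coef; pose d := (2 * m)%:C * log_coef.
have cJ : c^* = - c.
  by rewrite /c /log_coef; apply: complex_ext => /=; ring.
have dJ : d^* = d by rewrite /d /log_coef; apply: complex_ext => /=; ring.
have E0 w : spinor_density w -> {ae mu, forall x, calG0 m w x 0 0 =
    c * cpot (@riesz1 R) (entry w 1) x
    + (- (c * 'i%C)) * cpot (@riesz2 R) (entry w 1) x
    + d * cpot (@log_ker R) (entry w 0) x}.
  by move=> dw; apply: filterS (calG0_entry0 m dw) => x ->; rewrite /c /d; ring.
have E1 w : spinor_density w -> {ae mu, forall x, calG0 m w x 1 0 =
    c * cpot (@riesz1 R) (entry w 0) x
    + (c * 'i%C) * cpot (@riesz2 R) (entry w 0) x}.
  by move=> dw; apply: filterS (calG0_entry1 m dw) => x ->; rewrite /c; ring.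
clearbody c d.
pose A kap (u w : plane R -> R[i]) := cint (fun x => (u x)^* * cpot kap w x).
have alg0 (i p q r : R[i]) : c * p + - (c * i) * q + d * r = c * (p - i * q) + d * r.
  by ring.
have alg1 (i p q : R[i]) : c * p + (c * i) * q = c * (p + i * q) by ring.
have formE u w : spinor_density u -> spinor_density w -> form u w =
    c * (A (@riesz1 R) (entry u 0) (entry w 1) - 'i%C * A (@riesz2 R) (entry u 0) (entry w 1))
    + d * A (@log_ker R) (entry u 0) (entry w 0)
    + c * (A (@riesz1 R) (entry u 1) (entry w 0) + 'i%C * A (@riesz2 R) (entry u 1) (entry w 0)).
  move=> du dw.
  have [r1a _] := cpot_form (near_lin_riesz1 R) riesz1_anti (du 0) (dw 1).
  have [r2a _] := cpot_form (near_lin_riesz2 R) riesz2_anti (du 0) (dw 1).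
  have [l0 _] := cpot_form (near_lin_log R) log_sym (du 0) (dw 0).
  have [r1b _] := cpot_form (near_lin_riesz1 R) riesz1_anti (du 1) (dw 0).
  have [r2b _] := cpot_form (near_lin_riesz2 R) riesz2_anti (du 1) (dw 0).
  rewrite /form; congr (_ + _).
    rewrite (@cint_ae_eq _ _ (fun x =>
      (c * ((entry u 0 x)^* * cpot (@riesz1 R) (entry w 1) x)
       + (- (c * 'i%C)) * ((entry u 0 x)^* * cpot (@riesz2 R) (entry w 1) x))
      + d * ((entry u 0 x)^* * cpot (@log_ker R) (entry w 0) x))); last first.
      by apply: filterS (E0 w dw) => x ->; rewrite /entry; ring.
    have t1 := cintegrableZ c r1a; have t2 := cintegrableZ (- (c * 'i%C)) r2a.
    rewrite (cintD (cintegrableD t1 t2) (cintegrableZ d l0)) (cintD t1 t2).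
    rewrite (cint_scale c r1a) (cint_scale _ r2a) (cint_scale d l0).
    exact: alg0.
  rewrite (@cint_ae_eq _ _ (fun x =>
      c * ((entry u 1 x)^* * cpot (@riesz1 R) (entry w 0) x)
       + (c * 'i%C) * ((entry u 1 x)^* * cpot (@riesz2 R) (entry w 0) x))); last first.
    by apply: filterS (E1 w dw) => x ->; rewrite /entry; ring.
  have t1 := cintegrableZ c r1b; have t2 := cintegrableZ (c * 'i%C) r2b.
  rewrite (cintD t1 t2) (cint_scale c r1b) (cint_scale _ r2b).
  exact: alg1.
rewrite (formE f g df dg) (formE g f dg df) {formE}; clearbody form.
have iJ : ('i%C : R[i])^* = - 'i%C by apply: complex_ext => /=; ring.
have sym kap (s : R) u w (kP : near_lin kap)
    (ks : forall x y, kap (y, x) = s * kap (x, y)) (du : cdensity u) (dw : cdensity w) :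
    A kap u w = s%:C * (A kap w u)^*.
  by have [_] := cpot_form kP ks du dw.
clearbody A.
rewrite (sym _ _ _ _ (near_lin_riesz1 R) riesz1_anti (df 0) (dg 1)).
rewrite (sym _ _ _ _ (near_lin_riesz2 R) riesz2_anti (df 0) (dg 1)).
rewrite (sym _ _ _ _ (near_lin_riesz1 R) riesz1_anti (df 1) (dg 0)).
rewrite (sym _ _ _ _ (near_lin_riesz2 R) riesz2_anti (df 1) (dg 0)).
rewrite (sym _ _ _ _ (near_lin_log R) log_sym (df 0) (dg 0)).
have -> : (-1 : R)%:C = -1 by apply: complex_ext => /=; rewrite ?oppr0.
have -> : (1 : R)%:C = 1 by [].
move: (A (@riesz1 R) (entry g 0) (entry f 1)) (A (@riesz2 R) (entry g 0) (entry f 1)).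
move: (A (@riesz1 R) (entry g 1) (entry f 0)) (A (@riesz2 R) (entry g 1) (entry f 0)).
move: (A (@log_ker R) (entry g 0) (entry f 0)) => a1 a2 a3 a4 a5.
have conjE (p q : R[i]) : ((p + q)^* = p^* + q^*) * ((p * q)^* = p^* * q^*).
  by split; [exact: rmorphD | exact: rmorphM].
have conjN (p : R[i]) : (- p)^* = - p^* by exact: rmorphN.
rewrite !(conjE, conjN) cJ dJ iJ; ring.
Qed.

End DiracKernel.

(** * Far-field amplitudes *)

Section Amplitudes.
Variable R : realType.
Notation mu := (leb2 R).
Implicit Types (x y : plane R) (F : plane R -> R[i]) (f g : plane R -> 'cV[R[i]]_2).

Lemma criesz1_remainder F : cdensity F ->
  csqint (fun x => cpot (@riesz1 R) F x - (far1 x)%:C * cint F).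
Proof.
move=> [dr di]; split.
  apply: sqint_eq (riesz1_pot_remainder dr); apply: aeW => x.
  by rewrite ReD ReN Re_cpot ReM /= mul0r subr0.
apply: sqint_eq (riesz1_pot_remainder di); apply: aeW => x.
by rewrite ImD ImN Im_cpot ImM /= mul0r addr0.
Qed.

Lemma criesz2_remainder F : cdensity F ->
  csqint (fun x => cpot (@riesz2 R) F x - (far2 x)%:C * cint F).
Proof.
move=> [dr di]; split.
  apply: sqint_eq (riesz2_pot_remainder dr); apply: aeW => x.
  by rewrite ReD ReN Re_cpot ReM /= mul0r subr0.
apply: sqint_eq (riesz2_pot_remainder di); apply: aeW => x.
by rewrite ImD ImN Im_cpot ImM /= mul0r addr0.
Qed.

Definition moment1 F : R[i] := cint (fun y => (y.1)%:C * F y).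
Definition moment2 F : R[i] := cint (fun y => (y.2)%:C * F y).
Definition moment_sq F : R[i] := cint (fun y => (norm2 y ^+ 2)%:C * F y).

Lemma clog_remainder F : cdensity F -> cint F = 0 ->
  csqint (fun x => cpot (@log_ker R) F x +
    ((far1 x)%:C * moment1 F + (far2 x)%:C * moment2 F)).
Proof.
move=> [dr di] F0.
have Fr : Rintegral mu setT (fun x => complex.Re (F x)) = 0.
  by have := congr1 (@complex.Re R) F0.
have Fi : Rintegral mu setT (fun x => complex.Im (F x)) = 0.
  by have := congr1 (@complex.Im R) F0.
split.
  apply: sqint_eq (log_pot_remainder dr Fr); apply: aeW => x.
  rewrite !ReD Re_cpot !ReM /= !mul0r !subr0.
  by rewrite (Re_realM (fun x => x.1)) (Re_realM (fun x => x.2)).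
apply: sqint_eq (log_pot_remainder di Fi); apply: aeW => x.
rewrite !ImD Im_cpot !ImM /= !mul0r !addr0.
by rewrite (Im_realM (fun x => x.1)) (Im_realM (fun x => x.2)).
Qed.

Lemma far_csqint_coef (a1 a2 : R[i]) :
  csqint (fun x => (far1 x)%:C * a1 + (far2 x)%:C * a2) <-> a1 = 0 /\ a2 = 0.
Proof.
split=> [[r i]|[-> ->]]; last first.
  apply: csqint_eq (csqint0 R); apply: aeW => x; by rewrite !mulr0 addr0.
have [r1 r2] : complex.Re a1 = 0 /\ complex.Re a2 = 0.
  apply: far_sqint_coef; apply: sqint_eq r; apply: aeW => x.
  by rewrite ReD !ReM /= !mul0r !subr0 ![_ * complex.Re _]mulrC.
have [i1 i2] : complex.Im a1 = 0 /\ complex.Im a2 = 0.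
  apply: far_sqint_coef; apply: sqint_eq i; apply: aeW => x.
  by rewrite ImD !ImM /= !mul0r !addr0 ![_ * complex.Im _]mulrC.
by split; apply: complex_ext.
Qed.

(** The amplitudes are the coefficients of x_1 / |x|^2 and x_2 / |x|^2 in the
    first component of calG0 f at infinity, up to a common factor. *)
Definition amplitude1 (m : R) f : R[i] :=
  'i%C * cint (entry f 1) + (2 * m)%:C * moment1 (entry f 0).

Definition amplitude2 (m : R) f : R[i] :=
  cint (entry f 1) + (2 * m)%:C * moment2 (entry f 0).

Lemma mulii : 'i%C * 'i%C = -1 :> R[i].
Proof. by apply: complex_ext => /=; ring. Qed.

(** The second component is always square integrable, because its leading term
    carries the integral of the first entry of f. *)
Lemma calG0_L2 (m : R) f : spinor_density f -> cint (entry f 0) = 0 ->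
  is_L2 (calG0 m f) <-> amplitude1 m f = 0 /\ amplitude2 m f = 0.
Proof.
move=> df f0.
have e1 : csqint (fun x => calG0 m f x 1 0).
  have := csqintZ (log_coef R) (csqintZ (- 'i%C)
    (csqintD (criesz1_remainder (df 0)) (csqintZ 'i%C (criesz2_remainder (df 0))))).
  apply: csqint_eq; apply: filterS (calG0_entry1 m df) => x ->.
  by rewrite f0 !mulr0 !subr0.
have e0 : csqint (fun x => calG0 m f x 0 0 +
    log_coef R * ((far1 x)%:C * amplitude1 m f + (far2 x)%:C * amplitude2 m f)).
  have := csqintZ (log_coef R) (csqintD (csqintZ (- 'i%C)
    (csqintB (criesz1_remainder (df 1)) (csqintZ 'i%C (criesz2_remainder (df 1)))))
    (csqintZ (2 * m)%:C (clog_remainder (df 0) f0))).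
  apply: csqint_eq; apply: filterS (calG0_entry0 m df) => x ->.
  rewrite /amplitude1 /amplitude2 -mulrDr; congr (_ * _).
  set K1 := cpot _ _ x; set K2 := cpot _ _ x; set L := cpot _ _ x.
  set F1 := cint _; set A1 := moment1 _; set A2 := moment2 _.
  set i := 'i%C; set q1 := (far1 x)%:C; set q2 := (far2 x)%:C.
  have ii : i * i = -1 by exact: mulii.
  transitivity (- i * (K1 - i * K2) + (2 * m)%:C * L
    + (q1 * (i * F1 + (2 * m)%:C * A1) + q2 * ((- (i * i)) * F1 + (2 * m)%:C * A2))).
    by ring.
  by rewrite ii opprK mul1r.
have lc : csqint (fun x => calG0 m f x 0 0) <->
    csqint (fun x => (far1 x)%:C * amplitude1 m f + (far2 x)%:C * amplitude2 m f).
  split=> H.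
    have := csqintZ (log_coef R)^-1 (csqintB e0 H).
    apply: csqint_eq; apply: aeW => x.
    by rewrite [X in X - _]addrC addrK mulKf// log_coef_neq0.
  have := csqintB e0 (csqintZ (log_coef R) H).
  by apply: csqint_eq; apply: aeW => x; rewrite addrK.
rewrite -far_csqint_coef -lc; split; first by move=> /is_L2P[].
by move=> H; apply/is_L2P.
Qed.

Lemma G1_entry f x i : cdensity (entry f i) -> G1 f x i 0 =
  (norm2 x ^+ 2)%:C * cint (entry f i)
  - ((2 * x.1)%:C * moment1 (entry f i) + (2 * x.2)%:C * moment2 (entry f i))
  + moment_sq (entry f i).
Proof.
move=> df; have i0 := cdensity_integrable df.
have i1 := cdensity_moment1 df; have i2 := cdensity_moment2 df.
have i3 := cdensity_moment_sq df.
rewrite /G1 mxE /moment1 /moment2 /moment_sq.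
transitivity (cint (fun y => (norm2 x ^+ 2)%:C * entry f i y +
    (- (2 * x.1)%:C * ((y.1)%:C * entry f i y) +
     (- (2 * x.2)%:C * ((y.2)%:C * entry f i y) + (norm2 y ^+ 2)%:C * entry f i y)))).
  apply: cint_ext => y; rewrite mxE -/(entry f i y) dist2_sqrE.
  by apply: complex_ext; rewrite !(ReD, ReM, ImD, ImM, ReN, ImN) /=; ring.
have i2' := cintegrableZ (- (2 * x.2)%:C) i2.
have i1' := cintegrableZ (- (2 * x.1)%:C) i1.
have i0' := cintegrableZ (norm2 x ^+ 2)%:C i0.
rewrite cintD//; last by do 2 (apply: cintegrableD => //).
rewrite cintD//; last by apply: cintegrableD.
rewrite cintD// !cint_scale//; ring.
Qed.

Let derive_quad (a b c s t : R) :
  derive1 (fun t : R => (t ^+ 2 + s) * a - t * b + c) t = 2 * t * a - b.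
Proof.
have dq : is_derive t 1 (fun t : R => (t ^+ 2 + s) * a - t * b + c) (2 * t * a - b).
  by apply: is_derive_eq; rewrite /GRing.scale /=; ring.
by rewrite derive1E; case: dq => _.
Qed.

Let quad (k a1 a2 s : R[i]) x :=
  (norm2 x ^+ 2)%:C * k - ((2 * x.1)%:C * a1 + (2 * x.2)%:C * a2) + s.

Let partial1_quad k a1 a2 s x :
  partial1 (quad k a1 a2 s) x = (2 * x.1)%:C * k - (2 : R)%:C * a1.
Proof.
rewrite /partial1.
have -> : (fun t : R => complex.Re (quad k a1 a2 s (t, x.2))) = fun t : R =>
    (t ^+ 2 + x.2 ^+ 2) * complex.Re k - t * (2 * complex.Re a1)
    + (complex.Re s - 2 * x.2 * complex.Re a2).
  apply/funext => t; rewrite /quad !(ReD, ReN, ReM, ReC, ImC) sqr_norm2 /=; ring.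
have -> : (fun t : R => complex.Im (quad k a1 a2 s (t, x.2))) = fun t : R =>
    (t ^+ 2 + x.2 ^+ 2) * complex.Im k - t * (2 * complex.Im a1)
    + (complex.Im s - 2 * x.2 * complex.Im a2).
  apply/funext => t; rewrite /quad !(ImD, ImN, ImM, ReC, ImC) sqr_norm2 /=; ring.
rewrite !derive_quad.
case: k => k1 k2; case: a1 => b1 b2.
by apply: complex_ext => /=; ring.
Qed.

Let partial2_quad k a1 a2 s x :
  partial2 (quad k a1 a2 s) x = (2 * x.2)%:C * k - (2 : R)%:C * a2.
Proof.
rewrite /partial2.
have -> : (fun t : R => complex.Re (quad k a1 a2 s (x.1, t))) = fun t : R =>
    (t ^+ 2 + x.1 ^+ 2) * complex.Re k - t * (2 * complex.Re a2)
    + (complex.Re s - 2 * x.1 * complex.Re a1).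
  apply/funext => t; rewrite /quad !(ReD, ReN, ReM, ReC, ImC) sqr_norm2 /=; ring.
have -> : (fun t : R => complex.Im (quad k a1 a2 s (x.1, t))) = fun t : R =>
    (t ^+ 2 + x.1 ^+ 2) * complex.Im k - t * (2 * complex.Im a2)
    + (complex.Im s - 2 * x.1 * complex.Im a1).
  apply/funext => t; rewrite /quad !(ImD, ImN, ImM, ReC, ImC) sqr_norm2 /=; ring.
rewrite !derive_quad.
case: k => k1 k2; case: a2 => b1 b2.
by apply: complex_ext => /=; ring.
Qed.

Let entry_G1 f i : cdensity (entry f i) -> entry (G1 f) i =
  quad (cint (entry f i)) (moment1 (entry f i)) (moment2 (entry f i)) (moment_sq (entry f i)).
Proof. by move=> df; apply/funext => x; rewrite {1}/entry G1_entry. Qed.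

Let M11_entry0 f x : M11 f x 0 0 = cint (entry f 0).
Proof.
rewrite /M11 mxE; apply: cint_ext => y; rewrite mulmx_cV2.
by rewrite ![mat2 _ _ _ _ _ _]mxE /= mul1r mul0r addr0.
Qed.

Let M11_entry1 f x : M11 f x 1 0 = 0.
Proof.
rewrite /M11 mxE; apply: cint_eq0 => y; rewrite mulmx_cV2.
by rewrite ![mat2 _ _ _ _ _ _]mxE /= !mul0r addr0.
Qed.

Let M22_entry0 f x : M22 f x 0 0 = 0.
Proof.
rewrite /M22 mxE; apply: cint_eq0 => y; rewrite mulmx_cV2.
by rewrite ![mat2 _ _ _ _ _ _]mxE /= !mul0r addr0.
Qed.

Let M22_entry1 f x : M22 f x 1 0 = cint (entry f 1).
Proof.
rewrite /M22 mxE; apply: cint_ext => y; rewrite mulmx_cV2.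
by rewrite ![mat2 _ _ _ _ _ _]mxE /= mul1r mul0r add0r.
Qed.

Let calG1E0 (m : R) f x : calG1 m f x 0 0 = Defs.dirac0 (G1 f) x 0 0
  + (2 * m)%:C * entry (G1 (mulop (fun=> I1 R) f)) 0 x
  - (2 / m)%:C * cint (entry f 0).
Proof.
have := M11_entry0 f x; have := M22_entry0 f x; rewrite /calG1 /entry.
move: (cint _) (Defs.dirac0 _ x) (G1 _ x) (M11 f x) (M22 f x) => c p q r s es er.
by rewrite !mxE es er; ring.
Qed.

Let calG1E1 (m : R) f x : calG1 m f x 1 0 = Defs.dirac0 (G1 f) x 1 0
  + (2 * m)%:C * entry (G1 (mulop (fun=> I1 R) f)) 1 x
  - (2 / m)%:C * cint (entry f 1).
Proof.
have := M11_entry1 f x; have := M22_entry1 f x; rewrite /calG1 /entry.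
move: (cint _) (Defs.dirac0 _ x) (G1 _ x) (M11 f x) (M22 f x) => c p q r s es er.
by rewrite !mxE es er; ring.
Qed.

(** The quadratic term and the rank one corrections in the integral of the
    first entry vanish; the rest is affine in x. *)
Lemma calG1_entry0 (m : R) f : spinor_density f -> cint (entry f 0) = 0 ->
  forall x, calG1 m f x 0 0 =
    (2 * m)%:C * moment_sq (entry f 0)
    + 2 * 'i%C * (moment1 (entry f 1) - 'i%C * moment2 (entry f 1))
    - 2 * ((x.1)%:C * amplitude1 m f + (x.2)%:C * amplitude2 m f).
Proof.
move=> df f0 x; rewrite calG1E0 dirac0_entry0 (entry_G1 (df 1)) partial1_quad partial2_quad.
rewrite f0.
have I0 : entry (mulop (fun=> I1 R) f) 0 = entry f 0.
  by apply/funext => y; exact: I1_entry0.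
have -> : entry (G1 (mulop (fun=> I1 R) f)) 0 x = (norm2 x ^+ 2)%:C * 0
    - ((2 * x.1)%:C * moment1 (entry f 0) + (2 * x.2)%:C * moment2 (entry f 0))
    + moment_sq (entry f 0).
  by rewrite {1}/entry G1_entry I0 ?f0//; exact: (df 0).
rewrite /amplitude1 /amplitude2.
move: (cint _) (moment1 _) (moment2 _) (moment1 _) (moment2 _) (moment_sq _) => F a1 a2 b1 b2 s.
have ii := mulii; move: ('i%C : R[i]) ii => i ii.
have c2 (r : R) : (2 * r)%:C = 2 * r%:C by rewrite rmorphM /= rmorph_nat.
rewrite !c2 (_ : (2 : R)%:C = 2) ?rmorph_nat//.
move: (x.1)%:C (x.2)%:C m%:C (2 / m)%:C => X Y M K.
apply/eqP; rewrite -subr_eq0; apply/eqP.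
transitivity (2 * Y * F * (i * i + 1)); first by ring.
by rewrite ii addNr mulr0.
Qed.

Lemma calG1_entry1 (m : R) f : m != 0 -> spinor_density f -> cint (entry f 0) = 0 ->
  forall x, calG1 m f x 1 0 = (m^-1)%:C * ('i%C * amplitude1 m f - amplitude2 m f).
Proof.
move=> m0 df f0 x; rewrite calG1E1 dirac0_entry1 (entry_G1 (df 0)) partial1_quad partial2_quad.
rewrite f0.
have -> : entry (G1 (mulop (fun=> I1 R) f)) 1 x = 0.
  rewrite /entry /G1 mxE; apply: cint_eq0 => y.
  by rewrite mxE I1_entry1 mulr0.
rewrite /amplitude1 /amplitude2.
move: (cint _) (moment1 _) (moment2 _) => F a1 a2.
have ii := mulii; move: ('i%C : R[i]) ii => i ii.
have c2 (r : R) : (2 * r)%:C = 2 * r%:C by rewrite rmorphM /= rmorph_nat.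
rewrite !c2 (_ : (2 : R)%:C = 2) ?rmorph_nat//.
have : m%:C * (m^-1)%:C = 1 by rewrite -rmorphM /= mulfV.
move: (x.1)%:C (x.2)%:C m%:C (m^-1)%:C => X Y M K MK.
apply/eqP; rewrite -subr_eq0; apply/eqP.
transitivity (2 * i * a1 * (1 - M * K) + 2 * a2 * (i * i + M * K) - K * F * (i * i + 1));
  first by ring.
by rewrite ii MK subrr addNr !mulr0 addr0 subrr.
Qed.

(** The constant in [calG1_entry0] pairs to zero with g, leaving the first
    moments of g. *)
Lemma calG1_form (m : R) f g : m != 0 -> spinor_density f -> spinor_density g ->
  cint (entry f 0) = 0 -> cint (entry g 0) = 0 ->
  cint (fun x => (g x 0 0)^* * calG1 m f x 0 0)
  + cint (fun x => (g x 1 0)^* * calG1 m f x 1 0) =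
  - (m^-1)%:C * ((amplitude1 m g)^* * amplitude1 m f + (amplitude2 m g)^* * amplitude2 m f).
Proof.
move=> m0 df dg f0 g0.
have i0 := cintegrable_conj (cdensity_integrable (dg 0)).
have i1 := cintegrable_conj (cdensity_integrable (dg 1)).
have m1 := cintegrable_conj (cdensity_moment1 (dg 0)).
have m2 := cintegrable_conj (cdensity_moment2 (dg 0)).
set a1 := amplitude1 m f; set a2 := amplitude2 m f.
pose c := (2 * m)%:C * moment_sq (entry f 0)
    + 2 * 'i%C * (moment1 (entry f 1) - 'i%C * moment2 (entry f 1)).
have -> : cint (fun x => (g x 0 0)^* * calG1 m f x 0 0) =
    - 2 * a1 * (moment1 (entry g 0))^* + - 2 * a2 * (moment2 (entry g 0))^*.
  rewrite (@cint_ext _ _ (fun x => c * (entry g 0 x)^* +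
    (- 2 * a1 * ((x.1)%:C * entry g 0 x)^* + - 2 * a2 * ((x.2)%:C * entry g 0 x)^*))).
    rewrite cintD; [|exact: cintegrableZ|by apply: cintegrableD; exact: cintegrableZ].
    rewrite cintD; [|exact: cintegrableZ|exact: cintegrableZ].
    rewrite !cint_scale// cint_conj; last exact: cdensity_integrable.
    rewrite cint_conj; last exact: cdensity_moment1.
    rewrite cint_conj; last exact: cdensity_moment2.
    by rewrite g0 rmorph0 mulr0 add0r.
  move=> x; rewrite (calG1_entry0 _ df f0) -/c -/a1 -/a2 !conj_realM /entry.
  move: (_^*) (x.1)%:C (x.2)%:C c a1 a2 => *; ring.
have -> : cint (fun x => (g x 1 0)^* * calG1 m f x 1 0) =
    (m^-1)%:C * ('i%C * a1 - a2) * (cint (entry g 1))^*.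
  rewrite (@cint_ext _ _ (fun x => (m^-1)%:C * ('i%C * a1 - a2) * (entry g 1 x)^*)).
    by rewrite cint_scale// cint_conj//; exact: cdensity_integrable.
  by move=> x; rewrite (calG1_entry1 m0 df f0) mulrC.
have -> : (amplitude1 m g)^* = - 'i%C * (cint (entry g 1))^* + (2 * m)%:C * (moment1 (entry g 0))^*.
  rewrite -conj_realM /amplitude1.
  by apply: complex_ext; rewrite !(ReD, ReN, ReJ, ImD, ImN, ImJ, ReM, ImM) /=; ring.
have -> : (amplitude2 m g)^* = (cint (entry g 1))^* + (2 * m)%:C * (moment2 (entry g 0))^*.
  rewrite -conj_realM /amplitude2.
  by apply: complex_ext; rewrite !(ReD, ReN, ReJ, ImD, ImN, ImJ, ReM, ImM) /=; ring.
move: (cint (entry g 1))^* (moment1 (entry g 0))^* (moment2 (entry g 0))^* => F b1 b2.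
rewrite rmorphM /= rmorph_nat.
have : m%:C * (m^-1)%:C = 1 by rewrite -rmorphM /= mulfV.
move: a1 a2 ('i%C : R[i]) m%:C (m^-1)%:C => a1 a2 i M K MK.
apply/eqP; rewrite -subr_eq0; apply/eqP.
transitivity (2 * (b1 * a1 + b2 * a2) * (M * K - 1)); first by ring.
by rewrite MK subrr mulr0.
Qed.

End Amplitudes.

(** * Coefficients of faster than cubic decay *)

Section RapidDecay.
Variable R : realType.
Notation mu := (leb2 R).
Implicit Types (x y : plane R) (a h : plane R -> R) (F G : plane R -> R[i]).

Definition rapid a := aemeas mu a /\
  exists2 s : R, 3 < s & exists C : R, forall x, `|a x| <= C * japanese x `^ (- s).

Lemma densityD h g : density h -> density g -> density (fun x => h x + g x).
Proof.
move=> [h1 h2] [g1 g2]; split.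
  by apply: sqint_eq (sqintD h1 g1); apply: aeW => x; rewrite mulrDr.
by apply: aeint_eq (aeintD h2 g2); apply: aeW => x; rewrite mulrDr.
Qed.

Lemma densityN h : density h -> density (fun x => - h x).
Proof.
move=> [h1 h2]; split.
  by apply: sqint_eq (sqintN h1); apply: aeW => x; rewrite mulrN.
by apply: aeint_eq (aeintN h2); apply: aeW => x; rewrite mulrN.
Qed.

Lemma rapidN a : rapid a -> rapid (fun x => - a x).
Proof.
move=> [ma [s s3 [C aC]]]; split; first exact: aemeasN.
by exists s => //; exists C => x; rewrite normrN.
Qed.

Let lin_weight_le x : 1 + norm2 x <= 2 * japanese x.
Proof. by have := japanese_ge1 x; have := norm2_le_japanese x; lra. Qed.

Let coef_ge0 a s C : (forall x, `|a x| <= C * japanese x `^ (- s)) -> 0 <= C.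
Proof.
move=> aC; have := le_trans (normr_ge0 _) (aC (0, 0)).
by rewrite pmulr_lge0// powR_gt0// japanese_gt0.
Qed.

Let weighted_le a s C x : `|a x| <= C * japanese x `^ (- s) ->
  0 <= C -> (1 + norm2 x) * `|a x| <= 2 * C * japanese x `^ (1 - s).
Proof.
move=> aC C0; have J0 := japanese_gt0 x.
have -> : 2 * C * japanese x `^ (1 - s) = 2 * japanese x * (C * japanese x `^ (- s)).
  rewrite powRD; last by apply/implyP => _; rewrite gt_eqF.
  by rewrite powRr1 ?ltW//; ring.
by apply: ler_pM => //; exact: lin_weight_ge0.
Qed.

(** The power of the bracket that remains is below -2, hence below the power
    -3/2 of [decay]. *)
Lemma rapid_weight a : rapid a ->
  exists K, forall x, `|a x| * (1 + norm2 x) <= K * decay x.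
Proof.
move=> [_ [s s3 [C aC]]]; have C0 := coef_ge0 aC; exists (2 * C) => x.
rewrite mulrC; apply: le_trans (weighted_le (aC x) C0) _.
rewrite ler_wpM2l ?mulr_ge0// -ler_sqr ?nnegrE ?powR_ge0 ?decay_ge0// sqr_decay.
rewrite -powR_mulrn ?powR_ge0// -powRrM; apply: ler_powR; first exact: japanese_ge1.
by rewrite -/(2%:R); lra.
Qed.

(** The product (1 + |y|) a is bounded, which gives the first condition. The
    product (1 + |y|)^2 a is square integrable, since it decays faster than
    the inverse bracket; pairing it with h gives the second one. *)
Lemma rapid_density a h : rapid a -> sqint mu h -> density (fun x => a x * h x).
Proof.
move=> [ma [s s3 [C aC]]] hs; have C0 := coef_ge0 aC.
have mh : aemeas mu h by case: hs.
have mw : aemeas mu (fun x => 1 + norm2 x).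
  by apply: measurable_aemeas; exact: measurable_lin_weight.
split.
  apply: (sqint_dom _ (sqintZ (2 * C) hs)); first by do 2 apply: aemeasM => //.
  apply: aeW => x /=; rewrite mulrA normrM [leRHS]normrM ler_wpM2r//.
  rewrite normrM [`|1 + _|]ger0_norm ?lin_weight_ge0// [`|2 * C|]ger0_norm ?mulr_ge0//.
  apply: le_trans (weighted_le (aC x) C0) _; rewrite ler_piMr ?mulr_ge0//.
  by rewrite -[leRHS](powRr0 (japanese x)); apply: ler_powR; [exact: japanese_ge1|lra].
have gs : sqint mu (fun x => (1 + norm2 x) ^+ 2 * a x).
  have Js : sqint mu (fun x => japanese x `^ (2 - s)).
    split.
      apply: measurable_aemeas; apply: (measurableT_comp (measurable_powR _)).
      exact: measurable_japanese.
    have := @japanese_powR_int R (2 * s - 4); rewrite (_ : 2 < _); last by lra.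
    move=> /(_ isT); apply: le_lt_trans; rewrite le_eqVlt; apply/orP; left; apply/eqP.
    apply: eq_integral => x _; rewrite -powR_mulrn ?powR_ge0// -powRrM.
    by congr ((_ `^ _)%:E); rewrite -/(2%:R); lra.
  apply: (sqint_dom _ (sqintZ (4 * C) Js)).
    by apply: aemeasM => //; under eq_fun do rewrite expr2; apply: aemeasM.
  apply: aeW => x /=; rewrite normrM [leRHS]normrM.
  rewrite ger0_norm ?sqr_ge0// [`|4 * C|]ger0_norm ?mulr_ge0// [`|_ `^ _|]ger0_norm ?powR_ge0//.
  have -> : 4 * C * japanese x `^ (2 - s) =
      2 * japanese x * (2 * C * japanese x `^ (1 - s)).
    rewrite (_ : 2 - s = 1 + (1 - s)); last by ring.
    rewrite powRD; last by apply/implyP => _; rewrite gt_eqF// japanese_gt0.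
    by rewrite powRr1 ?ltW ?japanese_gt0//; ring.
  rewrite expr2 -[leLHS]mulrA; apply: ler_pM; [exact: lin_weight_ge0| |exact: lin_weight_le|exact: weighted_le].
  by rewrite mulr_ge0// lin_weight_ge0.
by apply: aeint_eq (sqintM gs hs); apply: aeW => x; rewrite mulrA.
Qed.

Definition crapid F := rapid (fun x => complex.Re (F x)) /\ rapid (fun x => complex.Im (F x)).

Lemma crapid_conj F : crapid F -> crapid (fun x => (F x)^*).
Proof.
move=> [r i]; split; first by under eq_fun do rewrite ReJ.
by under eq_fun do rewrite ImJ; exact: rapidN.
Qed.

Lemma crapid_density F G : crapid F -> csqint G -> cdensity (fun x => F x * G x).
Proof.
move=> [Fr Fi] [Gr Gi]; split.
  under eq_fun do rewrite ReM; apply: densityD; last apply: densityN; exact: rapid_density.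
by under eq_fun do rewrite ImM; apply: densityD; exact: rapid_density.
Qed.

Lemma cdensityD F G : cdensity F -> cdensity G -> cdensity (fun x => F x + G x).
Proof.
move=> [Fr Fi] [Gr Gi]; split.
  by under eq_fun do rewrite ReD; exact: densityD.
by under eq_fun do rewrite ImD; exact: densityD.
Qed.

Lemma crapid_cpot kap F G : near_lin kap -> crapid F -> cdensity G ->
  csqint (fun x => F x * cpot kap G x).
Proof.
move=> kP [Fr Fi] [Gr Gi].
have key a h : rapid a -> density h -> sqint mu (fun x => a x * pot kap h x).
  by move=> ra dh; have [K aK] := rapid_weight ra; apply: potential_weighted_sqint aK dh => //; case: ra.
split.
  by under eq_fun do rewrite ReM Re_cpot Im_cpot; apply: sqintB; exact: key.
by under eq_fun do rewrite ImM Re_cpot Im_cpot; apply: sqintD; exact: key.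
Qed.

Lemma rapid_lin (r : plane R -> R) a : measurable_fun setT r ->
  (forall x, `|r x| <= 1 + norm2 x) -> rapid a -> sqint mu (fun x => r x * a x).
Proof.
move=> mr rle ra; have [K aK] := rapid_weight ra.
apply: (sqint_dom _ (sqintZ K (@sqint_decay R))).
  by apply: aemeasM; [exact: measurable_aemeas|case: ra].
apply: aeW => x /=; rewrite normrM mulrC.
apply: le_trans (ler_norm _); apply: le_trans (aK x).
exact: ler_wpM2l.
Qed.

Lemma crapid_lin (r : plane R -> R) F : measurable_fun setT r ->
  (forall x, `|r x| <= 1 + norm2 x) -> crapid F -> csqint (fun x => (r x)%:C * F x).
Proof.
move=> mr rle [Fr Fi]; rewrite /csqint (Re_realM r) (Im_realM r).
by split; exact: rapid_lin.
Qed.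

Lemma crapid_csqint F : crapid F -> csqint F.
Proof.
move=> rF; have H := @crapid_lin (fun=> 1) F (measurable_cst _) _ rF.
apply: csqint_eq (H _); first by apply: aeW => x; rewrite mul1r.
by move=> x; rewrite normr1 lin_weight_ge1.
Qed.

End RapidDecay.

(** * Composition with the coefficient matrix *)

Section FactorizedOperator.
Variable R : realType.
Notation mu := (leb2 R).
Implicit Types (x y : plane R) (f g w : plane R -> 'cV[R[i]]_2) (v U : plane R -> 'M[R[i]]_2).

Definition mx_rapid v := forall i j, crapid (fun x => v x i j).

Lemma adjfieldE v x i j : adjfield v x i j = (v x j i)^*.
Proof. by rewrite /adjfield !mxE. Qed.

Lemma spinor_density_adj v f : mx_rapid v -> is_L2 f ->
  spinor_density (mulop (adjfield v) f).
Proof.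
move=> rv /is_L2P[f0 f1] i; rewrite /entry /mulop.
under eq_fun do rewrite mulmx_cV2 !adjfieldE.
by apply: cdensityD; apply: crapid_density => //; apply: crapid_conj; exact: rv.
Qed.

Lemma inner_mulop v f g : inner f (mulop v g) = inner (mulop (adjfield v) f) g.
Proof.
apply: cint_ext => x; rewrite !sum_ord2 /mulop !mulmx_cV2 !adjfieldE.
rewrite !rmorphD !rmorphM /= !conjCK.
by move: (_^*) (_^*) => *; ring.
Qed.

Lemma is_L2_calG0 v (m : R) f : mx_rapid v -> spinor_density f ->
  is_L2 (mulop v (calG0 m f)).
Proof.
move=> rv df.
have key i : csqint (fun x => mulop v (calG0 m f) x i 0).
  have r0 := rv i 0; have r1 := rv i 1.
  have k1 := crapid_cpot (near_lin_riesz1 R) r0 (df 1).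
  have k2 := crapid_cpot (near_lin_riesz2 R) r0 (df 1).
  have k3 := crapid_cpot (near_lin_log R) r0 (df 0).
  have k4 := crapid_cpot (near_lin_riesz1 R) r1 (df 0).
  have k5 := crapid_cpot (near_lin_riesz2 R) r1 (df 0).
  have := csqintZ (log_coef R) (csqintD
    (csqintD (csqintZ (- 'i%C) (csqintB k1 (csqintZ 'i%C k2))) (csqintZ (2 * m)%:C k3))
    (csqintZ (- 'i%C) (csqintD k4 (csqintZ 'i%C k5)))).
  apply: csqint_eq; apply: filterS2 (calG0_entry0 m df) (calG0_entry1 m df) => x e0 e1.
  rewrite /mulop mulmx_cV2 e0 e1.
  move: (cpot _ _ x) (cpot _ _ x) (cpot _ _ x) (cpot _ _ x) (cpot _ _ x) => p1 p2 p3 p4 p5.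
  by move: (log_coef R) (v x i 0) (v x i 1) ('i%C : R[i]) (2 * m)%:C => *; ring.
by apply/is_L2P; split; exact: key.
Qed.

Lemma is_L2_calG1 v (m : R) f : m != 0 -> mx_rapid v -> spinor_density f ->
  cint (entry f 0) = 0 -> is_L2 (mulop v (calG1 m f)).
Proof.
move=> m0 rv df f0.
have key i : csqint (fun x => mulop v (calG1 m f) x i 0).
  have r0 := rv i 0; have r1 := rv i 1.
  have k0 := crapid_csqint r0; have k1 := crapid_csqint r1.
  have kx := @crapid_lin R (fun x => x.1) _ measurable_fst _ r0.
  have ky := @crapid_lin R (fun x => x.2) _ measurable_snd _ r0.
  have {}kx := kx (fun x => le_trans (norm2_coord1 x) (ler_wpDl ler01 (lexx _))).
  have {}ky := ky (fun x => le_trans (norm2_coord2 x) (ler_wpDl ler01 (lexx _))).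
  set c := (2 * m)%:C * moment_sq (entry f 0)
    + 2 * 'i%C * (moment1 (entry f 1) - 'i%C * moment2 (entry f 1)).
  have := csqintD (csqintB (csqintZ c k0)
    (csqintZ 2 (csqintD (csqintZ (amplitude1 m f) kx) (csqintZ (amplitude2 m f) ky))))
    (csqintZ ((m^-1)%:C * ('i%C * amplitude1 m f - amplitude2 m f)) k1).
  apply: csqint_eq; apply: aeW => x.
  rewrite /mulop mulmx_cV2 (calG1_entry0 m df f0) (calG1_entry1 m0 df f0) -/c.
  move: c (amplitude1 m f) (amplitude2 m f) => c0 a1 a2.
  by move: (v x i 0) (v x i 1) (x.1)%:C (x.2)%:C (m^-1)%:C ('i%C : R[i]) => *; ring.
by apply/is_L2P; split; exact: key.
Qed.

Lemma G0_aeq f g : aeq f g -> G0 f = G0 g.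
Proof.
move=> fg; apply/funext => x; rewrite /G0; congr (_ *: _).
by apply/matrixP => i j; rewrite !mxE; apply: cint_ae_eq; apply: filterS fg => y ->.
Qed.

Lemma vint_aeq f g : aeq f g -> vint f = vint g.
Proof.
move=> fg; apply/matrixP => i j; rewrite !mxE.
by apply: cint_ae_eq; apply: filterS fg => y ->.
Qed.

Lemma G1_aeq f g : aeq f g -> G1 f = G1 g.
Proof.
by move=> fg; apply/funext => x; apply: vint_aeq; apply: filterS fg => y ->.
Qed.

Lemma mulop_aeq v f g : aeq f g -> aeq (mulop v f) (mulop v g).
Proof. by apply: filterS => x; rewrite /mulop => ->. Qed.

Lemma calG0_aeq (m : R) f g : aeq f g -> calG0 m f = calG0 m g.
Proof.
move=> fg; rewrite /calG0 (G0_aeq fg).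
by rewrite (G0_aeq (@mulop_aeq (fun=> I1 R) _ _ fg)).
Qed.

Lemma calG1_aeq (m : R) f g : aeq f g -> calG1 m f = calG1 m g.
Proof.
move=> fg; rewrite /calG1 (G1_aeq fg) (G1_aeq (@mulop_aeq (fun=> I1 R) _ _ fg)).
have -> : M11 f = M11 g by rewrite /M11 (vint_aeq (@mulop_aeq (fun=> mat2 1 0 0 0) _ _ fg)).
by have -> : M22 f = M22 g by rewrite /M22 (vint_aeq (@mulop_aeq (fun=> mat2 0 0 0 1) _ _ fg)).
Qed.

Lemma inner_split f g : (forall i, cintegrable (fun x => (f x i 0)^* * g x i 0)) ->
  inner f g = cint (fun x => (f x 0 0)^* * g x 0 0) + cint (fun x => (f x 1 0)^* * g x 1 0).
Proof. by move=> fg; rewrite -cintD//; apply: cint_ext => x; rewrite sum_ord2. Qed.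

End FactorizedOperator.

(** * Symmetry of the pairings *)

Section Symmetry.
Variable R : realType.
Notation mu := (leb2 R).
Implicit Types (x y : plane R) (f g w : plane R -> 'cV[R[i]]_2) (v U B : plane R -> 'M[R[i]]_2)
  (l : plane R -> R).

Lemma calG0_pairing (m : R) f g : spinor_density f -> spinor_density g ->
  forall i, cintegrable (fun x => (f x i 0)^* * calG0 m g x i 0).
Proof.
move=> df dg.
have [r1a _] := cpot_form (near_lin_riesz1 R) (@riesz1_anti R) (df 0) (dg 1).
have [r2a _] := cpot_form (near_lin_riesz2 R) (@riesz2_anti R) (df 0) (dg 1).
have [l0 _] := cpot_form (near_lin_log R) (@log_sym R) (df 0) (dg 0).
have [r1b _] := cpot_form (near_lin_riesz1 R) (@riesz1_anti R) (df 1) (dg 0).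
have [r2b _] := cpot_form (near_lin_riesz2 R) (@riesz2_anti R) (df 1) (dg 0).
elim/ord2_ind.
  have := cintegrableZ (log_coef R) (cintegrableD (cintegrableZ (- 'i%C)
    (cintegrableD r1a (cintegrableZ (- 'i%C) r2a))) (cintegrableZ (2 * m)%:C l0)).
  apply: cintegrable_eq; apply: filterS (calG0_entry0 m dg) => x -> /=; rewrite /entry.
  move: (cpot _ _ x) (cpot _ _ x) (cpot _ _ x) (_^*) (log_coef R) (2 * m)%:C ('i%C : R[i]).
  by move=> *; ring.
have := cintegrableZ (log_coef R) (cintegrableZ (- 'i%C)
    (cintegrableD r1b (cintegrableZ 'i%C r2b))).
apply: cintegrable_eq; apply: filterS (calG0_entry1 m dg) => x -> /=; rewrite /entry.
move: (cpot _ _ x) (cpot _ _ x) (_^*) (log_coef R) ('i%C : R[i]).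
by move=> *; ring.
Qed.

Lemma inner_calG0 (m : R) f g : spinor_density f -> spinor_density g ->
  inner f (calG0 m g) = (inner g (calG0 m f))^*.
Proof.
move=> df dg; rewrite (inner_split (calG0_pairing m df dg)).
by rewrite (inner_split (calG0_pairing m dg df)); exact: (calG0_form m df dg).
Qed.

Lemma inner_calG1 (m : R) f g : m != 0 -> spinor_density f -> spinor_density g ->
  cint (entry f 0) = 0 -> cint (entry g 0) = 0 ->
  inner g (calG1 m f) = - (m^-1)%:C *
    ((amplitude1 m g)^* * amplitude1 m f + (amplitude2 m g)^* * amplitude2 m f).
Proof.
move=> m0 df dg f0 g0; rewrite -(calG1_form m0 df dg f0 g0); apply: inner_split.
have i0 := cintegrable_conj (cdensity_integrable (dg 0)).
have i1 := cintegrable_conj (cdensity_integrable (dg 1)).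
have m1 := cintegrable_conj (cdensity_moment1 (dg 0)).
have m2 := cintegrable_conj (cdensity_moment2 (dg 0)).
elim/ord2_ind; last first.
  have := cintegrableZ ((m^-1)%:C * ('i%C * amplitude1 m f - amplitude2 m f)) i1.
  by apply: cintegrable_eq; apply: aeW => x; rewrite (calG1_entry1 m0 df f0) mulrC.
have := cintegrableD (cintegrableZ ((2 * m)%:C * moment_sq (entry f 0)
    + 2 * 'i%C * (moment1 (entry f 1) - 'i%C * moment2 (entry f 1))) i0)
  (cintegrableZ (-2) (cintegrableD (cintegrableZ (amplitude1 m f) m1)
    (cintegrableZ (amplitude2 m f) m2))).
apply: cintegrable_eq; apply: aeW => x; rewrite (calG1_entry0 m df f0).
rewrite !conj_realM /entry; move: (_^*) (_ + _) (amplitude1 _ _) (amplitude2 _ _) => z c a1 a2.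
by move: (x.1)%:C (x.2)%:C => X Y; ring.
Qed.

Lemma inner_Ufield l1 l2 f g :
  inner f (mulop (Ufield l1 l2) g) = inner (mulop (Ufield l1 l2) f) g.
Proof.
have UE h x : mulop (Ufield l1 l2) h x 0 0 = (sign1 (l1 x))%:C * h x 0 0 /\
    mulop (Ufield l1 l2) h x 1 0 = (sign1 (l2 x))%:C * h x 1 0.
  rewrite /mulop !mulmx_cV2 ![Ufield _ _ _ _ _]mxE /=.
  by rewrite !mul0r addr0 add0r.
apply: cint_ext => x; rewrite !sum_ord2.
have [-> ->] := UE f x; have [-> ->] := UE g x; rewrite !conj_realM.
by move: (_^*) (_^*) => *; ring.
Qed.

Lemma is_L2_Ufield l1 l2 f : lmeasurable l1 -> lmeasurable l2 -> is_L2 f ->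
  is_L2 (mulop (Ufield l1 l2) f).
Proof.
move=> ml1 ml2 /is_L2P[f0 f1].
have key l F : lmeasurable l -> csqint F -> csqint (fun x => (sign1 (l x))%:C * F x).
  move=> [l' ml' ll] [Fr Fi].
  have ms : aemeas mu (fun x => sign1 (l x)).
    exists (fun x => sign1 (l' x)); last by apply: filterS ll => x ->.
    apply: measurable_fun_ifT => //.
    by apply: measurable_fun_ltr.
  have sq h : sqint mu h -> sqint mu (fun x => sign1 (l x) * h x).
    move=> hs; apply: (sqint_dom _ hs); first by apply: aemeasM => //; case: hs.
    by apply: aeW => x; rewrite normrM /sign1; case: ifP; rewrite ?normrN normr1 mul1r.
  rewrite /csqint (Re_realM (fun x => sign1 (l x))) (Im_realM (fun x => sign1 (l x))).
  by split; exact: sq.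
apply/is_L2P; split.
  apply: csqint_eq (key _ _ ml1 f0); apply: aeW => x.
  by rewrite /mulop mulmx_cV2 ![Ufield _ _ _ _ _]mxE /= mul0r addr0.
apply: csqint_eq (key _ _ ml2 f1); apply: aeW => x.
by rewrite /mulop mulmx_cV2 ![Ufield _ _ _ _ _]mxE /= mul0r add0r.
Qed.

Lemma complex_norm_le (z : R[i]) (r : R) : `|z| <= r%:C ->
  `|complex.Re z| <= r /\ `|complex.Im z| <= r.
Proof.
case: z => a b; rewrite normc_def lecR /= => abr.
split; apply: le_trans abr; rewrite -ler_sqr ?nnegrE ?sqrtr_ge0//;
  rewrite sqr_sqrtr ?addr_ge0 ?sqr_ge0// real_normK ?num_real//.
  by rewrite lerDl sqr_ge0.
by rewrite lerDr sqr_ge0.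
Qed.

(** Each row of v is a row of B times the square root of an eigenvalue, which
    gives the measurability. *)
Lemma vfield_rapid l1 l2 B (C eps : R) : lmeasurable l1 -> lmeasurable l2 ->
  (forall i j, clmeasurable (fun x => B x i j)) -> 0 < eps ->
  (forall x i j, `|vfield l1 l2 B x i j| <= (C * japanese x `^ (- 3 - eps))%:C) ->
  mx_rapid (vfield l1 l2 B).
Proof.
move=> ml1 ml2 mB e0 hd i j.
have vE l k : lmeasurable l -> (forall x, vfield l1 l2 B x i j = (Num.sqrt `|l x|)%:C * B x k j) ->
    crapid (fun x => vfield l1 l2 B x i j).
  move=> [l' ml' ll] vE.
  have ms : aemeas mu (fun x => Num.sqrt `|l x|).
    exists (fun x => Num.sqrt `|l' x|); last by apply: filterS ll => x ->.
    apply: (measurableT_comp (@measurable_sqrt R)).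
    exact: (measurableT_comp (@normr_measurable R setT)).
  have [mr mi] := mB k j.
  have bd x := complex_norm_le (hd x i j).
  have sE : - 3 - eps = - (3 + eps) by ring.
  split; split; try (by exists (3 + eps); [lra|exists C => x; rewrite -sE; case: (bd x)]).
    under eq_fun do rewrite vE ReM ReC ImC mul0r subr0; exact: aemeasM.
  under eq_fun do rewrite vE ImM ReC ImC mul0r addr0; exact: aemeasM.
move: i vE {hd} => i; elim/ord2_ind: i => vE.
  apply: (vE l1 0) => // x; rewrite /vfield mxE sum_ord2.
  by rewrite ![mat2 _ _ _ _ _ _]mxE /= mul0r addr0.
apply: (vE l2 1) => // x; rewrite /vfield mxE sum_ord2.
by rewrite ![mat2 _ _ _ _ _ _]mxE /= mul0r add0r.
Qed.

Lemma is_L2_accol v : mx_rapid v -> is_L2 (accol v).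
Proof.
move=> rv; apply/is_L2P.
by split; apply: csqint_eq (crapid_csqint (rv _ 0)); apply: aeW => x; rewrite /accol mxE.
Qed.

Lemma inner_accol v f : inner (accol v) f = cint (entry (mulop (adjfield v) f) 0).
Proof.
apply: cint_ext => x; rewrite sum_ord2 /entry /mulop mulmx_cV2 !adjfieldE.
by rewrite /accol !mxE.
Qed.

End Symmetry.

(** * The operator T *)

Section TopTheory.
Variables (R : realType) (m : R) (l1 l2 : plane R -> R) (v : plane R -> 'M[R[i]]_2).
Hypotheses (ml1 : lmeasurable l1) (ml2 : lmeasurable l2) (rv : mx_rapid v).
Notation T := (Top m (Ufield l1 l2) v).
Implicit Types f g : plane R -> 'cV[R[i]]_2.

Lemma is_L2_Top f : is_L2 f -> is_L2 (T f).
Proof.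
move=> Lf; apply: is_L2D; first exact: is_L2_Ufield.
by apply: is_L2_calG0 => //; exact: spinor_density_adj.
Qed.

Lemma Top_aeq f g : aeq f g -> aeq (T f) (T g).
Proof.
move=> fg; rewrite /Top (calG0_aeq m (mulop_aeq (adjfield v) fg)).
by apply: filterS fg => x; rewrite /mulop => ->.
Qed.

(** The symmetry of T reduces to that of U and of the form of calG0 on fields
    v^* f. *)
Lemma Top_sym f g : is_L2 f -> is_L2 g -> inner f (T g) = (inner g (T f))^*.
Proof.
move=> Lf Lg; have df := spinor_density_adj rv Lf; have dg := spinor_density_adj rv Lg.
have LUf := is_L2_Ufield ml1 ml2 Lf; have LUg := is_L2_Ufield ml1 ml2 Lg.
rewrite innerDr//; last exact: is_L2_calG0.
rewrite [inner g _]innerDr//; last exact: is_L2_calG0.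
rewrite rmorphD /=; congr (_ + _).
  by rewrite -(inner_conj Lg LUf) (inner_Ufield l1 l2 f g).
rewrite (inner_mulop v f) (inner_mulop v g).
exact: (inner_calG0 m df dg).
Qed.

End TopTheory.

(** * The threshold subspaces *)

Section Threshold.
Variables (R : realType) (m : R) (l1 l2 : plane R -> R) (v : plane R -> 'M[R[i]]_2).
Variables P S1 S2 S3 : (plane R -> 'cV[R[i]]_2) -> (plane R -> 'cV[R[i]]_2).
Notation T := (Top m (Ufield l1 l2) v).
Notation ac := (accol v).
Notation M1 := (kernel_on (QTQ T P) (rangeL2 (compl_proj P))).
Notation M2 := (kernel_on (T1op T P S1) (rangeL2 S1)).
Notation M3 := (kernel_on (T2op m v S2) (rangeL2 S2)).
Hypotheses (m0 : m != 0) (ml1 : lmeasurable l1) (ml2 : lmeasurable l2) (rv : mx_rapid v).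
Hypotheses (ac0 : ~ aeq ac (fun=> 0)).
Hypotheses (hP : is_orth_proj P (spanL2 ac)) (hS1 : is_orth_proj S1 M1).
Hypotheses (hS2 : is_orth_proj S2 M2) (hS3 : is_orth_proj S3 M3).
Implicit Types z phi : plane R -> 'cV[R[i]]_2.

Let Lac : is_L2 ac := is_L2_accol rv.

Let kernel_L2 A S z : kernel_on A (rangeL2 S) z -> is_L2 z.
Proof. by move=> [[]]. Qed.

Lemma compl_proj_orth z : rangeL2 (compl_proj P) z -> inner ac z = 0.
Proof.
move=> [Lz [w Lw zw]]; have [_ orth] := hP Lw.
rewrite -(orth ac); first exact: inner_ae (aeq_refl _) zw.
by split => //; exists 1; apply: aeW => x; rewrite scale1r.
Qed.

(** The range of S consists of fields that agree almost everywhere with an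
    element of the subspace; on them S is the identity. *)
Lemma range_fix S A B z : is_orth_proj S (kernel_on A (rangeL2 B)) -> rangeL2 S z ->
  aeq (S z) z /\ exists2 z', kernel_on A (rangeL2 B) z' & aeq z z'.
Proof.
move=> SM [Lz [w Lw zw]]; have [Mw _] := SM w Lw.
split; last by exists (S w).
exact: (orth_proj_fix SM (@kernel_L2 _ _) Lz Mw zw).
Qed.

Lemma range_S1_orth z : rangeL2 S1 z -> inner ac z = 0.
Proof.
move=> /(range_fix hS1)[_ [z' [z'r _] zz']].
by rewrite (inner_ae (aeq_refl ac) zz'); exact: compl_proj_orth.
Qed.

Lemma M2_orth z : M2 z -> inner ac z = 0.
Proof. by move=> [zr _]; exact: range_S1_orth. Qed.

Lemma M2_moment z : M2 z -> cint (entry (mulop (adjfield v) z) 0) = 0.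
Proof. by move=> Mz; rewrite -inner_accol; exact: M2_orth. Qed.

(** Write P T z = k (a, c)^T. The equation S_1 T P T z = 0 means that T P T z
    is orthogonal to the range of S_1, in particular to z. By symmetry of T
    the scalar product of z and T P T z is |k|^2 times the square of the norm
    of (a, c)^T, so k = 0. *)
Lemma M2_inner_Top z : M2 z -> inner ac (T z) = 0.
Proof.
move=> Mz; have Lz := kernel_L2 Mz; have [zr T1z] := Mz.
have [S1z [z' Mz' zz']] := range_fix hS1 zr.
have LTz := is_L2_Top m ml1 ml2 rv Lz.
pose y := T (S1 z); have yT : aeq y (T z) by exact: Top_aeq.
have Ly : is_L2 y by exact: is_L2_eq (aeq_sym yT) LTz.
have {}T1z : aeq (S1 (T (P y))) (fun=> 0) := T1z.
clearbody y.
have [[LPy [k Pyk]] orthy] := hP Ly.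
have Mac : spanL2 ac ac.
  by split => //; exists 1; apply: aeW => x; rewrite scale1r.
have inner_Tz : inner ac (T z) = k * inner ac ac.
  have := orthy ac Mac; rewrite (innerBr Lac Ly LPy) (inner_ae (aeq_refl ac) yT).
  rewrite (inner_ae (aeq_refl ac) Pyk) (innerZr k Lac Lac) => /eqP.
  by rewrite subr_eq0 => /eqP.
have LTPy := is_L2_Top m ml1 ml2 rv LPy.
have /(orth_proj_eq0 hS1 (@kernel_L2 _ _) LTPy)/(_ z' Mz') := T1z.
rewrite -(inner_ae zz' (aeq_refl (T (P y)))) (Top_sym m ml1 ml2 rv Lz LPy).
rewrite (inner_ae Pyk (aeq_refl (T z))) (innerZl k LTz Lac) inner_Tz => /eqP.
rewrite conjC_eq0 mulf_eq0 conjC_eq0 mulf_eq0 (negbTE (inner_self_neq0 Lac ac0)) orbF orbb.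
by move=> /eqP ->; rewrite mul0r.
Qed.

Lemma range_S2_c0 phi : rangeL2 S2 phi -> c0 m (Ufield l1 l2) v phi = 0.
Proof.
move=> /(range_fix hS2)[_ [z Mz pz]]; rewrite /c0.
rewrite (inner_ae (aeq_refl ac) (Top_aeq m l1 l2 v pz)).
by rewrite (M2_inner_Top Mz) mul0r.
Qed.

Lemma sqr_conj_eq0 (a b : R[i]) : a^* * a + b^* * b = 0 -> a = 0 /\ b = 0.
Proof.
case: a => a1 a2; case: b => b1 b2 /(congr1 (@complex.Re R)) /= e.
have p1 := sqr_ge0 a1; have p2 := sqr_ge0 a2; have p3 := sqr_ge0 b1; have p4 := sqr_ge0 b2.
have sq0 (r : R) : r ^+ 2 = 0 -> r = 0 by move=> /eqP; rewrite sqrf_eq0 => /eqP.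
by split; apply: complex_ext; apply: sq0 => /=; lra.
Qed.

(** Both sides are equivalent to the vanishing of the two amplitudes of v^*
    phi. *)
Theorem threshold_resonance phi : rangeL2 S2 phi ->
  rangeL2 S3 phi <-> is_L2 (psi m (Ufield l1 l2) v phi).
Proof.
move=> hphi; have [Lphi _] := hphi.
have [S2phi [z Mz pz]] := range_fix hS2 hphi; have Lz := kernel_L2 Mz.
pose f := mulop (adjfield v) phi.
have df : spinor_density f by exact: spinor_density_adj.
have f0 : cint (entry f 0) = 0.
  by rewrite -inner_accol (inner_ae (aeq_refl ac) pz); exact: M2_orth.
have -> : is_L2 (psi m (Ufield l1 l2) v phi) <->
    amplitude1 m f = 0 /\ amplitude2 m f = 0.
  rewrite -(calG0_L2 m df f0) /psi (range_S2_c0 hphi) -/f.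
  split=> /(is_L2Z (-1)); apply: is_L2_eq; apply: aeW => x.
    by rewrite scale0r sub0r scaleN1r opprK.
  by rewrite scale0r sub0r scaleN1r.
have LG1 : is_L2 (mulop v (calG1 m f)) by exact: is_L2_calG1.
have pairing w : M2 w -> inner w (mulop v (calG1 m f)) = - (m^-1)%:C *
    ((amplitude1 m (mulop (adjfield v) w))^* * amplitude1 m f +
     (amplitude2 m (mulop (adjfield v) w))^* * amplitude2 m f).
  move=> Mw; rewrite inner_mulop; apply: inner_calG1 => //.
    exact: spinor_density_adj rv (kernel_L2 Mw).
  exact: M2_moment.
have T2E w : aeq w phi -> aeq (S2 w) w ->
    T2op m v S2 w = S2 (mulop v (calG1 m f)).
  move=> wp Sw; rewrite /T2op /=.
  by rewrite (calG1_aeq m (mulop_aeq (adjfield v) (aeq_trans Sw wp))).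
have S2G1 := orth_proj_eq0 hS2 (@kernel_L2 _ _) LG1.
split=> [/(range_fix hS3)[_ [w [wr T2w] pw]]|[a1 a2]].
  have [S2w _] := range_fix hS2 wr.
  move: T2w; rewrite (T2E w (aeq_sym pw) S2w) => /S2G1/(_ z Mz).
  rewrite -(inner_ae pz (aeq_refl (mulop v (calG1 m f)))) inner_mulop -/f (inner_calG1 m0 df df f0 f0) => /eqP.
  rewrite mulf_eq0 oppr_eq0 => /orP[|/eqP]; last exact: sqr_conj_eq0.
  by move=> /eqP/(congr1 (@complex.Re R)) /= /eqP; rewrite invr_eq0 (negbTE m0).
have M3phi : M3 phi.
  split=> //; rewrite (T2E phi (aeq_refl _) S2phi); apply/S2G1 => w Mw.
  by rewrite (pairing w Mw) a1 a2 !mulr0 addr0 mulr0.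
split => //; exists phi => //; apply: aeq_sym.
exact: (orth_proj_fix hS3 (@kernel_L2 _ _) Lphi M3phi (aeq_refl _)).
Qed.

End Threshold.

Theorem lemma7p9 (R : realType) (m : R) (hm : 0 < m)
  (V B : mxfield R) (l1 l2 : plane R -> R)
  (hVsa : forall x, (V x)^t* = V x)
  (hB : forall x, B x \is unitarymx)
  (hV : forall x, V x = Vfield l1 l2 B x)
  (hBmeas : forall i j, clmeasurable (fun x => B x i j))
  (hl1meas : lmeasurable l1) (hl2meas : lmeasurable l2)
  (U v : mxfield R)
  (hU : U = Ufield l1 l2) (hv : v = vfield l1 l2 B)
  (hac : ~ aeq (accol v) (fun=> 0))
  (C eps : R) (heps : 0 < eps)
  (hdecay : forall x i j,
     `|v x i j| <= (C * japanese x `^ (- 3 - eps))%:C)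
  (P S1 S2 S3 : spinor R -> spinor R)
  (hP : is_orth_proj P (spanL2 (accol v)))
  (hS1 : is_orth_proj S1
     (kernel_on (QTQ (Top m U v) P) (rangeL2 (compl_proj P))))
  (hS2 : is_orth_proj S2
     (kernel_on (T1op (Top m U v) P S1) (rangeL2 S1)))
  (hS3 : is_orth_proj S3
     (kernel_on (T2op m v S2) (rangeL2 S2)))
  (phi : spinor R) (hphi : rangeL2 S2 phi) :
  rangeL2 S3 phi <-> is_L2 (psi m U v phi).
Proof.
subst U v; have rv := vfield_rapid hl1meas hl2meas hBmeas heps hdecay.
exact: (threshold_resonance (lt0r_neq0 hm) hl1meas hl2meas rv hac hP hS1 hS2 hS3 hphi).
Qed.
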